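(* Let $T>0$ and $\omega,\mu\in\mathbb R$. Let $V\in C^1(\mathbb R)$ be $T$-periodic and real-valued. Let $M\in\mathbb N$ and $\theta\in\{\pm1\}^M$. Let $\psi_0\in H^2(\mathbb R)$ be a real-valued nondegenerate solution of $$-\psi''+\mu V(x)\psi+\omega\psi-\psi^3=0.\qquad(\ast)$$ Then there exists $N\in\mathbb N$ such that for each $n\in\mathbb N$ with $n\ge N$ the following hold. 1. There exists a real-valued nondegenerate solution $\psi_n$ of $(\ast)$ of the form $$\psi_n=\sum_{j=1}^M\theta_j\psi_0(\cdot-jnT)+a_n,$$ where $\{a_n\}_n$ is a sequence in $H^2(\mathbb R)$ converging to $0$ as $n\to\infty$. 2. There exists an $nT$-periodic real-valued solution $\psi_{{\rm per},n}$ of $(\ast)$ given by $$\psi_{{\rm per},n}(x)=\chi_n(x)\psi_0(x)+a_n(x),\qquad x\in[-\tfrac n2T,\tfrac n2T),$$ where (now) $\{a_n\}_n$ is a sequence with $a_n\in H^2_{\rm per}(0,nT)$ satisfying $\|a_n\|_{H^2_{\rm per}(0,nT)}\to0$ as $n\to\infty$.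
   Context: Equation $(\ast)$ describes real-valued stationary solutions of the focusing Gross–Pitaevskii equation $i\partial_t\psi=-\partial_x^2\psi+\mu V\psi+\omega\psi-|\psi|^2\psi$, equivalently stationary solutions of the real-valued equation $\partial_t\psi=-\partial_x^2\psi+\mu V\psi+\omega\psi-\psi^3$. A real-valued bounded solution $\psi$ of $(\ast)$ is nondegenerate (as a stationary solution of the latter) if the operator $\varphi\mapsto-\varphi''+\mu V\varphi+\omega\varphi-3\psi^2\varphi$ on $L^2(\mathbb R)$ with domain $H^2(\mathbb R)$ is invertible. $H^2_{\rm per}(0,L)$: $L$-periodic, locally $H^2$ functions with the $H^2(0,L)$-norm. For each (sufficiently large) $n$, $\chi_n:\mathbb R\to[0,1]$ is a smooth $nT$-periodic cut-off with $\|\chi_n\|_{W^{2,\infty}}\le1$ (maximum of sup norms of derivatives of order $\le2$), $\chi_n=1$ on $[-\frac n6T,\frac n6T]$, $\chi_n=0$ on $[-\frac n2T,-\frac n3T]\cup[\frac n3T,\frac n2T]$. *)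

(* Defs.v *)
(* Mathematical Components / MathComp-Analysis, over an arbitrary realType. *)
From HB Require Import structures.
From mathcomp Require Import all_boot all_order all_algebra.
From mathcomp Require Import all_classical all_reals all_analysis.

Set Implicit Arguments.
Unset Strict Implicit.
Unset Printing Implicit Defensive.

Import Order.TTheory GRing.Theory Num.Theory.
Import numFieldNormedType.Exports.

Local Open Scope classical_set_scope.
Local Open Scope ring_scope.

Definition smooth (R : realType) (f : R -> R) : Prop :=
  forall (k : nat) (x : R), derivable (derive1n k f) x 1.

Definition C1 (R : realType) (f : R -> R) : Prop :=
  (forall x : R, derivable f x 1) /\ continuous (derive1 f).

Definition test_function (R : realType) (phi : R -> R) : Prop :=
  smooth phi /\
  exists K : set R, compact K /\ (forall x : R, ~ K x -> phi x = 0).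

(* Elements of Lebesgue and Sobolev spaces are represented by functions
   R -> R; every notion below that concerns them is insensitive to changes on
   null sets, and no continuous representative is singled out. *)

Definition in_L2 (R : realType) (D : set R) (f : R -> R) : Prop :=
  (f \_ D : R -> R) \in Lfun (@lebesgue_measure R) 2%:E.

Definition in_L2loc (R : realType) (f : R -> R) : Prop :=
  forall K : set R, compact K -> in_L2 K f.

Definition L2norm (R : realType) (D : set R) (f : R -> R) : \bar R :=
  ('N[@lebesgue_measure R]_2%:E [EFin \o (f \_ D)])%E.

Definition is_weak_derivative (R : realType) (f g : R -> R) : Prop :=
  [/\ locally_integrable [set: R] f,
      locally_integrable [set: R] g &
      forall phi : R -> R, test_function phi ->
        \int[@lebesgue_measure R]_(x in [set: R]) (f x * derive1 phi x) =
        - \int[@lebesgue_measure R]_(x in [set: R]) (g x * phi x)].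

Definition weakly_derivable (R : realType) (f : R -> R) : Prop :=
  exists g : R -> R, is_weak_derivative f g.

(* A chosen representative of the weak derivative; it is meaningful only when
   [weakly_derivable f] (otherwise it is the zero function). *)
Definition wderiv (R : realType) (f : R -> R) : R -> R :=
  xget (fun=> 0) [set g : R -> R | is_weak_derivative f g].

Definition in_H2 (R : realType) (f : R -> R) : Prop :=
  [/\ weakly_derivable f, weakly_derivable (wderiv f),
      in_L2 [set: R] f, in_L2 [set: R] (wderiv f) &
      in_L2 [set: R] (wderiv (wderiv f))].

Definition in_H2loc (R : realType) (f : R -> R) : Prop :=
  [/\ weakly_derivable f, weakly_derivable (wderiv f),
      in_L2loc f, in_L2loc (wderiv f) & in_L2loc (wderiv (wderiv f))].

Definition H2norm (R : realType) (D : set R) (f : R -> R) : \bar R :=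
  ((L2norm D f ^+ 2 + L2norm D (wderiv f) ^+ 2
    + L2norm D (wderiv (wderiv f)) ^+ 2) `^ (2^-1))%E.

Definition in_H2per (R : realType) (L : R) (f : R -> R) : Prop :=
  periodic f L /\ in_H2loc f.

Definition H2per_norm (R : realType) (L : R) (f : R -> R) : \bar R :=
  H2norm `]0, L[ f.

(* Invertibility of an operator A on (real) L^2(R) with domain dom, in the
   usual sense for unbounded operators: A is a bijection from dom onto L^2(R)
   (up to equality almost everywhere) whose inverse is bounded on L^2(R). *)
Definition invertible_operator (R : realType) (dom : (R -> R) -> Prop)
    (A : (R -> R) -> (R -> R)) : Prop :=
  [/\ forall phi, dom phi -> in_L2 [set: R] (A phi),
      forall phi1 phi2, dom phi1 -> dom phi2 ->
        {ae @lebesgue_measure R, forall x, A phi1 x = A phi2 x} ->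
        {ae @lebesgue_measure R, forall x, phi1 x = phi2 x},
      forall g, in_L2 [set: R] g -> exists phi, dom phi /\
        {ae @lebesgue_measure R, forall x, A phi x = g x} &
      exists C : R, forall phi, dom phi ->
        (L2norm [set: R] phi <= C%:E * L2norm [set: R] (A phi))%E].

Definition is_solution (R : realType) (omega mu : R) (V : R -> R)
    (psi : R -> R) : Prop :=
  in_H2loc psi /\
  {ae @lebesgue_measure R, forall x,
    - wderiv (wderiv psi) x + mu * V x * psi x + omega * psi x
      - psi x ^+ 3 = 0}.

Definition linearization (R : realType) (omega mu : R) (V : R -> R)
    (psi : R -> R) (phi : R -> R) : R -> R :=
  fun x => - wderiv (wderiv phi) x + mu * V x * phi x + omega * phi x
           - 3 * psi x ^+ 2 * phi x.

Definition essentially_bounded (R : realType) (f : R -> R) : Prop :=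
  exists C : R, {ae @lebesgue_measure R, forall x, `|f x| <= C}.

Definition nondegenerate_solution (R : realType) (omega mu : R) (V : R -> R)
    (psi : R -> R) : Prop :=
  [/\ is_solution omega mu V psi, essentially_bounded psi &
      invertible_operator (@in_H2 R) (linearization omega mu V psi)].

Definition is_cutoff (R : realType) (T : R) (n : nat) (chi : R -> R) : Prop :=
  [/\ smooth chi,
      periodic chi (n%:R * T),
      forall x : R, 0 <= chi x <= 1,
      forall (k : nat) (x : R), (k <= 2)%N -> `|derive1n k chi x| <= 1 &
      (forall x : R, - (n%:R / 6 * T) <= x <= n%:R / 6 * T -> chi x = 1) /\
      (forall x : R, - (n%:R / 2 * T) <= x <= - (n%:R / 3 * T) \/
                 n%:R / 3 * T <= x <= n%:R / 2 * T -> chi x = 0)].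

(* Main.v *)
(* Near the superposition w of the translates of psi0, the ansatz psi = w + a
   turns the equation into - a'' + Q a = f with Q = mu V + omega - 3 w^2, where
   f consists of the residual of w and of terms of order two and three in a. The
   operator - d^2/dx^2 + Q is invertible with bounds that do not depend on n:
   gluing the inverses of the operators on both sides of a wide transition layer
   gives an approximate right inverse, hence by a Neumann-type fixed point an
   exact one, and self-adjointness turns surjectivity with bounds into
   injectivity with bounds. Since psi0 decays, the residual tends to 0 in L^2,
   and Banach's fixed point theorem on a ball of L^2 whose radius is a multiple
   of the residual gives a; invertibility at w + a follows because w + a is
   uniformly close to w. In the periodic case the inverse of the single-soliton
   operator, applied to data supported in one period, cut off and periodized,
   plays the same part.

   A function of H^2 is represented by a triple (u, p, h) with u' = p and p' = h
   in the sense of absolutely continuous functions; the lemma of du Bois-Reymond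
   relates this to weak derivatives. *)

Require Import Defs.
From HB Require Import structures.
From mathcomp Require Import all_boot all_order all_algebra.
From mathcomp Require Import all_classical all_reals all_analysis.
From mathcomp Require Import measurable_realfun ring lra.
Import Order.TTheory GRing.Theory Num.Theory.
Import numFieldNormedType.Exports.
Local Open Scope classical_set_scope.
Local Open Scope ring_scope.

Set Implicit Arguments.
Unset Strict Implicit.
Unset Printing Implicit Defensive.

(** * Square-integrable functions *)

Section L2_theory.
Context {R : realType}.
Local Notation mu := (@lebesgue_measure R).
Implicit Types (f g h : R -> R) (K M r : R).

(** The unknown of the nonlinear fixed points is the right-hand side f in L^2, not the correction a
    = A f. The H^2 regularity of a then comes from the solution operator A, and the sup bound on A f
    makes the quadratic and cubic terms contract in L^2. Solution operators are obtained by choice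
    and are known only through estimates, those on differences replacing linearity.

    Uniformity in n requires constants fixed before n. Gluing worsens the constant by an explicit
    amount depending only on it and on a bound of the potential, so an induction over the M bumps
    ends with a single constant. Its base case, the operator with potential mu V + omega alone, is
    not a hypothesis: it is glued from two copies of the single-soliton operator, translated by
    multiples of T, which preserve V, with their solitons moved far away in opposite directions.

    In the periodic part only existence is claimed, so an approximate right inverse suffices, and
    its error is absorbed directly in the nonlinear fixed point. *)

Definition summable_fun f := mu.-integrable setT (EFin \o f).

Lemma summable_dom f g : measurable_fun setT g -> summable_fun f ->
  (forall x, `|g x| <= `|f x|) -> summable_fun g.
Proof.
move=> mg sf gf; apply: (le_integrable _ _ _ sf) => //.
  exact/measurable_EFinP.
by move=> x _ /=; rewrite lee_fin.
Qed.

Lemma summableD f g : summable_fun f -> summable_fun g ->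
  summable_fun (fun x => f x + g x).
Proof. by move=> sf sg; exact: (integrableD measurableT sf sg). Qed.

Lemma summableZ a f : summable_fun f -> summable_fun (fun x => a * f x).
Proof. by move=> sf; exact: (integrableZl _ a sf). Qed.

Lemma summable_measurable f : summable_fun f -> measurable_fun setT f.
Proof. by move=> /measurable_int/measurable_EFinP. Qed.

Lemma ae_imp (P Q : R -> Prop) : (forall x, P x -> Q x) ->
  {ae mu, forall x, P x} -> {ae mu, forall x, Q x}.
Proof.
move=> PQ [A [mA A0 PA]]; exists A; split=> // x nQ; apply: PA => /= Px.
by apply: nQ; exact: PQ.
Qed.

Lemma ae_and (P Q : R -> Prop) : {ae mu, forall x, P x} ->
  {ae mu, forall x, Q x} -> {ae mu, forall x, P x /\ Q x}.
Proof.
move=> aP aQ; have := @filterI _ _ (ae_filter_ringOfSetsType mu) _ _ aP aQ.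
exact.
Qed.

Definition L2 f := measurable_fun setT f /\ summable_fun (fun x => f x ^+ 2).

Definition nrm f : R := Num.sqrt (\int[mu]_x (f x ^+ 2)).

(** Membership and bound travel together: [nrm] alone is a default real when the square is not
    integrable, and bundled estimates compose without side conditions. *)
Definition nb f (K : R) := L2 f /\ nrm f <= K.

Lemma nrm_ge0 f : 0 <= nrm f. Proof. exact: sqrtr_ge0. Qed.

Lemma nrm_sqr f : nrm f ^+ 2 = \int[mu]_x (f x ^+ 2).
Proof. by rewrite sqr_sqrtr// Rintegral_ge0// => x _; exact: sqr_ge0. Qed.

Lemma nb_ge0 f K : nb f K -> 0 <= K.
Proof. by move=> [_]; apply: le_trans; exact: nrm_ge0. Qed.

Lemma nb_nrm f : L2 f -> nb f (nrm f).
Proof. by move=> h; split. Qed.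

Lemma nb_le f K K' : nb f K -> K <= K' -> nb f K'.
Proof. by move=> [L h] h'; split=> //; exact: le_trans h'. Qed.

Lemma nb_L2 f K : nb f K -> L2 f. Proof. by case. Qed.

Lemma nb_measurable f K : nb f K -> measurable_fun setT f.
Proof. by case=> -[]. Qed.

Lemma nbP f K : 0 <= K -> L2 f -> (\int[mu]_x (f x ^+ 2)) <= K ^+ 2 -> nb f K.
Proof.
move=> K0 Lf fK; split=> //.
by rewrite -(@ler_pXn2r _ 2) ?nnegrE ?nrm_ge0// nrm_sqr.
Qed.

Lemma nb_sqr f K : nb f K -> (\int[mu]_x (f x ^+ 2)) <= K ^+ 2.
Proof.
move=> nf; rewrite -nrm_sqr; apply: lerXn2r; rewrite ?nnegrE ?nrm_ge0//.
  exact: nb_ge0 nf.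
by case: nf.
Qed.

Lemma nb_dom (M : R) f g K : 0 <= M -> nb f K -> measurable_fun setT g ->
  (forall x, `|g x| <= M * `|f x|) -> nb g (M * K).
Proof.
move=> M0 nf mg gf; have K0 := nb_ge0 nf.
have [[mf sf] fK] := nf.
have sq x : g x ^+ 2 <= M ^+ 2 * f x ^+ 2.
  by rewrite -(real_normK (num_real (g x))) -(real_normK (num_real (f x)))
    -exprMn ler_pXn2r ?nnegrE ?mulr_ge0.
have sg : summable_fun (fun x => g x ^+ 2).
  apply: (@summable_dom (fun x => M ^+ 2 * f x ^+ 2)).
  - exact: measurable_funX.
  - exact: summableZ.
  - move=> x; rewrite (ger0_norm (sqr_ge0 _)) (ger0_norm (mulr_ge0 (sqr_ge0 _) (sqr_ge0 _))).
    exact: sq.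
apply: nbP => //; first exact: mulr_ge0.
apply: (@le_trans _ _ (\int[mu]_x (M ^+ 2 * f x ^+ 2))).
  by apply: le_Rintegral => //; exact: summableZ.
rewrite RintegralZl// exprMn ler_wpM2l ?sqr_ge0//; exact: nb_sqr.
Qed.

Lemma nb_dom1 f g K : nb f K -> measurable_fun setT g ->
  (forall x, `|g x| <= `|f x|) -> nb g K.
Proof.
move=> nf mg gf; rewrite -[K]mul1r; apply: nb_dom nf mg _ => // x.
by rewrite mul1r.
Qed.

Lemma L2M_summable f g : L2 f -> L2 g -> summable_fun (fun x => f x * g x).
Proof.
move=> [mf sf] [mg sg].
apply: (@summable_dom (fun x => f x ^+ 2 + g x ^+ 2)).
- exact: measurable_funM.
- exact: summableD.
- move=> x; rewrite [leRHS]ger0_norm ?addr_ge0 ?sqr_ge0// normrM.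
  rewrite -(real_normK (num_real (f x))) -(real_normK (num_real (g x))).
  set a := `|f x|; set b := `|g x|.
  have a0 : 0 <= a by exact: normr_ge0. have b0 : 0 <= b by exact: normr_ge0.
  nra.
Qed.

Lemma CauchySchwarz f g : L2 f -> L2 g ->
  `|\int[mu]_x (f x * g x)| <= nrm f * nrm g.
Proof.
move=> Lf Lg; have sfg := L2M_summable Lf Lg.
have [mf sf] := Lf; have [mg sg] := Lg.
set I := \int[mu]_x (f x * g x).
have key (s t : R) : 0 <= s ^+ 2 * nrm f ^+ 2 + (2 * s * t) * I + t ^+ 2 * nrm g ^+ 2.
  have s1 := summableZ (s ^+ 2) sf; have s2 := summableZ (2 * s * t) sfg.
  have s3 := summableZ (t ^+ 2) sg; have s4 := summableD s1 s2.
  rewrite !nrm_sqr /I -!RintegralZl// -!RintegralD//.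
  apply: Rintegral_ge0 => x _.
  have -> : s ^+ 2 * f x ^+ 2 + 2 * s * t * (f x * g x) + t ^+ 2 * g x ^+ 2 =
     (s * f x + t * g x) ^+ 2 by ring.
  exact: sqr_ge0.
have a0 := nrm_ge0 f; have b0 := nrm_ge0 g.
move: (nrm f) (nrm g) a0 b0 key => a b a0 b0 key.
have key2 : I ^+ 2 <= (a * b) ^+ 2.
  have [a00|an0] := eqVneq a 0.
    have [->|I0] := eqVneq I 0; first by rewrite expr0n/= sqr_ge0.
    (* With [a = 0] the form is affine in s; this s gives it the value -1 if [I] is nonzero. *)
    have := key (- (b ^+ 2 + 1) / (2 * I)) 1; rewrite a00 expr0n/= mulr0 add0r.
    have -> : 2 * (- (b ^+ 2 + 1) / (2 * I)) * 1 * I = - (b ^+ 2 + 1) by field.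
    by rewrite expr1n mul1r; lra.
  (* The minimizer of the quadratic form up to scaling; its value is [a ^+ 2] times the desired
     difference. *)
  have := key (- I) (a ^+ 2).
  have -> : (- I) ^+ 2 * a ^+ 2 + 2 * - I * a ^+ 2 * I + (a ^+ 2) ^+ 2 * b ^+ 2 =
    a ^+ 2 * ((a * b) ^+ 2 - I ^+ 2) by ring.
  by rewrite pmulr_rge0 ?subr_ge0// exprn_gt0// lt_neqAle eq_sym an0.
rewrite -(@ler_pXn2r _ 2) ?nnegrE ?mulr_ge0//.
by rewrite real_normK ?num_real.
Qed.

Lemma nbD f g K K' : nb f K -> nb g K' -> nb (fun x => f x + g x) (K + K').
Proof.
move=> nf ng; have K0 := nb_ge0 nf; have K'0 := nb_ge0 ng.
have [Lf fK] := nf; have [Lg gK] := ng.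
have sfg := L2M_summable Lf Lg; have CS := CauchySchwarz Lf Lg.
have [mf sf] := Lf; have [mg sg] := Lg.
have E x : (f x + g x) ^+ 2 = f x ^+ 2 + 2 * (f x * g x) + g x ^+ 2 by ring.
have s2 := summableZ 2 sfg.
have s : summable_fun (fun x => (f x + g x) ^+ 2).
  rewrite (_ : (fun x => _) = (fun x => f x ^+ 2 + 2 * (f x * g x) + g x ^+ 2)).
    by apply: summableD => //; exact: summableD.
  by apply/funext => x; exact: E.
apply: nbP; first exact: addr_ge0.
  by split=> //; exact: measurable_funD.
under eq_Rintegral do rewrite E.
rewrite !RintegralD//=; last exact: summableD.
rewrite RintegralZl//=.
have := nb_sqr nf; have := nb_sqr ng.
move: CS; rewrite ler_norml => /andP[_ CS].
have : nrm f * nrm g <= K * K' by apply: ler_pM => //; exact: nrm_ge0.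
move: CS; nra.
Qed.

Lemma nbZ a f K : nb f K -> nb (fun x => a * f x) (`|a| * K).
Proof.
move=> nf; have mf := nb_measurable nf; apply: nb_dom nf _ _ => //.
  exact: measurable_funM.
by move=> x; rewrite normrM.
Qed.

Lemma nbN f K : nb f K -> nb (fun x => - f x) K.
Proof.
move=> nf; have mf := nb_measurable nf; apply: nb_dom1 nf _ _.
  exact: measurableT_comp.
by move=> x; rewrite normrN.
Qed.

Lemma nbB f g K K' : nb f K -> nb g K' -> nb (fun x => f x - g x) (K + K').
Proof. by move=> nf ng; apply: nbD => //; exact: nbN. Qed.

Lemma nb0 : nb (fun=> 0) 0.
Proof.
have L : L2 (fun=> 0).
  split=> //; rewrite expr0n/=; exact: integrable0.
by apply: nbP => //; rewrite expr0n/= (Rintegral_cst)// mul0r.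
Qed.

Lemma L2D f g : L2 f -> L2 g -> L2 (fun x => f x + g x).
Proof. by move=> /nb_nrm nf /nb_nrm ng; exact/nb_L2/(nbD nf ng). Qed.

Lemma L2B f g : L2 f -> L2 g -> L2 (fun x => f x - g x).
Proof. by move=> /nb_nrm nf /nb_nrm ng; exact/nb_L2/(nbB nf ng). Qed.

Lemma L2Z a f : L2 f -> L2 (fun x => a * f x).
Proof. by move=> /nb_nrm nf; exact/nb_L2/(nbZ a nf). Qed.

Lemma nb_ae f g K : nb f K -> measurable_fun setT g ->
  {ae mu, forall x, f x = g x} -> nb g K.
Proof.
move=> nf mg fg; have [[mf sf] fK] := nf.
have mf2 : measurable_fun setT (EFin \o (fun x => f x ^+ 2)).
  by apply/measurable_EFinP; exact: measurable_funX.
have mg2 : measurable_fun setT (EFin \o (fun x => g x ^+ 2)).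
  by apply/measurable_EFinP; exact: measurable_funX.
have E : (\int[mu]_x ((g x ^+ 2)%:E) = \int[mu]_x ((f x ^+ 2)%:E))%E.
  apply: ae_eq_integral => //.
  by apply: (ae_imp _ fg) => x /= ->.
have L : L2 g.
  split=> //; apply/integrableP; split=> //.
  under eq_integral do rewrite /= ger0_norm ?sqr_ge0//.
  rewrite E; move/integrableP : sf => [_].
  by under eq_integral do rewrite /= ger0_norm ?sqr_ge0//.
apply: nbP => //; first exact: nb_ge0 nf.
by rewrite /Rintegral E; exact: nb_sqr.
Qed.

Lemma nrm0_ae f : nb f 0 -> {ae mu, forall x, f x = 0}.
Proof.
move=> nf; have [[mf sf] f0] := nf.
have z : (\int[mu]_x (f x ^+ 2)) = 0.
  apply/eqP; rewrite eq_le Rintegral_ge0 ?andbT//; last by move=> x _; exact: sqr_ge0.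
  by have := nb_sqr nf; rewrite expr0n.
have e0 : (\int[mu]_x `| (f x ^+ 2)%:E | = 0)%E.
  under eq_integral do rewrite gee0_abs ?lee_fin ?sqr_ge0//.
  rewrite -[LHS]fineK; last exact: integrable_fin_num.
  by rewrite -[fine _]/(\int[mu]_x (f x ^+ 2)) z.
have m2 : measurable_fun setT (fun x => (f x ^+ 2)%:E).
  by apply/measurable_EFinP; exact: measurable_funX.
have := ae_eq_integral_abs mu measurableT m2; move=> [+ _] => /(_ e0).
apply: ae_imp => x /= /(_ I) [] /eqP.
by rewrite sqrf_eq0 => /eqP.
Qed.

End L2_theory.

(** * Completeness of L^2 and the contraction principle *)

Section L2_complete.
Context {R : realType}.
Local Notation mu := (@lebesgue_measure R).
Implicit Types (f g h : R -> R) (K M r : R).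

Lemma nb_lim f K C : (forall k, nb f (K + C / 2 ^+ k)) -> nb f K.
Proof.
move=> h; split; first exact: nb_L2 (h 0%N).
apply/ler_addgt0Pr => e e0.
have [C0|C0] := leP C 0.
  have := (h 0%N).2; rewrite expr0 divr1; lra.
have [k kC] : exists k : nat, C / e < 2 ^+ k.
  have h0 := @archi_boundP R (C / e) (divr_ge0 (ltW C0) (ltW e0)).
  exists (Num.bound (C / e)); apply: lt_le_trans h0 _.
  rewrite -natrX ler_nat; apply: ltnW; exact: ltn_expl.
apply: le_trans (h k).2 _; rewrite lerD2l.
by rewrite ler_pdivrMr ?exprn_gt0// mulrC -ler_pdivrMr// ltW.
Qed.

(** Riesz-Fischer: the partial sums [G] of the absolute increments are bounded in L^2, so by
    monotone convergence their limit is finite almost everywhere and the sequence converges there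
    absolutely. Fatou's lemma transfers the geometric rate to the limit. *)
Lemma L2_complete (f : nat -> R -> R) (r : R) :
  (forall k, L2 (f k)) ->
  (forall k, nb (fun x => f k.+1 x - f k x) (r / 2 ^+ k)) ->
  exists F, L2 F /\ forall k, nb (fun x => F x - f k x) (2 * r / 2 ^+ k).
Proof.
move=> Lf df.
have r0 : 0 <= r by have := nb_ge0 (df 0%N); rewrite expr0 divr1.
have mf k : measurable_fun setT (f k) by have [] := Lf k.
(* Keeping the subtracted remainder of the geometric series makes the induction on m close
   exactly. *)
have tail k m : nb (fun x => f (k + m)%N x - f k x)
    (2 * r / 2 ^+ k - 2 * r / 2 ^+ (k + m)).
  elim: m => [|m IH].
    rewrite addn0 subrr (_ : (fun x => _) = (fun=> 0)); first exact: nb0.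
    by apply/funext => x; rewrite subrr.
  have := nbD IH (df (k + m)%N).
  rewrite (_ : (fun x => _) = (fun x => f (k + m.+1)%N x - f k x)); last first.
    by apply/funext => x; rewrite addnS; ring.
  move=> /nb_le; apply; rewrite addnS exprS le_eqVlt; apply/orP; left; apply/eqP.
  have n0 : 2 ^+ (k + m) != 0 :> R by rewrite expf_neq0.
  have n1 : 2 ^+ k != 0 :> R by rewrite expf_neq0.
  by field; rewrite n0 n1.
have tail2 k m : nb (fun x => f (k + m)%N x - f k x) (2 * r / 2 ^+ k).
  by apply: nb_le (tail k m) _; rewrite gerBl divr_ge0 ?mulr_ge0 ?exprn_ge0.
pose G n x := \sum_(0 <= k < n) `|f k.+1 x - f k x|.
have mG n : measurable_fun setT (G n).
  apply: measurable_sum => k; apply: measurableT_comp => //.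
  exact: measurable_funB.
have nG n : nb (G n) (2 * r - 2 * r / 2 ^+ n).
  elim: n => [|n IH].
    rewrite expr0 divr1 subrr (_ : G 0%N = (fun=> 0)); first exact: nb0.
    by apply/funext => x; rewrite /G big_geq.
  have nd : nb (fun x => `|f n.+1 x - f n x|) (r / 2 ^+ n).
    apply: nb_dom1 (df n) _ _.
      by apply: measurableT_comp => //; exact: measurable_funB.
    by move=> x; rewrite normr_id.
  have := nbD IH nd.
  rewrite (_ : (fun x => _) = G n.+1); last first.
    by apply/funext => x; rewrite /G big_nat_recr.
  move=> /nb_le; apply; rewrite exprS le_eqVlt; apply/orP; left; apply/eqP.
  have n0 : 2 ^+ n != 0 :> R by rewrite expf_neq0.
  by field; rewrite n0.
have G0 n x : 0 <= G n x by apply: sumr_ge0.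
have Gnd x : {homo G ^~ x : n m / (n <= m)%N >-> n <= m}.
  move=> n m nm; rewrite /G (@big_cat_nat _ _ _ n 0 m)//= lerDl.
  exact: sumr_ge0.
pose G2 n x := ((G n x) ^+ 2)%:E.
have mG2 n : measurable_fun setT (G2 n).
  by apply/measurable_EFinP; exact: measurable_funX.
have G20 n x : setT x -> (0 <= G2 n x)%E by rewrite lee_fin sqr_ge0.
have G2nd x : setT x -> {homo G2 ^~ x : n m / (n <= m)%N >-> (n <= m)%E}.
  move=> _ n m nm; rewrite lee_fin; apply: lerXn2r; rewrite ?nnegrE//.
  exact: Gnd.
have MC := @cvg_monotone_convergence _ _ _ mu setT measurableT G2 mG2 G20 G2nd.
have IG : (\int[mu]_(x in setT) (limn (G2^~ x)) <= ((2 * r) ^+ 2)%:E)%E.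
  rewrite -(cvg_lim _ MC)//; apply: lime_le; first by apply/cvg_ex; eexists; exact: MC.
  apply: nearW => n /=.
  have [[_ s] _] := nG n.
  have nGn : nb (G n) (2 * r).
    by apply: nb_le (nG n) _; rewrite gerBl divr_ge0 ?mulr_ge0 ?exprn_ge0.
  rewrite /G2 -[X in (X <= _)%E]fineK; last exact: (integrable_fin_num measurableT s).
  by rewrite lee_fin; exact: nb_sqr nGn.
have iG : mu.-integrable setT (fun x => limn (G2^~ x)).
  apply/integrableP; split.
    apply: (@emeasurable_fun_cvg _ _ _ setT G2 _ mG2) => x _.
    by apply: ereal_nondecreasing_is_cvgn => n m; exact: G2nd.
  apply: le_lt_trans (ltry ((2 * r) ^+ 2)).
  apply: le_trans IG; rewrite le_eqVlt; apply/orP; left; apply/eqP.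
  apply: eq_integral => x _; rewrite gee0_abs//.
  apply: lime_ge; first by apply: ereal_nondecreasing_is_cvgn => n m; exact: G2nd.
  by apply: nearW => n; exact: G20.
have fin := integrable_ae measurableT iG.
have cv : {ae mu, forall x, cvgn (fun n => f n x)}.
  apply: (ae_imp _ fin) => x /(_ I) fx.
  have ub : has_ubound (range (G^~ x)).
    exists (1 + fine (limn (G2^~ x))) => _ [n _ <-].
    have : G n x ^+ 2 <= fine (limn (G2^~ x)).
      rewrite -lee_fin fineK//; apply: lime_ge.
        by apply: ereal_nondecreasing_is_cvgn => p q; exact: G2nd.
      by exists n => // m /= nm; exact: (G2nd x I n m nm).
    have := G0 n x; nra.
  have cG : cvgn (series (fun k => f k.+1 x - f k x)).
    apply: normed_cvg; have := nondecreasing_is_cvgn (@Gnd x) ub.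
    by rewrite /G.
  have E : (fun n => f n x) = (fun n => f 0%N x + series (fun k => f k.+1 x - f k x) n).
    apply/funext => n; rewrite /series/= telescope_sumr//; lra.
  by rewrite E; apply: is_cvgD => //; exact: is_cvg_cst.
(* The upper limit is measurable without restriction to the set of convergence, on which it equals
   the limit. *)
pose F x := fine (limn_esup (fun n => (f n x)%:E)).
have mF : measurable_fun setT F.
  apply: measurableT_comp; first exact: fine_measurable.
  by apply: measurable_fun_limn_esup => n; exact/measurable_EFinP.
have cF : {ae mu, forall x, f n x @[n --> \oo] --> F x}.
  apply: (ae_imp _ cv) => x /cvg_ex [l fl].
  have fl' : (f n x)%:E @[n --> \oo] --> l%:E.
    by apply: cvg_EFin => //; exact: nearW.
  by have [_ E] := cvg_limn_einf_sup fl'; rewrite /F E.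
have nF k : nb (fun x => F x - f k x) (2 * r / 2 ^+ k).
  have K0 : 0 <= 2 * r / 2 ^+ k by rewrite divr_ge0 ?mulr_ge0 ?exprn_ge0.
  pose h m x := (((f (k + m)%N x - f k x) ^+ 2)%:E : \bar R).
  have mh m : measurable_fun setT (h m).
    by apply/measurable_EFinP/measurable_funX; exact: measurable_funB.
  have h0 m x : setT x -> (0 <= h m x)%E by rewrite lee_fin sqr_ge0.
  have FT := @fatou _ _ _ mu setT measurableT h mh h0.
  have mFk : measurable_fun setT (fun x => (F x - f k x) ^+ 2).
    by apply: measurable_funX; exact: measurable_funB.
  have I1 : (\int[mu]_x (((F x - f k x) ^+ 2)%:E) <= ((2 * r / 2 ^+ k) ^+ 2)%:E)%E.
    apply: le_trans (le_trans _ FT) _.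
      apply: ae_ge0_le_integral => //.
      - by move=> x _; rewrite lee_fin sqr_ge0.
      - exact/measurable_EFinP.
      - move=> x _; rewrite limn_einf_lim; apply: lime_ge; first exact: is_cvg_einfs.
        by apply: nearW => n; apply: le_ereal_inf_tmp => _ [m /= nm <-]; exact: h0.
      - rewrite /limn_einf; apply: measurableT_comp => //.
        apply: (@measurable_fun_limn_esup _ _ _ setT (fun n x => - h n x)%E) => n.
        exact: measurableT_comp.
      apply: (ae_imp _ cF) => x cFx _.
      have cc : h n x @[n --> \oo] --> ((F x - f k x) ^+ 2)%:E.
        apply: cvg_EFin; first exact: nearW.
        have c1 : (f (k + n)%N x - f k x) @[n --> \oo] --> F x - f k x.
          apply: cvgB; last exact: cvg_cst.
          under eq_fun do rewrite addnC.
          by have := cFx; rewrite -(cvg_shiftn k).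
        exact: (cvgM c1 c1).
      by have [-> _] := cvg_limn_einf_sup cc.
    rewrite limn_einf_lim; apply: lime_le; first exact: is_cvg_einfs.
    apply: nearW => n; apply: ge_ereal_inf; exists (\int[mu]_x h n x)%E.
      by exists n => //=.
    have [[_ s] _] := tail2 k n.
    rewrite -[X in (X <= _)%E]fineK; last exact: (integrable_fin_num measurableT s).
    by rewrite lee_fin; exact: nb_sqr (tail2 k n).
  have L : L2 (fun x => F x - f k x).
    split; first exact: measurable_funB.
    apply/integrableP; split; first exact/measurable_EFinP.
    apply: le_lt_trans (ltry ((2 * r / 2 ^+ k) ^+ 2)).
    apply: le_trans I1; rewrite le_eqVlt; apply/orP; left; apply/eqP.
    by apply: eq_integral => x _; rewrite gee0_abs// lee_fin sqr_ge0.
  apply: nbP => //; rewrite -lee_fin fineK//.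
  by have [_ s] := L; exact: (integrable_fin_num measurableT s).
exists F; split=> //.
have := L2D (nb_L2 (nF 0%N)) (Lf 0%N).
rewrite (_ : (fun x => _) = F)//.
by apply/funext => x; rewrite subrK.
Qed.

(** Picard iteration from 0. The fixed-point equation holds only almost everywhere, because it is
    read off from the vanishing of the L^2 norm of [F - Phi F]. *)
Lemma L2_fixpoint (Phi : (R -> R) -> R -> R) (r : R) : 0 <= r ->
  (forall f, nb f r -> nb (Phi f) r) ->
  (forall f g K, nb f r -> nb g r -> nb (fun x => f x - g x) K ->
     nb (fun x => Phi f x - Phi g x) (K / 2)) ->
  exists f, nb f r /\ {ae mu, forall x, f x = Phi f x}.
Proof.
move=> r0 PhiB PhiC.
pose f k := iter k Phi (fun=> 0).
have nf k : nb (f k) r.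
  elim: k => [|k IH]; last exact: PhiB.
  exact: nb_le nb0 r0.
have df k : nb (fun x => f k.+1 x - f k x) (2 * r / 2 ^+ k).
  elim: k => [|k IH].
    rewrite expr0 divr1; apply: nb_le (nbB (nf 1%N) (nf 0%N)) _.
    by rewrite mulrDl mul1r.
  have := PhiC _ _ _ (nf k.+1) (nf k) IH.
  rewrite exprS [2 * 2 ^+ k]mulrC invfM mulrA; exact.
have [F [LF nF]] := L2_complete (fun k => nb_L2 (nf k)) df.
have nFr : nb F r.
  apply: (@nb_lim _ _ (2 * (2 * r))) => k.
  have := nbD (nf k) (nF k).
  rewrite (_ : (fun x => _) = F)//.
  by apply/funext => x; rewrite subrKC.
exists F; split=> //.
have z : nb (fun x => F x - Phi F x) 0.
  apply: (@nb_lim _ _ (6 * r)) => k; rewrite add0r.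
  have h1 := nF k.+1.
  have h2 := PhiC _ _ _ (nf k) nFr.
  have h3 : nb (fun x => f k x - F x) (2 * (2 * r) / 2 ^+ k).
    apply: nb_dom1 (nF k) _ _ => [|x]; last by rewrite distrC.
    apply: measurable_funB; exact: nb_measurable.
  have := nbD h1 (h2 _ h3).
  rewrite (_ : (fun x => _) = (fun x => F x - Phi F x)); last first.
    by apply/funext => x; rewrite /f/=; ring.
  move=> /nb_le; apply; rewrite exprS.
  have n0 : 2 ^+ k != 0 :> R by rewrite expf_neq0.
  have p0 : 0 <= r / 2 ^+ k by rewrite divr_ge0 ?exprn_ge0.
  have -> : 2 * (2 * r) / (2 * 2 ^+ k) = 2 * (r / 2 ^+ k) by field.
  lra.
by apply: ae_imp (nrm0_ae z) => x /eqP; rewrite subr_eq0 => /eqP.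
Qed.

End L2_complete.

(** * Translations and integrals over intervals *)

Section translation.
Context {R : realType}.
Local Notation mu := (@lebesgue_measure R).
Implicit Types f g h : R -> R.

Lemma measurable_shift (t : R) : measurable_fun setT (fun x : R => x + t).
Proof. by apply: measurable_funD. Qed.

(** The image measure has the same values on half-open intervals, and these determine Lebesgue
    measure. *)
Lemma lebesgue_measure_shift (t : R) (A : set R) : measurable A ->
  mu A = pushforward mu (fun x : R => x + t) A.
Proof.
move=> mA.
have mt : measurable_fun [set: measurableTypeR R]
    ((fun x : R => x + t) : measurableTypeR R -> measurableTypeR R).
  exact: measurable_shift.
apply: (@lebesgue_measure_unique R
  (measure_function_pushforward__canonical__measure_function_Measure mu mt) _ A mA).
move=> X [] [a b] /= ab <-.
rewrite /pushforward.
have -> : (fun x : R => x + t) @^-1` `]a, b]%classic = `]a - t, b - t]%classic.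
  apply/seteqP; split => x /=; rewrite !in_itv/=.
    by rewrite ltrBlDr lerBrDr.
  by rewrite ltrBlDr lerBrDr.
rewrite !lebesgue_measure_itv/= !lte_fin ltrD2r.
by case: ifPn => // _; congr (_%:E); ring.
Qed.

Lemma ge0_integral_shift (t : R) (f : R -> \bar R) :
  measurable_fun setT f -> (forall x, 0 <= f x)%E ->
  (\int[mu]_x f (x + t)%R = \int[mu]_x f x)%E.
Proof.
move=> mf f0.
have mt : measurable_fun [set: measurableTypeR R]
    ((fun x : R => x + t) : measurableTypeR R -> measurableTypeR R).
  exact: measurable_shift.
have := @ge0_integral_pushforward _ _ _ _ _ _ mt mu setT f measurableT mf
   (fun x _ => f0 x).
rewrite preimage_setT => <-.
apply: eq_measure_integral => A mA _; apply/esym.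
exact: (lebesgue_measure_shift t mA).
Qed.

Lemma integral_shift (t : R) (f : R -> \bar R) : measurable_fun setT f ->
  (\int[mu]_x f (x + t)%R = \int[mu]_x f x)%E.
Proof.
move=> mf; rewrite integralE [RHS]integralE; congr (_ - _)%E.
  rewrite -[RHS](ge0_integral_shift t)//; last exact: measurable_funepos.
  by apply: eq_integral => x _; rewrite !funeposE.
rewrite -[RHS](ge0_integral_shift t)//; last exact: measurable_funeneg.
by apply: eq_integral => x _; rewrite !funenegE.
Qed.

Lemma ae_shift (t : R) (P : R -> Prop) : {ae mu, forall x, P x} ->
  {ae mu, forall x, P (x + t)}.
Proof.
move=> [A [mA A0 PA]]; exists ((fun x => x + t) @^-1` A); split.
- by rewrite -[X in measurable X]setTI; exact: measurable_shift.
- by have := lebesgue_measure_shift t mA; rewrite A0 => /esym.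
- by move=> x nP; exact: PA.
Qed.

Lemma nb_shift (t : R) f K : nb f K -> nb (fun x => f (x + t)) K.
Proof.
move=> nf; have [[mf sf] _] := nf.
have mft : measurable_fun setT (fun x : R => f (x + t)).
  by apply: measurableT_comp => //; exact: measurable_shift.
have m2 : measurable_fun setT (fun x => (f x ^+ 2)%:E).
  by apply/measurable_EFinP; exact: measurable_funX.
have E : (\int[mu]_x ((f (x + t)) ^+ 2)%:E = \int[mu]_x (f x ^+ 2)%:E)%E.
  rewrite (@ge0_integral_shift t (fun x => (f x ^+ 2)%:E))// => x.
  by rewrite lee_fin sqr_ge0.
apply: nbP; [exact: nb_ge0 nf| |].
  split=> //; apply/integrableP; split.
    by apply/measurable_EFinP; exact: measurable_funX.
  under eq_integral do rewrite gee0_abs ?lee_fin ?sqr_ge0//.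
  by rewrite E; exact: (integrable_lty measurableT sf).
by rewrite /Rintegral E; exact: nb_sqr.
Qed.

End translation.

(** * Locally summable functions and integrals over compact intervals *)

Section locally_summable.
Context {R : realType}.
Local Notation mu := (@lebesgue_measure R).
Implicit Types f g h : R -> R.

Definition lint f := measurable_fun setT f /\
  forall a b : R, mu.-integrable `[a, b] (EFin \o f).

Lemma continuous_lint f : continuous f -> lint f.
Proof.
move=> cf; split; first exact: continuous_measurable_fun.
move=> a b; apply: continuous_compact_integrable; first exact: segment_compact.
exact: continuous_subspaceT.
Qed.

Lemma summable_lint f : summable_fun f -> lint f.
Proof.
move=> sf; split; first exact: summable_measurable.
by move=> a b; apply: integrableS sf.
Qed.

Lemma lint_dom f g : measurable_fun setT g -> lint f ->
  (forall x, `|g x| <= `|f x|) -> lint g.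
Proof.
move=> mg [mf lf] gf; split=> // a b; apply: (le_integrable _ _ _ (lf a b)) => //.
  by apply/measurable_EFinP; exact: measurable_funTS.
by move=> x _ /=; rewrite lee_fin.
Qed.

Lemma lintD f g : lint f -> lint g -> lint (fun x => f x + g x).
Proof.
move=> [mf lf] [mg lg]; split; first exact: measurable_funD.
by move=> a b; apply: (@integrableD _ _ _ mu `[a, b] _ _ _ (lf a b) (lg a b)).
Qed.

Lemma lintZ c f : lint f -> lint (fun x => c * f x).
Proof.
move=> [mf lf]; split; first exact: measurable_funM.
by move=> a b; apply: (@integrableZl _ _ _ mu `[a, b] _ c _ (lf a b)).
Qed.

Lemma lintN f : lint f -> lint (fun x => - f x).
Proof.
move=> lf; have := lintZ (-1) lf.
by under eq_fun do rewrite mulN1r.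
Qed.

Lemma lintB f g : lint f -> lint g -> lint (fun x => f x - g x).
Proof. by move=> lf lg; apply: lintD => //; exact: lintN. Qed.

Lemma lint_abs f : lint f -> lint (fun x => `|f x|).
Proof.
move=> lf; apply: (lint_dom _ lf); last by move=> x; rewrite normr_id.
by apply: measurableT_comp => //; case: lf.
Qed.

(** Not an oriented integral: for a > b the interval is empty and the value is 0. Hence the
    hypotheses a <= b below. *)
Definition J a b f : R := \int[mu]_(x in `[a, b]) f x.

Lemma eq_J a b f g : (forall x, a <= x <= b -> f x = g x) -> J a b f = J a b g.
Proof.
by move=> fg; apply: eq_Rintegral => x; rewrite inE/= in_itv/=; exact: fg.
Qed.

Lemma JD a b f g : lint f -> lint g -> J a b (fun x => f x + g x) = J a b f + J a b g.
Proof. by move=> [_ lf] [_ lg]; apply: RintegralD. Qed.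

Lemma JB a b f g : lint f -> lint g -> J a b (fun x => f x - g x) = J a b f - J a b g.
Proof. by move=> [_ lf] [_ lg]; apply: RintegralB. Qed.

Lemma JZ a b c f : lint f -> J a b (fun x => c * f x) = c * J a b f.
Proof. by move=> [_ lf]; apply: RintegralZl. Qed.

Lemma le_J a b f g : lint f -> lint g ->
  (forall x, a <= x <= b -> f x <= g x) -> J a b f <= J a b g.
Proof.
by move=> [_ lf] [_ lg] fg; apply: le_Rintegral => // x /=; rewrite in_itv/=; exact: fg.
Qed.

Lemma J_ge0 a b f : (forall x, a <= x <= b -> 0 <= f x) -> 0 <= J a b f.
Proof.
by move=> fg; apply: Rintegral_ge0 => x /=; rewrite in_itv/=; exact: fg.
Qed.

Lemma le_normJ a b f : lint f -> `|J a b f| <= J a b (fun x => `|f x|).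
Proof. by move=> [_ lf]; apply: le_normr_Rintegral. Qed.

Lemma J_cst a b c : a <= b -> J a b (fun=> c) = c * (b - a).
Proof.
move=> ab; rewrite /J Rintegral_cst//; congr (_ * _).
have E : mu `[a, b]%classic = (b - a)%:E.
  rewrite lebesgue_measure_itv/= lte_fin.
  by move: ab; rewrite le_eqVlt => /predU1P[->|->//]; rewrite ltxx subrr.
exact: (congr1 fine E).
Qed.

Lemma J_cat a b c f : lint f -> a <= b -> b <= c -> J a c f = J a b f + J b c f.
Proof.
move=> [_ lf] ab bc; have := @Rintegral_itvB R f (BLeft a) (BRight c) b (lf a c).
rewrite !bnd_simp => /(_ ab bc) /eqP; rewrite subr_eq addrC => /eqP; rewrite /J => ->.
rewrite Rintegral_itv_obnd_cbnd//.
by apply: integrableS (lf b c) => //; exact: subset_itv_oc_cc.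
Qed.

Lemma J_ge0_sub a b c d f : lint f -> (forall x, 0 <= f x) ->
  c <= a -> a <= b -> b <= d -> J a b f <= J c d f.
Proof.
move=> lf f0 ca ab bd.
rewrite (J_cat lf (le_trans ca ab) bd) (J_cat lf ca ab).
by rewrite -addrA addrCA lerDl addr_ge0// J_ge0.
Qed.

(** Nonnegativity of the variance: expand the integral of [((b - a) * f x - I) ^+ 2]. *)
Lemma J_sqr_le a b f : lint f -> lint (fun x => f x ^+ 2) -> a <= b ->
  J a b f ^+ 2 <= (b - a) * J a b (fun x => f x ^+ 2).
Proof.
move=> lf lf2; rewrite le_eqVlt => /predU1P[->|ab].
  by rewrite /J set_itv1 !Rintegral_set1 expr0n/= mulr0.
set I := J a b f.
have key : 0 <= J a b (fun x => ((b - a) * f x - I) ^+ 2).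
  by apply: J_ge0 => x _; exact: sqr_ge0.
have lc c : lint (fun=> c) by apply: continuous_lint; exact: cst_continuous.
have E : (fun x => ((b - a) * f x - I) ^+ 2) =
    (fun x => (b - a) ^+ 2 * f x ^+ 2 + ((- (2 * (b - a) * I)) * f x + I ^+ 2)).
  by apply/funext => x; ring.
rewrite {}E JD ?JZ// ?JD ?JZ ?J_cst ?(ltW ab)// in key; last 3 first.
- exact: lintZ.
- exact: lintZ.
- by apply: lintD => //; exact: lintZ.
move: key; rewrite -/I.
have -> : (b - a) ^+ 2 * J a b (fun x => f x ^+ 2) +
   (- (2 * (b - a) * I) * I + I * (I * (b - a))) =
   (b - a) * ((b - a) * J a b (fun x => f x ^+ 2) - I ^+ 2) by ring.
by rewrite pmulr_rge0 ?subr_gt0// subr_ge0.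
Qed.

Lemma J_shift a b t f : lint f -> J a b (fun x => f (x + t)) = J (a + t) (b + t) f.
Proof.
move=> [mf _]; rewrite /J /Rintegral integral_mkcond [in RHS]integral_mkcond; congr fine.
rewrite -[RHS](integral_shift t).
  apply: eq_integral => x _; rewrite !patchE !mem_setE/= !in_itv/=.
  by rewrite !lerD2r.
by apply/(measurable_restrictT _ _).1 => //; exact/measurable_EFinP/measurable_funTS.
Qed.

(** Monotone convergence for |f| on the symmetric intervals [-n, n]. The remainder is controlled by
    that of |f|, which shrinks as the interval grows; so both endpoints may move independently. *)
Lemma J_cvg_full f (e : R) : summable_fun f -> 0 < e ->
  exists r : R, 0 <= r /\ forall a b, a <= - r -> r <= b ->
    `|\int[mu]_x f x - J a b f| <= e.
Proof.
move=> sf e0.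
have sa : summable_fun (fun x => `|f x|).
  apply: (summable_dom _ sf) => [|x]; last by rewrite normr_id.
  by apply: measurableT_comp => //; exact: summable_measurable.
have la := summable_lint sa; have lf := summable_lint sf.
have split_int g a b : summable_fun g ->
    \int[mu]_x g x - J a b g = \int[mu]_(x in ~` `[a, b]) g x.
  move=> sg; rewrite /J -{1}(setUv `[a, b]%classic) Rintegral_setU//.
  - by rewrite addrC addKr.
  - exact: measurableC.
  - by rewrite setUv.
  - by apply/disj_setPCl.
have tail a b : `|\int[mu]_x f x - J a b f| <= \int[mu]_x `|f x| - J a b (fun x => `|f x|).
  rewrite !split_int//; apply: le_normr_Rintegral; first exact: measurableC.
  by apply: integrableS sf => //; exact: measurableC.
pose F (n : nat) : set R := `[- n%:R, n%:R]%classic.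
have cF : (\int[mu]_(x in F i) (`|f x|)%:E @[i --> \oo] -->
    \int[mu]_(x in \bigcup_i F i) (`|f x|)%:E)%E.
  apply: ge0_nondecreasing_set_cvg_integral.
  - move=> n m nm; apply/subsetPset => x; rewrite /F/= !in_itv/= => /andP[nx xn].
    by rewrite (le_trans _ nx) ?lerN2 ?ler_nat// (le_trans xn) ?ler_nat.
  - by move=> i; exact: measurable_itv.
  - by move=> i; apply: measurable_funTS; apply/measurable_EFinP; exact: summable_measurable.
  - by move=> i x _; rewrite lee_fin.
have UF : \bigcup_i F i = setT.
  apply/seteqP; split => // x _.
  exists (Num.bound `|x|) => //; rewrite /F/= in_itv/= -ler_norml.
  by apply: ltW; exact: archi_boundP.
rewrite UF in cF.
have cJ : J (- n%:R) n%:R (fun x => `|f x|) @[n --> \oo] --> \int[mu]_x `|f x|.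
  apply: (fine_cvg (a := _)); rewrite /Rintegral fineK//.
  exact: (integrable_fin_num measurableT sa).
move/cvgrPdist_le : cJ => /(_ e e0) [n _ /(_ n (leqnn n))/= nP].
exists n%:R; split=> // a b an nb; apply: le_trans (tail a b) _.
apply: le_trans (le_trans (ler_norm _) nP); rewrite lerD2l lerN2.
apply: J_ge0_sub => //.
by rewrite ge0_cp.
Qed.

End locally_summable.

(** * Absolutely continuous functions and H^2 *)

Section absolutely_continuous.
Context {R : realType}.
Local Notation mu := (@lebesgue_measure R).
Implicit Types f g h p q u v k : R -> R.

(* [W1 p h]: p is absolutely continuous, with p' = h locally in L^2. *)
Definition W1 p h := [/\ lint h, lint (fun x => h x ^+ 2) &
  forall a b, a <= b -> p b - p a = J a b h].

(** Local Hoelder continuity of exponent 1/2, from [J_sqr_le] applied to h on the unit neighbourhood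
    of x. *)
Lemma W1_continuous p h : W1 p h -> continuous p.
Proof.
move=> [lh lh2 ph] x; apply/cvgrPdist_le => e e0.
set M := J (x - 1) (x + 1) (fun x => h x ^+ 2).
have M0 : 0 <= M by apply: J_ge0 => y _; exact: sqr_ge0.
have key a b : x - 1 <= a -> a <= b -> b <= x + 1 -> (p b - p a) ^+ 2 <= (b - a) * M.
  move=> xa ab bx; rewrite ph//; apply: le_trans (J_sqr_le lh lh2 ab) _.
  by rewrite ler_wpM2l ?subr_ge0//; apply: J_ge0_sub => // y; exact: sqr_ge0.
near=> y.
have yx : `|x - y| <= 1 by near: y; apply: cvgr_dist_le => //; exact: cvg_id.
have yxe : `|x - y| <= e ^+ 2 / (M + 1).
  by near: y; apply: cvgr_dist_le; [exact: cvg_id|rewrite divr_gt0 ?exprn_gt0// ltr_wpDl].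
rewrite -(@ler_pXn2r _ 2) ?nnegrE ?(ltW e0)// real_normK ?num_real//.
apply: (@le_trans _ _ (`|x - y| * M)).
  have [xy|yx'] := leP x y.
    rewrite -sqrrN opprB (ler0_norm (_ : x - y <= 0)) ?subr_le0// opprB.
    by move: yx; rewrite ler0_norm ?subr_le0// => yx; apply: key; lra.
  rewrite (gtr0_norm (_ : 0 < x - y)) ?subr_gt0//.
  by move: yx; rewrite gtr0_norm ?subr_gt0// => yx; apply: key; lra.
apply: (@le_trans _ _ (e ^+ 2 / (M + 1) * (M + 1))).
  by apply: ler_pM => //; lra.
by rewrite divfK// gt_eqF// ltr_wpDl.
Unshelve. all: by end_near. Qed.

Lemma W1_lint p h : W1 p h -> lint p.
Proof. by move=> /W1_continuous; exact: continuous_lint. Qed.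

Lemma W1_measurable p h : W1 p h -> measurable_fun setT p.
Proof. by move=> /W1_lint[]. Qed.

Lemma continuous_lint_sqr p : continuous p -> lint (fun x => p x ^+ 2).
Proof.
move=> cp; apply: continuous_lint => x.
under eq_fun do rewrite expr2.
by apply: continuousM; exact: cp.
Qed.

Lemma W1_lint_sqr p h : W1 p h -> lint (fun x => p x ^+ 2).
Proof. by move=> /W1_continuous; exact: continuous_lint_sqr. Qed.

Lemma lint_sqr_dom f g h : measurable_fun setT g -> lint (fun x => f x ^+ 2) ->
  lint (fun x => h x ^+ 2) -> (forall x, `|g x| <= `|f x| + `|h x|) ->
  lint (fun x => g x ^+ 2).
Proof.
move=> mg lf lh gf; apply: (lint_dom _ (lintZ 2 (lintD lf lh))).
  exact: measurable_funX.
move=> x; rewrite ger0_norm ?sqr_ge0// ger0_norm; last first.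
  by rewrite mulr_ge0 ?addr_ge0 ?sqr_ge0.
rewrite -(real_normK (num_real (g x))) -(real_normK (num_real (f x))).
rewrite -(real_normK (num_real (h x))).
have := gf x; move: (normr_ge0 (g x)) (normr_ge0 (f x)) (normr_ge0 (h x)).
move: `|g x| `|f x| `|h x| => a b c a0 b0 c0 abc.
have : a ^+ 2 <= (b + c) ^+ 2 by apply: lerXn2r => //; rewrite nnegrE addr_ge0.
have := sqr_ge0 (b - c); nra.
Qed.

Lemma lint_sqrD f g : lint f -> lint g -> lint (fun x => f x ^+ 2) ->
  lint (fun x => g x ^+ 2) -> lint (fun x => (f x + g x) ^+ 2).
Proof.
move=> [mf _] [mg _] lf lg; apply: (lint_sqr_dom _ lf lg).
  exact: measurable_funD.
by move=> x; exact: ler_normD.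
Qed.

Lemma W1D p q h k : W1 p h -> W1 q k -> W1 (fun x => p x + q x) (fun x => h x + k x).
Proof.
move=> [lh lh2 ph] [lk lk2 qk]; split; [exact: lintD|exact: lint_sqrD|].
by move=> a b ab; rewrite JD// -ph// -qk//; ring.
Qed.

Lemma W1Z c p h : W1 p h -> W1 (fun x => c * p x) (fun x => c * h x).
Proof.
move=> [lh lh2 ph]; split; [exact: lintZ| |].
  by under eq_fun do rewrite exprMn; exact: lintZ.
by move=> a b ab; rewrite JZ// -ph//; ring.
Qed.

Lemma W1N p h : W1 p h -> W1 (fun x => - p x) (fun x => - h x).
Proof.
move=> /(W1Z (-1)); under eq_fun do rewrite mulN1r.
by under [X in W1 _ X -> _]eq_fun do rewrite mulN1r.
Qed.

Lemma W1B p q h k : W1 p h -> W1 q k -> W1 (fun x => p x - q x) (fun x => h x - k x).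
Proof. by move=> ph qk; apply: W1D => //; exact: W1N. Qed.

Lemma W1_cst c : W1 (fun=> c) (fun=> 0).
Proof.
have l0 : lint (fun=> (0 : R)) by apply: continuous_lint; exact: cst_continuous.
split => //; first by rewrite expr0n.
by move=> a b ab; rewrite J_cst// mul0r subrr.
Qed.

Lemma eq_W1 p p' h h' : p =1 p' -> h =1 h' -> W1 p h -> W1 p' h'.
Proof. by move=> /funext -> /funext ->. Qed.

Lemma W1_ae p h h' : W1 p h -> measurable_fun setT h' ->
  {ae mu, forall x, h x = h' x} -> W1 p h'.
Proof.
move=> [lh lh2 ph] mh' hh'.
have ae_lint f f' : lint f -> measurable_fun setT f' ->
    {ae mu, forall x, f x = f' x} -> lint f' /\ forall a b, J a b f = J a b f'.
  move=> [mf lf] mf' ff'.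
  have mE g a b : measurable_fun setT g -> measurable_fun (`[a, b] : set R) (EFin \o g).
    by move=> mg; apply/measurable_EFinP; exact: measurable_funTS.
  split.
    split=> // a b; apply/integrableP; split; first exact: mE.
    have /integrableP[_] := lf a b; apply: le_lt_trans.
    rewrite le_eqVlt; apply/orP; left; apply/eqP/ae_eq_integral => //.
    - by apply: measurableT_comp => //; exact: mE.
    - by apply: measurableT_comp => //; exact: mE.
    - by apply: (ae_imp _ ff') => x /= ->.
  move=> a b; rewrite /J /Rintegral; congr fine.
  by apply: ae_eq_integral => //; [exact: mE|exact: mE|apply: (ae_imp _ ff') => x ->].
have [l1 j1] := ae_lint _ _ lh mh' hh'.
have [|l2 _] := ae_lint _ (fun x => h' x ^+ 2) lh2 (measurable_funX _ mh').
  by apply: (ae_imp _ hh') => x ->.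
by split=> // a b ab; rewrite ph.
Qed.

Lemma lintM f g : lint f -> lint g -> lint (fun x => f x ^+ 2) ->
  lint (fun x => g x ^+ 2) -> lint (fun x => f x * g x).
Proof.
move=> [mf _] [mg _] lf lg; apply: (lint_dom _ (lintD lf lg)).
  exact: measurable_funM.
move=> x; rewrite [leRHS]ger0_norm ?addr_ge0 ?sqr_ge0// normrM.
rewrite -(real_normK (num_real (f x))) -(real_normK (num_real (g x))).
move: (normr_ge0 (f x)) (normr_ge0 (g x)); move: `|f x| `|g x| => a b; nra.
Qed.

Lemma lint_continuousM f g : continuous f -> lint g -> lint (fun x => f x * g x).
Proof.
move=> cf [mg lg].
have mfg : measurable_fun setT (fun x => f x * g x).
  by apply: measurable_funM => //; exact: continuous_measurable_fun.
split=> // a b.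
have cf2 : {within `[a, b], continuous f} by exact: continuous_subspaceT.
have [M [Mr Mf]] := compact_bounded (continuous_compact cf2 (@segment_compact R a b)).
apply: (@le_integrable _ _ _ mu `[a, b] _ _ (EFin \o (fun x => (M + 1) * g x))) => //.
- by apply/measurable_EFinP; exact: measurable_funTS.
- move=> x abx /=; rewrite lee_fin !normrM ler_wpM2r//.
  apply: le_trans (ler_norm _).
  apply: (Mf (M + 1)); first by rewrite ltrDl.
  by exists x.
- exact: (@integrableZl _ _ _ mu `[a, b] _ (M + 1) _ (lg a b)).
Qed.

Lemma lint_sqrM f g : continuous f -> lint (fun x => g x ^+ 2) ->
  lint (fun x => (f x * g x) ^+ 2).
Proof.
move=> cf lg; under eq_fun do rewrite exprMn.
apply: lint_continuousM => // x; under eq_fun do rewrite expr2.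
by apply: continuousM; exact: cf.
Qed.

(* On [a, b] the defect of the product rule is at most (b - a) times the
   additive quantity \int_a^b (h^2 + k^2); halving the interval repeatedly
   therefore shows that it vanishes. *)
Lemma W1M p q h k : W1 p h -> W1 q k ->
  W1 (fun x => p x * q x) (fun x => h x * q x + p x * k x).
Proof.
move=> Wp Wq; have cp := W1_continuous Wp; have cq := W1_continuous Wq.
have [lh lh2 ph] := Wp; have [lk lk2 qk] := Wq.
have lp := W1_lint Wp; have lq := W1_lint Wq.
have lp2 := W1_lint_sqr Wp; have lq2 := W1_lint_sqr Wq.
have lhq : lint (fun x => h x * q x) by exact: lintM.
have lpk : lint (fun x => p x * k x) by exact: lintM.
have ltot := lintD lhq lpk.
split=> //.
  apply: lint_sqrD => //; last exact: lint_sqrM.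
  by under eq_fun do rewrite mulrC; exact: lint_sqrM.
pose G a b := p b * q b - p a * q a - J a b (fun x => h x * q x + p x * k x).
pose m a b := J a b (fun x => h x ^+ 2 + k x ^+ 2).
have lm : lint (fun x => h x ^+ 2 + k x ^+ 2) by exact: lintD.
have m_ge0 a b : 0 <= m a b by apply: J_ge0 => x _; rewrite addr_ge0 ?sqr_ge0.
have G0 a b : a <= b -> `|G a b| <= (b - a) * m a b.
  move=> ab.
  pose H := J a b (fun x => `|h x|); pose K := J a b (fun x => `|k x|).
  have H0 : 0 <= H by apply: J_ge0. have K0 : 0 <= K by apply: J_ge0.
  have HK : H * K + K * H <= (b - a) * m a b.
    have h1 := J_sqr_le (lint_abs lh) (_ : lint (fun x => `|h x| ^+ 2)) ab.
    have h2 := J_sqr_le (lint_abs lk) (_ : lint (fun x => `|k x| ^+ 2)) ab.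
    have e1 : (fun x => `|h x| ^+ 2) = (fun x => h x ^+ 2).
      by apply/funext => x; rewrite real_normK ?num_real.
    have e2 : (fun x => `|k x| ^+ 2) = (fun x => k x ^+ 2).
      by apply/funext => x; rewrite real_normK ?num_real.
    rewrite e1 in h1; rewrite e2 in h2.
    have HK2 := sqr_ge0 (H - K).
    move: (h1 lh2) (h2 lk2); rewrite -/H -/K /m JD// mulrDr.
    move: (_ * J _ _ _) (_ * J _ _ _) => X Y; nra.
  (* Since p b (q b - q a) + q a (p b - p a) is exactly the increment of the product, only the
     oscillations of p and q on [a, b] remain, and these are bounded by [H] and [K]. *)
  have E : G a b = J a b (fun x => k x * (p b - p x) + h x * (q a - q x)).
    rewrite (@eq_J _ a b _ (fun x => (p b * k x + q a * h x) - (h x * q x + p x * k x))); last first.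
      by move=> x _; ring.
    rewrite JB//; last by apply: lintD; exact: lintZ.
    rewrite JD ?JZ//; [|exact: lintZ|exact: lintZ].
    by rewrite -ph// -qk// /G; ring.
  have lin1 : lint (fun x => k x * (p b - p x)).
    under eq_fun do rewrite mulrBr.
    apply: lintB; first by under eq_fun do rewrite mulrC; exact: lintZ.
    by under eq_fun do rewrite mulrC.
  have lin2 : lint (fun x => h x * (q a - q x)).
    under eq_fun do rewrite mulrBr.
    by apply: lintB => //; under eq_fun do rewrite mulrC; exact: lintZ.
  apply: le_trans HK; rewrite E; apply: le_trans (le_normJ _ _ (lintD lin1 lin2)) _.
  have lha := lint_abs lh; have lka := lint_abs lk.
  have bd x : a <= x <= b ->
      `|k x * (p b - p x) + h x * (q a - q x)| <= H * `|k x| + K * `|h x|.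
    move=> /andP[ax xb].
    apply: le_trans (ler_normD _ _) _; rewrite !normrM [H * _]mulrC [K * _]mulrC.
    apply: lerD; apply: ler_wpM2l => //.
      rewrite ph//; apply: le_trans (le_normJ _ _ lh) _.
      by apply: J_ge0_sub.
    rewrite distrC qk//; apply: le_trans (le_normJ _ _ lk) _.
    by apply: J_ge0_sub.
  apply: le_trans (le_J _ _ bd) _.
  - by apply: lint_abs; exact: lintD.
  - by apply: lintD; exact: lintZ.
  - by rewrite JD ?JZ//; exact: lintZ.
have Gk n a b : a <= b -> `|G a b| <= (b - a) / 2 ^+ n * m a b.
  elim: n a b => [|n IH] a b ab; first by rewrite expr0 divr1; exact: G0.
  pose c := (a + b) / 2.
  have ac : a <= c by rewrite /c; lra. have cb : c <= b by rewrite /c; lra.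
  have -> : G a b = G a c + G c b by rewrite /G (J_cat ltot ac cb); ring.
  apply: le_trans (ler_normD _ _) _.
  apply: le_trans (lerD (IH _ _ ac) (IH _ _ cb)) _.
  have -> : m a b = m a c + m c b by rewrite /m (J_cat lm ac cb).
  rewrite mulrDr; apply: lerD; apply: ler_wpM2r => //; rewrite exprS invfM mulrA.
    by apply: ler_wpM2r; rewrite ?invr_ge0 ?exprn_ge0// /c; lra.
  by apply: ler_wpM2r; rewrite ?invr_ge0 ?exprn_ge0// /c; lra.
move=> a b ab; apply/eqP; rewrite -subr_eq0 -normr_le0 -/(G a b).
apply/ler_addgt0Pr => e e0; rewrite add0r.
have D0 : 0 <= (b - a) * m a b by rewrite mulr_ge0 ?subr_ge0.
have h0 := archi_boundP (divr_ge0 D0 (ltW e0)).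
set n := Num.bound _ in h0.
apply: le_trans (Gk n a b ab) _.
rewrite mulrAC ler_pdivrMr ?exprn_gt0// -ler_pdivrMl// [e^-1 * _]mulrC.
apply/ltW/(lt_le_trans h0); rewrite -natrX ler_nat; apply: ltnW; exact: ltn_expl.
Qed.

Lemma lint_shift t f : lint f -> lint (fun x => f (x + t)).
Proof.
move=> [mf lf].
have mft : measurable_fun setT (fun x : R => f (x + t)).
  by apply: measurableT_comp => //; exact: measurable_shift.
split=> // a b; apply/integrableP; split.
  by apply/measurable_EFinP; exact: measurable_funTS.
have /integrableP[_] := lf (a + t) (b + t); apply: le_lt_trans.
rewrite integral_mkcond [leRHS]integral_mkcond -[leRHS](integral_shift t).
  rewrite le_eqVlt; apply/orP; left; apply/eqP; apply: eq_integral => x _.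
  by rewrite !patchE !mem_setE/= !in_itv/= !lerD2r.
apply/(measurable_restrictT _ _).1 => //; apply: measurableT_comp => //.
by apply/measurable_EFinP; exact: measurable_funTS.
Qed.

Lemma W1_shift t p h : W1 p h -> W1 (fun x => p (x + t)) (fun x => h (x + t)).
Proof.
move=> [lh lh2 ph]; split; [exact: lint_shift|exact: (lint_shift t lh2)|].
by move=> a b ab; rewrite J_shift// -ph// lerD2r.
Qed.

Lemma W1_deriv (p h : R -> R) : (forall x, derivable p x 1) -> derive1 p =1 h ->
  continuous h -> W1 p h.
Proof.
move=> dp ph ch; split; [exact: continuous_lint|exact: continuous_lint_sqr|].
move=> a b; rewrite le_eqVlt => /predU1P[->|ab].
  by rewrite subrr /J set_itv1 Rintegral_set1.
rewrite /J /Rintegral (@continuous_FTC2 _ h p)//.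
- exact: continuous_subspaceT.
- split.
  + by move=> x _; exact: dp.
  + apply: cvg_at_right_filter; apply: differentiable_continuous.
    by apply/derivable1_diffP; exact: dp.
  + apply: cvg_at_left_filter; apply: differentiable_continuous.
    by apply/derivable1_diffP; exact: dp.
Qed.

End absolutely_continuous.

(** * Sobolev embedding, decay and integration by parts on the line *)

Section H2_functions.
Context {R : realType}.
Local Notation mu := (@lebesgue_measure R).
Implicit Types f g h p q u v k : R -> R.

(* [H2 u p h]: the function u is in H^2(R), with u' = p and u'' = h. *)
Definition H2 u p h := [/\ W1 u p, W1 p h, L2 u, L2 p & L2 h].

Definition vanishing f := forall e : R, 0 < e ->
  exists r : R, forall x, r <= `|x| -> `|f x| <= e.

Lemma L2_lint_sqr f : L2 f -> lint (fun x => f x ^+ 2).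
Proof. by move=> [_ /summable_lint]. Qed.

(** Compare u at x with u at y in the unit window to the right, using - 2 u u' <= u^2 + u'^2, and
    average over y. *)
Lemma W1_sqr_le u p x : W1 u p ->
  u x ^+ 2 <= 2 * J x (x + 1) (fun y => u y ^+ 2 + p y ^+ 2).
Proof.
move=> Wu; have [lp lp2 _] := Wu; have lu2 := W1_lint_sqr Wu.
have W2 := W1M Wu Wu; have [l2 _ u2] := W2.
have ls : lint (fun y => u y ^+ 2 + p y ^+ 2) by exact: lintD.
set A := J x (x + 1) (fun y => u y ^+ 2 + p y ^+ 2).
have A0 : J x (x + 1) (fun y => u y ^+ 2) <= A.
  by apply: le_J => // y _; rewrite lerDl sqr_ge0.
have pt y : x <= y <= x + 1 -> u x ^+ 2 <= u y ^+ 2 + A.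
  move=> /andP[xy yx].
  have : - (u y * u y - u x * u x) <= A.
    rewrite u2//.
    apply: (@le_trans _ _ (J x y (fun y => u y ^+ 2 + p y ^+ 2))); last first.
      by apply: J_ge0_sub => // z; rewrite addr_ge0 ?sqr_ge0.
    rewrite -mulN1r -JZ//; apply: le_J => //; first exact: lintZ.
    by move=> z _; have := sqr_ge0 (u z + p z); nra.
  by rewrite !expr2; lra.
have lc c : lint (fun=> c) by apply: continuous_lint; exact: cst_continuous.
have : J x (x + 1) (fun=> u x ^+ 2) <= J x (x + 1) (fun y => u y ^+ 2 + A).
  by apply: le_J => //; exact: lintD.
by rewrite JD// !J_cst ?lerDl//; lra.
Qed.

Lemma J_le_full a b f : summable_fun f -> (forall x, 0 <= f x) ->
  J a b f <= \int[mu]_x f x.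
Proof.
move=> sf f0; apply/ler_addgt0Pr => e e0.
have [r [r0 h]] := J_cvg_full sf e0.
have := h (Num.min a (- r)) (Num.max b r).
rewrite ge_min lexx orbT le_max lexx orbT => /(_ isT isT).
rewrite ler_norml => /andP[h1 _].
have [ab|ba] := leP a b; last first.
  rewrite {1}/J set_itv_ge ?Rintegral_set0; last by rewrite bnd_simp -ltNge.
  by rewrite addr_ge0 ?(ltW e0)// Rintegral_ge0.
apply: (@le_trans _ _ (J (Num.min a (- r)) (Num.max b r) f)); last lra.
apply: J_ge0_sub => //; first exact: summable_lint.
  by rewrite ge_min lexx.
by rewrite le_max lexx.
Qed.

(** The Sobolev embedding; [2 * K] is the square root of [2 * (K ^+ 2 + K ^+ 2)]. *)
Lemma W1_sup u p K x : W1 u p -> nb u K -> nb p K -> `|u x| <= 2 * K.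
Proof.
move=> Wu nu np; have K0 := nb_ge0 nu.
rewrite -(@ler_pXn2r _ 2) ?nnegrE ?mulr_ge0// real_normK ?num_real//.
apply: le_trans (W1_sqr_le x Wu) _.
have [[_ su] _] := nu; have [[_ sp] _] := np.
apply: (@le_trans _ _ (2 * (K ^+ 2 + K ^+ 2))); last by rewrite exprMn; lra.
rewrite ler_pM2l//; apply: le_trans (J_le_full _ _ (summableD su sp) _) _.
  by move=> y; rewrite addr_ge0 ?sqr_ge0.
by rewrite RintegralD//; apply: lerD; exact: nb_sqr.
Qed.

Lemma W1_vanishing u p : W1 u p -> L2 u -> L2 p -> vanishing u.
Proof.
move=> Wu [mu' su] [mp sp] e e0.
have ss := summableD su sp.
have e2 : 0 < e ^+ 2 / 2 by rewrite divr_gt0 ?exprn_gt0.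
have [r [r0 h]] := J_cvg_full ss e2.
(* For negative x the window [x, x + 1] must still end to the left of -r. *)
exists (r + 1) => x rx.
rewrite -(@ler_pXn2r _ 2) ?nnegrE ?(ltW e0)// real_normK ?num_real//.
apply: le_trans (W1_sqr_le x Wu) _.
have ls := summable_lint ss.
have f0 y : 0 <= u y ^+ 2 + p y ^+ 2 by rewrite addr_ge0 ?sqr_ge0.
suff : J x (x + 1) (fun y => u y ^+ 2 + p y ^+ 2) <= e ^+ 2 / 2 by lra.
set f := (fun y => _) in ss h ls f0 *.
have [x0|x0] := leP 0 x.
  rewrite ger0_norm// in rx.
  have := h (- r) x (lexx _) (_ : r <= x); rewrite ler_norml => /(_ _)/andP[|_ h1]; first lra.
  have := J_le_full (- r) (x + 1) ss f0.
  by rewrite (@J_cat _ (- r) x (x + 1))//; lra.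
rewrite ltr0_norm// in rx.
have := h (x + 1) r (_ : x + 1 <= - r) (lexx _); rewrite ler_norml => /(_ _)/andP[|_ h1]; first lra.
have := J_le_full x r ss f0.
by rewrite (@J_cat _ x (x + 1) r)//; lra.
Qed.

Lemma integral_derivative0 G g : W1 G g -> summable_fun g -> vanishing G ->
  \int[mu]_x g x = 0.
Proof.
move=> [_ _ WG] sg vG; apply/eqP; rewrite -normr_le0.
apply/ler_addgt0Pr => e e0; rewrite add0r.
have e3 : 0 < e / 3 by rewrite divr_gt0.
have [r [r0 h]] := J_cvg_full sg e3; have [s hs] := vG _ e3.
pose t := Num.max r `|s|.
have t0 : 0 <= t by rewrite le_max r0.
have rt : r <= t by rewrite le_max lexx.
have st : s <= t by rewrite le_max (ler_norm s) orbT.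
have := h (- t) t; rewrite lerN2 => /(_ rt rt).
rewrite -WG ?ge0_cp// => h1.
have := hs t; rewrite ger0_norm// => /(_ st) h2.
have := hs (- t); rewrite normrN ger0_norm// => /(_ st) h3.
move: h1 h2 h3; rewrite !ler_norml => /andP[? ?] /andP[? ?] /andP[? ?].
by apply/andP; split; lra.
Qed.

Lemma vanishing_bound f g M : vanishing f -> (forall x, `|g x| <= M) ->
  vanishing (fun x => f x * g x).
Proof.
move=> vf gM e e0.
have M0 : 0 <= M by apply: le_trans (gM 0); exact: normr_ge0.
have M1 : 0 < M + 1 by rewrite ltr_wpDl.
have [r h] := vf _ (divr_gt0 e0 M1); exists r => x /h fx.
rewrite normrM; apply: (@le_trans _ _ (e / (M + 1) * (M + 1))).
  by apply: ler_pM => //; apply: le_trans (gM x) _; rewrite lerDl.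
by rewrite divfK// gt_eqF.
Qed.

Lemma W1_bounded u p : W1 u p -> L2 u -> L2 p -> exists M, forall x, `|u x| <= M.
Proof.
move=> Wu Lu Lp.
exists (2 * (nrm u + nrm p)) => x; apply: (W1_sup _ Wu).
  by apply: nb_le (nb_nrm Lu) _; rewrite lerDl nrm_ge0.
by apply: nb_le (nb_nrm Lp) _; rewrite lerDr nrm_ge0.
Qed.

(** Green's identity: the difference of the integrands is the derivative of p v - u q, which tends
    to 0 at both ends. *)
Lemma H2_symmetric u p h v q k : H2 u p h -> H2 v q k ->
  \int[mu]_x (h x * v x) = \int[mu]_x (u x * k x).
Proof.
move=> [Wu Wp Lu Lp Lh] [Wv Wq Lv Lq Lk].
have s1 := L2M_summable Lh Lv; have s2 := L2M_summable Lu Lk.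
apply/eqP; rewrite -subr_eq0 -RintegralB//; apply/eqP.
have W := W1B (W1M Wp Wv) (W1M Wu Wq).
apply: integral_derivative0.
- apply: eq_W1 W => // x /=; ring.
- by have := summableD s1 (summableZ (-1) s2); under eq_fun do rewrite mulN1r.
- move=> e e0; have e2 : 0 < e / 2 by rewrite divr_gt0.
  have [Mv hv] := W1_bounded Wv Lv Lq; have [Mu hu] := W1_bounded Wu Lu Lp.
  have [r hr] := vanishing_bound (W1_vanishing Wp Lp Lh) hv e2.
  have [s hs] := vanishing_bound (W1_vanishing Wq Lq Lk) hu e2.
  exists (Num.max r s) => x; rewrite ge_max => /andP[/hr h1 /hs h2].
  apply: le_trans (ler_normB _ _) _; move: h1 h2; rewrite [q x * _]mulrC; lra.
Qed.

(** Integrating (u u')' shows that the squared norm of u' is minus the integral of u u'', hence at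
    most A B. *)
Lemma H2_interpolation u p h A B : H2 u p h -> nb u A -> nb h B -> nb p (A + B).
Proof.
move=> [Wu Wp Lu Lp Lh] nu nh; have A0 := nb_ge0 nu; have B0 := nb_ge0 nh.
have s1 := L2M_summable Lp Lp; have s2 := L2M_summable Lu Lh.
have z : \int[mu]_x (p x * p x + u x * h x) = 0.
  apply: integral_derivative0 (W1M Wu Wp) (summableD s1 s2) _.
  have [M hM] := W1_bounded Wp Lp Lh.
  exact: vanishing_bound (W1_vanishing Wu Lu Lp) hM.
rewrite RintegralD// in z.
apply: nbP => //; first exact: addr_ge0.
have -> : (fun x => p x ^+ 2) = (fun x => p x * p x) by apply/funext => x; rewrite expr2.
have := CauchySchwarz Lu Lh; rewrite ler_norml => /andP[h1 _].
have : nrm u * nrm h <= A * B.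
  by apply: ler_pM; rewrite ?nrm_ge0//; [case: nu|case: nh].
nra.
Qed.

Lemma H2D u p h v q k : H2 u p h -> H2 v q k ->
  H2 (fun x => u x + v x) (fun x => p x + q x) (fun x => h x + k x).
Proof.
by move=> [? ? ? ? ?] [? ? ? ? ?]; split; [exact: W1D|exact: W1D|exact: L2D|exact: L2D|exact: L2D].
Qed.

Lemma H2Z c u p h : H2 u p h ->
  H2 (fun x => c * u x) (fun x => c * p x) (fun x => c * h x).
Proof.
by move=> [? ? ? ? ?]; split; [exact: W1Z|exact: W1Z|exact: L2Z|exact: L2Z|exact: L2Z].
Qed.

Lemma H2B u p h v q k : H2 u p h -> H2 v q k ->
  H2 (fun x => u x - v x) (fun x => p x - q x) (fun x => h x - k x).
Proof.
by move=> [? ? ? ? ?] [? ? ? ? ?]; split; [exact: W1B|exact: W1B|exact: L2B|exact: L2B|exact: L2B].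
Qed.

Lemma H2_0 : H2 (fun=> 0) (fun=> 0) (fun=> 0).
Proof.
have W := W1_cst (0 : R); have L := nb_L2 (@nb0 R).
by split.
Qed.

Lemma H2_shift t u p h : H2 u p h ->
  H2 (fun x => u (x + t)) (fun x => p (x + t)) (fun x => h (x + t)).
Proof.
have Ls f : L2 f -> L2 (fun x => f (x + t)).
  by move=> /nb_nrm/(nb_shift t)/nb_L2.
by move=> [? ? ? ? ?]; split; [exact: W1_shift|exact: W1_shift|exact: Ls|exact: Ls|exact: Ls].
Qed.

Lemma H2_ae u p h h' : H2 u p h -> measurable_fun setT h' ->
  {ae mu, forall x, h x = h' x} -> H2 u p h'.
Proof.
move=> [Wu Wp Lu Lp Lh] mh' hh'; split=> //; first exact: W1_ae hh'.
exact/nb_L2/(nb_ae (nb_nrm Lh) mh' hh').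
Qed.

End H2_functions.

(** * Smooth functions and weak derivatives *)

Section smooth_functions.
Context {R : realType}.
Local Notation mu := (@lebesgue_measure R).
Implicit Types f g h phi chi : R -> R.

Lemma smooth_derivable f x : smooth f -> derivable f x 1.
Proof. by move=> sf; exact: (sf 0%N x). Qed.

Lemma smooth_derive1 f : smooth f -> smooth (derive1 f).
Proof. by move=> sf k x; have := sf k.+1 x; rewrite derive1Sn. Qed.

Lemma smooth_continuous f : smooth f -> continuous f.
Proof.
move=> sf x; apply: differentiable_continuous.
by apply/derivable1_diffP; exact: smooth_derivable.
Qed.

(** Coinduction for smoothness. It avoids formulas for higher derivatives: it suffices to exhibit a
    class of differentiable functions that is stable under differentiation. *)
Lemma smooth_class (P : (R -> R) -> Prop) :
  (forall f, P f -> (forall x, derivable f x 1) /\ P (derive1 f)) ->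
  forall f, P f -> smooth f.
Proof.
move=> PP f Pf k; elim: k f Pf => [|k IH] f Pf x; first by have [df _] := PP _ Pf; exact: df.
by rewrite derive1Sn; apply: IH; have [] := PP _ Pf.
Qed.

Lemma smooth_cst c : smooth (fun=> c : R).
Proof.
apply: (@smooth_class (fun f => exists c, f = (fun=> c))); last by exists c.
move=> _ [d ->]; split; first by move=> x; exact: derivable_cst.
by exists 0; apply/funext => x; rewrite derive1_cst.
Qed.

Lemma is_derive_affine f (c d x : R) : derivable f (c * x + d) 1 ->
  is_derive x 1 (fun y => f (c * y + d)) (c * derive1 f (c * x + d)).
Proof.
move=> df.
have da : is_derive x 1 (fun y : R => c * y + d) c.
  have H := is_deriveD (is_deriveZ c (is_derive_id x (1 : R))) (is_derive_cst d x (1 : R)).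
  by apply: (@is_derive_eq _ _ _ _ _ _ _ _ H); rewrite addr0 /GRing.scale/= mulr1.
have dal : derivable (fun y : R => c * y + d) x 1 by case: da.
have E := derive1_comp dal df.
apply: DeriveDef.
  apply/derivable1_diffP; apply: differentiable_comp.
    by move/derivable1_diffP : dal.
  by move/derivable1_diffP : df.
rewrite -derive1E -[LHS]/(derive1 (f \o (fun y => c * y + d)) x) E mulrC; congr (_ * _).
by rewrite derive1E; exact: (@derive_val _ _ _ _ _ _ _ da).
Qed.

Lemma smooth_affine f (c d : R) : smooth f -> smooth (fun x => f (c * x + d)).
Proof.
move=> sf.
apply: (@smooth_class (fun h => exists g e, smooth g /\ h = (fun x => e * g (c * x + d)))).
  move=> _ [g [e [sg ->]]].
  have D (x : R) : is_derive x 1 (fun y : R => e * g (c * y + d)) (e * (c * derive1 g (c * x + d))).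
    have := is_derive_affine (@smooth_derivable g (c * x + d) sg) => H.
    exact: (@is_deriveZ _ _ _ _ e).
  split; first by move=> x; case: (D x).
  exists (derive1 g), (e * c); split; first exact: smooth_derive1.
  by apply/funext => x; rewrite derive1E (@derive_val _ _ _ _ _ _ _ (D x)) mulrA.
by exists f, 1; split=> //; apply/funext => x; rewrite mul1r.
Qed.

Lemma smoothB f g : smooth f -> smooth g -> smooth (fun x => f x - g x).
Proof.
move=> sf sg.
apply: (@smooth_class (fun h => exists f g, [/\ smooth f, smooth g & h = (fun x => f x - g x)])).
  move=> _ [u [v [su sv ->]]].
  have du x : derivable u x 1 := @smooth_derivable u x su.
  have dv x : derivable v x 1 := @smooth_derivable v x sv.
  split; first by move=> x; exact: derivableB.
  exists (derive1 u), (derive1 v); split; [exact: smooth_derive1|exact: smooth_derive1|].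
  by apply/funext => x; rewrite !derive1E deriveB.
by exists f, g.
Qed.

Lemma smooth_local f :
  (forall x : R, exists g, smooth g /\ \forall y \near x, f y = g y) -> smooth f.
Proof.
apply: (@smooth_class (fun f => forall x : R, exists g, smooth g /\ \forall y \near x, f y = g y)).
move=> {}f lf; split=> [x|x]; have [g [sg fg]] := lf x.
  apply: (@near_eq_derivable _ _ _ g); last exact: smooth_derivable.
  by apply: filterS fg => y ->.
exists (derive1 g); split; first exact: smooth_derive1.
have := near_join fg; apply: filterS => y fgy.
by rewrite !derive1E; exact: near_eq_derive.
Qed.

(** With l = n T / 2 half a period, chi vanishes for 2 l / 3 <= |x| <= l, so replacing it by 0
    outside the period preserves smoothness. *)
Lemma cutoff_truncation (T : R) (n : nat) chi : 0 < T -> (0 < n)%N ->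
  is_cutoff T n chi -> exists c : R -> R, [/\ smooth c, forall x, 0 <= c x <= 1,
    forall x, `|x| <= n%:R / 2 * T -> c x = chi x,
    forall x, `|x| <= n%:R / 2 * T / 3 -> c x = 1 &
    forall x, 2 * (n%:R / 2 * T) / 3 <= `|x| -> c x = 0].
Proof.
move=> T0 n0 [schi pchi chi01 _ [chi1 chi0]].
set l := n%:R / 2 * T.
have l0 : 0 < l by rewrite mulr_gt0// divr_gt0// ltr0n.
have E3 : n%:R / 3 * T = 2 * l / 3 by rewrite /l; field.
have E6 : n%:R / 6 * T = l / 3 by rewrite /l; field.
pose c x := if `|x| <= l then chi x else 0.
have c0 x : 2 * l / 3 <= `|x| -> c x = 0.
  move=> xl; rewrite /c; case: ifPn => // xl'; apply: chi0; rewrite E3 -/l.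
  have [xp|xn] := leP 0 x.
    by right; rewrite ger0_norm// in xl xl'; rewrite xl.
  left; rewrite ltr0_norm// in xl xl'; apply/andP; split; lra.
exists c; split; last exact: c0.
- apply: smooth_local => x; have [xl|xl] := ltP `|x| l.
    exists chi; split=> //; near=> y; rewrite /c ifT//; apply: ltW.
    near: y; have e0 : 0 < l - `|x| by rewrite subr_gt0.
    apply/nbhs_ballP; exists (l - `|x|) => //= y.
    rewrite -ball_normE/= => xy.
    have := ler_distD x 0 y; rewrite !sub0r !normrN; lra.
  exists (fun=> 0); split; first exact: smooth_cst.
  near=> y; apply: c0; near: y.
  apply/nbhs_ballP; exists (l / 3) => /=; first by rewrite divr_gt0.
  move=> y; rewrite -ball_normE/= => xy.
  by have := ler_distD y 0 x; rewrite !sub0r !normrN distrC; lra.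
- by move=> x; rewrite /c; case: ifP => // _; rewrite lexx ler01.
- by move=> x xl; rewrite /c xl.
- move=> x xl; rewrite /c ifT; last lra.
  by apply: chi1; rewrite E6 -ler_norml.
Unshelve. all: by end_near. Qed.

(* The given family of cut-offs supplies a bump function: the truncation of one
   of them to a period, rescaled. *)
Lemma bump_of_cutoff (T : R) (n : nat) chi : 0 < T -> (0 < n)%N -> is_cutoff T n chi ->
  exists b : R -> R, [/\ smooth b, forall x, 0 <= b x <= 1,
    forall x, `|x| <= 1 -> b x = 1 & forall x, 2 <= `|x| -> b x = 0].
Proof.
move=> T0 n0 /(cutoff_truncation T0 n0)[c [sc c01 _ c1 c0]].
set l := n%:R / 2 * T in c1 c0.
have l30 : 0 < l / 3 by rewrite divr_gt0// mulr_gt0// divr_gt0// ltr0n.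
have norm x : `|l / 3 * x + 0| = l / 3 * `|x| by rewrite addr0 normrM gtr0_norm.
exists (fun x => c (l / 3 * x + 0)); split.
- exact: smooth_affine.
- by move=> x; exact: c01.
- by move=> x x1; apply: c1; rewrite norm -[leRHS]mulr1 ler_pM2l.
- by move=> x x2; apply: c0; rewrite norm -mulrA mulrC ler_pM2l.
Qed.

Lemma compact_support_summable f r : lint f -> (forall x : R, r <= `|x| -> f x = 0) ->
  summable_fun f.
Proof.
move=> [mf lf] f0.
have [+ _] := integrable_mkcond (mu := mu) (EFin \o f) (measurable_itv `[- r, r]).
move=> /(_ (lf (- r) r)).
rewrite restrict_EFin (_ : (f \_ _) = f)//.
apply/funext => x; rewrite patchE; case: ifPn => //.
rewrite notin_setE/= in_itv/= -ler_norml => /negP; rewrite -ltNge => /ltW.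
by move/f0.
Qed.

(** The primitive from minus infinity vanishes to the left of -m because g does, and to the right of
    m because g has mean zero. *)
Lemma primitive_test g (m : R) : smooth g -> (forall x, m <= `|x| -> g x = 0) ->
  \int[mu]_x g x = 0 -> exists phi, test_function phi /\ derive1 phi = g.
Proof.
move=> sg g0 ig.
have cg := smooth_continuous sg.
have sumg : summable_fun g by apply: compact_support_summable g0; exact: continuous_lint.
pose phi x := \int[mu]_(t in [set` Interval (BInfty R true) (BRight x)]) g t.
have D x : derivable phi x 1 /\ derive1 phi x = g x.
  apply: (@continuous_FTC1 _ g (BInfty R true) x (x + 1)); last exact: cg.
  - by rewrite ltrDl.
  - by apply: integrableS sumg.
  - exact: ltNyr.
have Dphi : derive1 phi = g by apply/funext => y; have [] := D y.
exists phi; split; last exact: Dphi.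
split.
  case=> [|k] x; first by have [] := D x.
  by rewrite derive1Sn Dphi; exact: sg.
exists `[- m, m]%classic; split; first exact: segment_compact.
move=> x /=; rewrite in_itv/= => /negP; rewrite negb_and -!ltNge => /orP[xm|mx].
  rewrite /phi (@eq_Rintegral _ _ _ _ _ (cst 0)); last first.
    move=> t; rewrite inE/= in_itv/= => tx; apply: g0.
    by rewrite -normrN (le_trans _ (ler_norm _))//; lra.
  by rewrite Rintegral_cst// mul0r.
rewrite /phi Rintegral_mkcond (_ : g \_ _ = g)//.
apply/funext => t; rewrite patchE; case: ifPn => //.
rewrite notin_setE/= in_itv/= => /negP; rewrite -ltNge => xt.
by rewrite g0// (le_trans _ (ler_norm _))//; lra.
Qed.

Lemma test_W1 phi : test_function phi -> W1 phi (derive1 phi).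
Proof.
move=> [sp _]; apply: W1_deriv => //; first by move=> x; exact: smooth_derivable.
exact/smooth_continuous/smooth_derive1.
Qed.

Lemma test_support phi : test_function phi ->
  exists r, forall x, r <= `|x| -> phi x = 0 /\ derive1 phi x = 0.
Proof.
move=> [sp [K [cK K0]]].
have [M [Mr Mf]] := compact_bounded cK.
have z x : M + 1 < `|x| -> phi x = 0.
  move=> Mx; apply: K0 => Kx.
  have M1 : M < M + 1 by rewrite ltrDl.
  by have /= := Mf (M + 1) M1 x Kx; rewrite leNgt Mx.
exists (M + 2) => x Mx; split; first by apply: z; lra.
have E : \forall y \near x, phi y = cst 0 y.
  apply/nbhs_ballP; exists 1 => //= y; rewrite -ball_normE/= => xy; apply: z.
  by have := ler_distD y 0 x; rewrite !sub0r !normrN distrC; lra.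
by rewrite derive1E (near_eq_derive _ E) derive_cst.
Qed.

End smooth_functions.

(** * The lemma of du Bois-Reymond and weak derivatives *)

Section weak_derivatives.
Context {R : realType}.
Local Notation mu := (@lebesgue_measure R).
Implicit Types f g h u p w phi : R -> R.

Lemma locally_integrable_lint f : locally_integrable setT f -> lint f.
Proof.
move=> [mf _ lf]; split=> // a b; apply/integrableP; split.
  by apply/measurable_EFinP; exact: measurable_funTS.
by have := lf `[a, b]%classic (@subsetT _ _) (@segment_compact R a b).
Qed.

Lemma compact_sub_itv (K : set R) : compact K -> exists r : R, K `<=` `[- r, r]%classic.
Proof.
move=> /compact_bounded[M [Mr Mf]]; exists (M + 1) => x Kx /=.
have M1 : M < M + 1 by rewrite ltrDl.
by rewrite in_itv/= -ler_norml; exact: (Mf (M + 1) M1 x Kx).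
Qed.

Lemma lint_locally_integrable f : lint f -> locally_integrable setT f.
Proof.
move=> [mf lf]; split=> //; first exact: openT.
move=> K _ cK; have [r Kr] := compact_sub_itv cK.
have /integrableP[_] := lf (- r) r; apply: le_lt_trans.
apply: ge0_subset_integral => //; first exact: compact_measurable.
by apply/measurable_EFinP/measurable_funTS; exact: measurableT_comp.
Qed.

Lemma lint_test f phi : lint f -> continuous phi ->
  (exists r, forall x, r <= `|x| -> phi x = 0) -> summable_fun (fun x => f x * phi x).
Proof.
move=> lf cp [r pr]; apply: (@compact_support_summable _ _ r).
  by under eq_fun do rewrite mulrC; exact: lint_continuousM.
by move=> x /pr ->; rewrite mulr0.
Qed.

Lemma test_summable f phi : lint f -> test_function phi ->
  summable_fun (fun x => f x * phi x) /\ summable_fun (fun x => f x * derive1 phi x).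
Proof.
move=> lf tp; have [r hr] := test_support tp; have [sp _] := tp; split.
  apply: lint_test => //; first exact: smooth_continuous.
  by exists r => x /hr[].
apply: lint_test => //; first exact/smooth_continuous/smooth_derive1.
by exists r => x /hr[].
Qed.

Lemma lebesgue_pt_small w a (e : R) : lebesgue_pt w a -> 0 < e ->
  \forall r \near (0:R)^'+, (davg w a r <= e%:E)%E.
Proof.
move=> wa e0.
have : nbhs (0%:E : \bar R) [set y : \bar R | (y < e%:E)%E].
  by apply: open_nbhs_nbhs; split; [exact: open_ereal_lt_ereal|rewrite /= lte_fin].
move=> nb0; have h : \forall r \near (0:R)^'+, (davg w a r < e%:E)%E := wa _ nb0.
by near=> r; apply: ltW; near: r; exact: h.
Unshelve. all: by end_near. Qed.

(** Near a Lebesgue point a, the integral of w against a bump centred at a is close to [w a] times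
    that of the bump. The factor [4 * r] is the length of the ball of radius [2 * r] that contains
    the support. *)
Lemma davg_dist w (b : R -> R) (a r e : R) : lint w ->
  continuous b -> (forall x, 0 <= b x <= 1) -> (forall x : R, 2 * r <= `|x| -> b x = 0) ->
  0 < r -> (davg w a (2 * r) <= e%:E)%E ->
  `| \int[mu]_x (w x * b (x - a)) - w a * \int[mu]_x b (x - a) | <= 4 * r * e.
Proof.
move=> lw cb b01 b0 r0 dw.
have cba : continuous (fun x : R => b (x - a)).
  move=> x; apply: continuous_comp; last exact: cb.
  by apply: continuousB; [exact: cvg_id|exact: cvg_cst].
have z x : 2 * r + `|a| <= `|x| -> b (x - a) = 0.
  by move=> h; apply: b0; have := ler_distD a x 0; rewrite !subr0; lra.
have lc (c : R) : lint (fun=> c) by apply: continuous_lint; exact: cst_continuous.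
have s1 : summable_fun (fun x => w x * b (x - a)).
  by apply: lint_test => //; exists (2 * r + `|a|).
have s2 : summable_fun (fun x => w a * b (x - a)).
  by apply: lint_test => //; exists (2 * r + `|a|).
have s3 : summable_fun (fun x => b (x - a)).
  have := lint_test (lc 1) cba (ex_intro _ _ z).
  by under eq_fun do rewrite mul1r.
rewrite -RintegralZl// -RintegralB//.
have mw : measurable_fun setT w by case: lw.
have mcw : measurable_fun setT (fun x => `|w x - w a|).
  by apply: measurableT_comp => //; exact: measurable_funB.
have sB : summable_fun (fun x => w x * b (x - a) - w a * b (x - a)).
  by have := summableD s1 (summableZ (-1) s2); under eq_fun do rewrite mulN1r.
have mball : measurable (ball a (2 * r) : set R) by exact: measurable_ball.
have r40 : 0 < (2 * r) *+ 2 by rewrite -mulr_natr !mulr_gt0.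
have I : (\int[mu]_(x in ball a (2 * r)) `|w x - w a|%:E <= (4 * r * e)%:E)%E.
  move: dw; rewrite /davg /iavg lebesgue_measure_ball; last by rewrite mulr_ge0// ltW.
  rewrite inver gt_eqF// => dw.
  have -> : (4 * r * e)%:E = (((2 * r) *+ 2)%:E * e%:E)%E.
    by rewrite -EFinM -mulr_natr; congr (_%:E); ring.
  rewrite -lee_pdivrMl// muleC; move: dw; rewrite muleC.
have L : (`|\int[mu]_x (w x * b (x - a) - w a * b (x - a))|%:E <=
    \int[mu]_(x in ball a (2 * r)) `|w x - w a|%:E)%E.
  rewrite EFin_normr_Rintegral//.
  apply: le_trans (le_abse_integral _ _ _) _ => //.
    by apply/measurable_EFinP; exact: summable_measurable.
  rewrite [leRHS]integral_mkcond; apply: ge0_le_integral => //.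
  - by apply/measurable_EFinP/measurableT_comp => //; exact: summable_measurable.
  - apply/(measurable_restrictT _ _).1 => //; apply/measurable_EFinP.
    exact: measurable_funTS.
  move=> x _; rewrite patchE -mulrBl; case: ifPn => [_|].
    rewrite abse_EFin lee_fin normrM ler_piMr//.
    by have /andP[? ?] := b01 (x - a); rewrite ger0_norm.
  rewrite notin_setE -ball_normE/= => /negP; rewrite -leNgt distrC => /b0 ->.
  by rewrite mulr0 normr0.
by rewrite -lee_fin; apply: le_trans L I.
Qed.

Lemma ae_exists (P : R -> Prop) : {ae mu, forall x, P x} -> exists x, P x.
Proof.
move=> [A [mA A0 PA]]; apply: contrapT => nP.
have AT : A = setT.
  by apply/seteqP; split => // x _; apply: PA => /= Px; apply: nP; exists x.
have := @lebesgue_measure_itv R `[0, 1]; rewrite /= lte_fin ltr01 => I1.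
have : (mu `[0%R, 1%R]%classic <= mu A)%E.
  by apply: le_measure; rewrite ?inE//= AT.
by rewrite I1 A0 -EFinB lee_fin; lra.
Qed.

Lemma bump_integral_ge (b : R -> R) (a r : R) : continuous b -> (forall x, 0 <= b x <= 1) ->
  (forall x : R, `|x| <= r -> b x = 1) -> (forall x : R, 2 * r <= `|x| -> b x = 0) ->
  0 < r -> 2 * r <= \int[mu]_x b (x - a).
Proof.
move=> cb b01 b1 b0 r0.
have cba : continuous (fun x : R => b (x - a)).
  move=> x; apply: continuous_comp; last exact: cb.
  by apply: continuousB; [exact: cvg_id|exact: cvg_cst].
have s : summable_fun (fun x => b (x - a)).
  apply: (@compact_support_summable _ _ (2 * r + `|a|)); first exact: continuous_lint.
  by move=> x h; apply: b0; have := ler_distD a x 0; rewrite !subr0; lra.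
apply: le_trans (J_le_full (a - r) (a + r) s _); last by move=> x; have /andP[] := b01 (x - a).
rewrite (@eq_J _ _ _ _ (fun=> 1)) ?J_cst; [lra|lra|].
by move=> x h; apply: b1; rewrite ler_norml; lra.
Qed.

Section with_bump.
Context (b : R -> R) (sb : smooth b) (b01 : forall x, 0 <= b x <= 1)
  (b1 : forall x, `|x| <= 1 -> b x = 1) (b0 : forall x, 2 <= `|x| -> b x = 0).

Let br r x := b (r^-1 * x + 0).

Let br_smooth r : smooth (br r). Proof. exact: smooth_affine. Qed.
Let br01 r x : 0 <= br r x <= 1. Proof. exact: b01. Qed.
Let br1 r x : 0 < r -> `|x| <= r -> br r x = 1.
Proof.
move=> r0 xr; apply: b1; rewrite addr0 normrM gtr0_norm ?invr_gt0//.
by rewrite mulrC ler_pdivrMr// mul1r.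
Qed.
Let br0 r x : 0 < r -> 2 * r <= `|x| -> br r x = 0.
Proof.
move=> r0 xr; apply: b0; rewrite addr0 normrM gtr0_norm ?invr_gt0//.
by rewrite mulrC ler_pdivlMr.
Qed.

(* Testing against a primitive of the difference of two translates of a bump,
   the weighted means of w around any two Lebesgue points agree. *)
Lemma du_Bois_Reymond w : lint w ->
  (forall phi, test_function phi -> \int[mu]_x (w x * derive1 phi x) = 0) ->
  exists c, {ae mu, forall x, w x = c}.
Proof.
move=> lw w0.
have cbr r := smooth_continuous (@br_smooth r).
have means a c r : 0 < r ->
    \int[mu]_x (w x * br r (x - a)) = \int[mu]_x (w x * br r (x - c)).
  move=> r0.
  have sm (d : R) : smooth (fun x => br r (x - d)).
    by have := @smooth_affine _ _ 1 (- d) (@br_smooth r); under eq_fun do rewrite mul1r.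
  have sd := smoothB (sm a) (sm c).
  have zz (d x : R) : 2 * r + `|d| <= `|x| -> br r (x - d) = 0.
    by move=> h; apply: br0 => //; have := ler_distD d x 0; rewrite !subr0; lra.
  have ss (d : R) : summable_fun (fun x => br r (x - d)).
    apply: (@compact_support_summable _ _ (2 * r + `|d|)); last exact: zz.
    exact: continuous_lint (smooth_continuous (sm d)).
  have i0 : \int[mu]_x (br r (x - a) - br r (x - c)) = 0.
    have mb : measurable_fun setT (EFin \o br r).
      by apply/measurable_EFinP; exact: (continuous_measurable_fun (@cbr r)).
    rewrite (RintegralB measurableT (ss a) (ss c)); apply/eqP; rewrite subr_eq0; apply/eqP.
    by rewrite /Rintegral (integral_shift (- a) mb) (integral_shift (- c) mb).
  have [|phi [tphi dphi]] := @primitive_test _ _ (2 * r + `|a| + `|c|) sd _ i0.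
    move=> x h; rewrite !zz ?subrr//; have := normr_ge0 a; have := normr_ge0 c; lra.
  have := w0 _ tphi; rewrite dphi.
  have sw (d : R) : summable_fun (fun x => w x * br r (x - d)).
    apply: (lint_test lw (smooth_continuous (sm d))).
    by exists (2 * r + `|d|); exact: zz.
  under eq_Rintegral do rewrite mulrBr.
  by rewrite (RintegralB measurableT (sw a) (sw c)) => /eqP; rewrite subr_eq0 => /eqP.
have LP := lebesgue_differentiation (lint_locally_integrable lw).
have [c Lc] := ae_exists LP.
exists (w c); apply: (ae_imp _ LP) => a La.
apply/eqP; rewrite -subr_eq0 -normr_le0; apply/ler_addgt0Pr => e e0; rewrite add0r.
(* Each of the two errors is then at most r e by [davg_dist], while the integral of the bump is at
   least 2 r. *)
have e4 : 0 < e / 4 by rewrite divr_gt0.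
have Fa := lebesgue_pt_small La e4; have Fc := lebesgue_pt_small Lc e4.
have [r [r0 [ra rc]]] : exists r, 0 < r /\ (davg w a (2 * r) <= (e / 4)%:E)%E /\
    (davg w c (2 * r) <= (e / 4)%:E)%E.
  have : \forall r \near (0:R)^'+, (0 < r /\ (davg w a r <= (e / 4)%:E)%E /\
    (davg w c r <= (e / 4)%:E)%E).
    near=> r; split; first by [].
    by split; near: r.
  move=> /filter_ex [r [r0 [h1 h2]]]; exists (r / 2).
  have -> : 2 * (r / 2) = r by field.
  by rewrite divr_gt0.
have da := davg_dist lw (@cbr r) (@br01 r) (fun x => @br0 r x r0) r0 ra.
have dc := davg_dist lw (@cbr r) (@br01 r) (fun x => @br0 r x r0) r0 rc.
rewrite (means a c r r0) in da.
have I a' := bump_integral_ge a' (@cbr r) (@br01 r) (fun x => @br1 r x r0) (fun x => @br0 r x r0) r0.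
have Eac : \int[mu]_x br r (x - a) = \int[mu]_x br r (x - c).
  have mb : measurable_fun setT (EFin \o br r).
    by apply/measurable_EFinP; exact: (continuous_measurable_fun (@cbr r)).
  by rewrite /Rintegral (integral_shift (- a) mb) (integral_shift (- c) mb).
rewrite Eac in da; have := I c.
move: (\int[mu]_x br r (x - c)) (\int[mu]_x (w x * br r (x - c))) da dc => A B da dc A2.
have : `|w a - w c| * A <= 2 * r * e.
  have -> : `|w a - w c| * A = `|(B - w c * A) - (B - w a * A)|.
    by rewrite -[A in LHS]ger0_norm -?normrM; [congr `|_|; ring|lra].
  apply: le_trans (ler_normB _ _) _; lra.
move=> h; have h2 : `|w a - w c| * (2 * r) <= e * (2 * r).
  apply: le_trans (_ : `|w a - w c| * A <= _); first by apply: ler_wpM2l.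
  by rewrite [e * _]mulrC.
by rewrite ler_pM2r ?mulr_gt0 in h2.
Unshelve. all: by end_near. Qed.

(** The difference g - h annihilates all test functions, in particular derivatives of test
    functions, so it is a constant c by du Bois-Reymond. Testing against the bump, whose integral is
    positive, gives c = 0. *)
Lemma weak_derivative_unique f g h : is_weak_derivative f g -> is_weak_derivative f h ->
  {ae mu, forall x, g x = h x}.
Proof.
move=> [_ /locally_integrable_lint lg fg] [_ /locally_integrable_lint lh fh].
have lw := lintB lg lh.
have zero phi : test_function phi -> \int[mu]_x ((g x - h x) * phi x) = 0.
  move=> tp; have [s1 _] := test_summable lg tp; have [s2 _] := test_summable lh tp.
  under eq_Rintegral do rewrite mulrBl.
  rewrite RintegralB//; have := fg _ tp; rewrite fh// => /oppr_inj ->.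
  by rewrite subrr.
have tb : test_function b.
  split=> //; exists `[-2, 2]%classic; split; first exact: segment_compact.
  move=> x /=; rewrite in_itv/= -ler_norml => /negP; rewrite -ltNge => /ltW.
  exact: b0.
have [|c wc] := du_Bois_Reymond lw.
  move=> phi [sp [K [cK K0]]]; apply: zero; split; first exact: smooth_derive1.
  have [r hr] := test_support (conj sp (ex_intro _ K (conj cK K0))).
  exists `[- r, r]%classic; split; first exact: segment_compact.
  move=> x /=; rewrite in_itv/= -ler_norml => /negP; rewrite -ltNge => /ltW.
  by move/hr => [].
have := zero _ tb.
have mb : measurable_fun setT b by exact: (continuous_measurable_fun (smooth_continuous sb)).
have -> : \int[mu]_x ((g x - h x) * b x) = \int[mu]_x (c * b x).
  rewrite /Rintegral; congr fine; apply: ae_eq_integral => //.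
  - apply/measurable_EFinP/measurable_funM => //; by case: lw.
  - by apply/measurable_EFinP/measurable_funM.
  - by apply: (ae_imp _ wc) => x ->.
have cb := smooth_continuous sb.
have sumb : summable_fun b.
  by apply: compact_support_summable b0; exact: continuous_lint.
rewrite RintegralZl// => /eqP; rewrite mulf_eq0 => /orP[/eqP c0|/eqP ib].
  by apply: (ae_imp _ wc) => x; rewrite c0 => /eqP; rewrite subr_eq0 => /eqP.
have := @bump_integral_ge b 0 1 cb b01 b1; rewrite mulr1 => /(_ b0 ltr01).
by under eq_Rintegral do rewrite subr0; rewrite ib; lra.
Qed.

Lemma weak_derivative_W1 f g : is_weak_derivative f g -> lint (fun x => g x ^+ 2) ->
  exists u, W1 u g /\ {ae mu, forall x, f x = u x}.
Proof.
move=> [/locally_integrable_lint lf /locally_integrable_lint lg fg] lg2.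
(* The primitive of g based at 0, with the sign that [J] does not carry. Then f - G annihilates
   every phi' and is constant almost everywhere. *)
pose G x := if 0 <= x then J 0 x g else - J x 0 g.
have WG : W1 G g.
  split=> // x y xy; rewrite /G.
  have [x0|x0] := leP 0 x; have [y0|y0] := leP 0 y.
  - by rewrite (J_cat lg x0 xy) addrC addKr.
  - by have := lt_le_trans y0 (le_trans x0 xy); rewrite ltxx.
  - by rewrite opprK (J_cat lg (ltW x0) y0) addrC.
  - by rewrite opprK (J_cat lg xy (ltW y0)); ring.
have lG := W1_lint WG.
have [|c wc] := du_Bois_Reymond (lintB lf lG).
  move=> phi tp.
  have [_ s1] := test_summable lf tp; have [_ s2] := test_summable lG tp.
  have [s3 _] := test_summable lg tp.
  under eq_Rintegral do rewrite mulrBl.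
  rewrite RintegralB// fg// -opprD -RintegralD//; apply/eqP; rewrite oppr_eq0; apply/eqP.
  apply: integral_derivative0 (W1M WG (test_W1 tp)) (summableD s3 s2) _.
  move=> e e0; have [r hr] := test_support tp; exists r => x /hr[-> _].
  by rewrite mulr0 normr0 ltW.
exists (fun x => G x + c); split.
  by have := W1D WG (W1_cst c); under [X in W1 _ X -> _]eq_fun do rewrite addr0.
by apply: (ae_imp _ wc) => x <-; rewrite subrKC.
Qed.

Lemma W1_weak_derivative u p f g : W1 u p -> measurable_fun setT f ->
  measurable_fun setT g -> {ae mu, forall x, f x = u x} -> {ae mu, forall x, g x = p x} ->
  is_weak_derivative f g.
Proof.
move=> Wu mf mg fu gp.
have lu := W1_lint Wu; have [lp _ _] := Wu.
have li v v' : lint v -> measurable_fun setT v' -> {ae mu, forall x, v' x = v x} ->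
    locally_integrable setT v'.
  move=> lv mv' vv'; have [mv _ lv'] := lint_locally_integrable lv.
  split=> //; first exact: openT.
  move=> K KT cK; have mK : measurable K by exact: compact_measurable.
  apply: le_lt_trans (lv' K KT cK); rewrite le_eqVlt; apply/orP; left.
  apply/eqP/ae_eq_integral => //.
  - by apply/measurable_EFinP/measurable_funTS/measurableT_comp.
  - by apply/measurable_EFinP/measurable_funTS/measurableT_comp.
  - by apply: (ae_imp _ vv') => x ->.
split; [exact: li fu|exact: li gp|].
move=> phi tp; have Wphi := test_W1 tp.
have [s1 _] := test_summable lp tp; have [_ s2] := test_summable lu tp.
have mphi := W1_measurable Wphi; have mdphi : measurable_fun setT (derive1 phi).
  by have [[]] := Wphi.
have mu' := W1_measurable Wu; have [mp _] := lp.
have -> : \int[mu]_x (f x * derive1 phi x) = \int[mu]_x (u x * derive1 phi x).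
  rewrite /Rintegral; congr fine; apply: ae_eq_integral => //.
  - exact/measurable_EFinP/measurable_funM.
  - exact/measurable_EFinP/measurable_funM.
  - by apply: (ae_imp _ fu) => x ->.
have -> : \int[mu]_x (g x * phi x) = \int[mu]_x (p x * phi x).
  rewrite /Rintegral; congr fine; apply: ae_eq_integral => //.
  - exact/measurable_EFinP/measurable_funM.
  - exact/measurable_EFinP/measurable_funM.
  - by apply: (ae_imp _ gp) => x ->.
apply/eqP; rewrite -subr_eq0 opprK addrC -RintegralD//; apply/eqP.
apply: integral_derivative0 (W1M Wu Wphi) (summableD s1 s2) _.
move=> e e0; have [r hr] := test_support tp; exists r => x /hr[-> _].
by rewrite mulr0 normr0 ltW.
Qed.

(** [wderiv] is an arbitrary choice among the weak derivatives, so only uniqueness identifies it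
    with p, and only almost everywhere. *)
Lemma wderiv_W1 u p f : W1 u p -> measurable_fun setT f -> {ae mu, forall x, f x = u x} ->
  [/\ weakly_derivable f, measurable_fun setT (wderiv f) &
     {ae mu, forall x, wderiv f x = p x}].
Proof.
move=> Wu mf fu.
have mp : measurable_fun setT p by have [[]] := Wu.
have wp := W1_weak_derivative Wu mf mp fu (aeW _ (fun x => erefl)).
have ww : is_weak_derivative f (wderiv f) by apply: xgetPex; exists p.
split; [by exists p| |exact: weak_derivative_unique ww wp].
by have [_ /locally_integrable_lint[]] := ww.
Qed.

End with_bump.

End weak_derivatives.

(** * Translation between weak Sobolev spaces and absolutely continuous triples *)

Section sobolev_bridge.
Context {R : realType}.
Local Notation mu := (@lebesgue_measure R).
Implicit Types f g h u p : R -> R.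

Lemma Lnorm2E f : ('N[mu]_2%:E [EFin \o f] = (\int[mu]_x (f x ^+ 2)%:E) `^ (2^-1))%E.
Proof.
rewrite unlock; congr (_ `^ _)%E; apply: eq_integral => x _ /=.
by rewrite powR_mulrn// real_normK ?num_real.
Qed.

Lemma in_L2_setT f : in_L2 setT f <-> L2 f.
Proof.
rewrite /in_L2 patch_setT; split.
  move=> Lf; split; last exact: Lfun2_integrable_sqr.
  by move: Lf; rewrite inE => /andP[+ _]; rewrite inE.
move=> [mf sf]; rewrite inE; apply/andP; split; rewrite inE//=.
rewrite /finite_norm Lnorm2E; apply: poweR_lty.
exact: (integrable_lty measurableT sf).
Qed.

Lemma L2norm_setT f : L2 f -> L2norm setT f = (nrm f)%:E.
Proof.
move=> [mf sf]; rewrite /L2norm patch_setT Lnorm2E.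
rewrite -[X in (X `^ _)%E]fineK; last exact: (integrable_fin_num measurableT sf).
rewrite poweR_EFin powR12_sqrt//.
by apply: Rintegral_ge0 => x _; exact: sqr_ge0.
Qed.

Lemma in_L2_restrict D f : in_L2 D f <-> L2 (f \_ D).
Proof. by rewrite -in_L2_setT /in_L2 patch_setT. Qed.

Lemma L2norm_restrict D f : L2 (f \_ D) -> L2norm D f = (nrm (f \_ D))%:E.
Proof. by move=> Lf; rewrite -L2norm_setT// /L2norm patch_setT. Qed.

Lemma in_L2loc_lint f : measurable_fun setT f -> in_L2loc f -> lint (fun x => f x ^+ 2).
Proof.
move=> mf Lf; split; first exact: measurable_funX.
move=> a b; have /in_L2_restrict[_ s] := Lf _ (@segment_compact R a b).
apply/(integrable_mkcond (mu := mu) _ (measurable_itv `[a, b])).2.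
apply: eq_integrable s => // x _; rewrite /= patchE [in RHS]patchE.
by case: ifP => //; rewrite expr0n.
Qed.

Lemma lint_in_L2loc f : measurable_fun setT f -> lint (fun x => f x ^+ 2) -> in_L2loc f.
Proof.
move=> mf [_ lf] K cK; apply/in_L2_restrict.
have mK : measurable K by exact: compact_measurable.
have [r Kr] := compact_sub_itv cK.
split; first by apply/(measurable_restrictT _ _).1 => //; exact: measurable_funTS.
have iK : mu.-integrable K (EFin \o (fun x => f x ^+ 2)).
  by apply: integrableS (lf (- r) r).
have := (integrable_mkcond (mu := mu) _ mK).1 iK.
apply: eq_integrable => // x _; rewrite /= !patchE.
by case: ifP => //; rewrite expr0n.
Qed.

Section with_bump.
Context (b : R -> R) (sb : smooth b) (b01 : forall x, 0 <= b x <= 1)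
  (b1 : forall x, `|x| <= 1 -> b x = 1) (b0 : forall x, 2 <= `|x| -> b x = 0).

(** The function and its first derivative are replaced by continuous representatives, whereas the
    second derivative stays [wderiv (wderiv f)] itself, which has no preferred representative. *)
Lemma in_H2loc_W1 f : in_H2loc f -> exists u p,
  [/\ W1 u p, W1 p (wderiv (wderiv f)), {ae mu, forall x, f x = u x},
      {ae mu, forall x, wderiv f x = p x} & measurable_fun setT f].
Proof.
move=> [[g fg] [h gh] Lf Lg Lh].
have wf : is_weak_derivative f (wderiv f) by apply: xgetPex; exists g.
have wg : is_weak_derivative (wderiv f) (wderiv (wderiv f)) by apply: xgetPex; exists h.
have [/locally_integrable_lint[mf _] /locally_integrable_lint[mg _] _] := wf.
have [_ /locally_integrable_lint[mh _] _] := wg.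
have [u [Wu fu]] := weak_derivative_W1 sb b01 b1 b0 wf (in_L2loc_lint mg Lg).
have [p [Wp gp]] := weak_derivative_W1 sb b01 b1 b0 wg (in_L2loc_lint mh Lh).
exists u, p; split=> //; exact: W1_ae Wu (W1_measurable Wp) gp.
Qed.

Lemma W1_in_H2loc f u p h : W1 u p -> W1 p h -> measurable_fun setT f ->
  {ae mu, forall x, f x = u x} ->
  [/\ in_H2loc f, measurable_fun setT (wderiv f), measurable_fun setT (wderiv (wderiv f)),
    {ae mu, forall x, wderiv f x = p x} & {ae mu, forall x, wderiv (wderiv f) x = h x}].
Proof.
move=> Wu Wp mf fu.
have [d1 m1 e1] := wderiv_W1 sb b01 b1 b0 Wu mf fu.
have [d2 m2 e2] := wderiv_W1 sb b01 b1 b0 Wp m1 e1.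
have loc f1 f2 : lint (fun x => f2 x ^+ 2) -> measurable_fun setT f1 ->
    {ae mu, forall x, f1 x = f2 x} -> in_L2loc f1.
  move=> [m2' l2'] m1' e12; apply: lint_in_L2loc => //.
  split; first exact: measurable_funX.
  move=> c d; apply/integrableP; split.
    by apply/measurable_EFinP/measurable_funTS; exact: measurable_funX.
  have /integrableP[_] := l2' c d; apply: le_lt_trans.
  rewrite le_eqVlt; apply/orP; left; apply/eqP/ae_eq_integral => //.
  - by apply: measurableT_comp => //; apply/measurable_EFinP/measurable_funTS; exact: measurable_funX.
  - by apply: measurableT_comp => //; apply/measurable_EFinP/measurable_funTS.
  - by apply: (ae_imp _ e12) => x /= ->.
split=> //; split=> //.
- exact: loc (W1_lint_sqr Wu) mf fu.
- exact: loc (W1_lint_sqr Wp) m1 e1.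
- by have [_ lh _] := Wp; exact: loc lh m2 e2.
Qed.

Lemma in_H2_H2 f : in_H2 f -> exists u p,
  [/\ H2 u p (wderiv (wderiv f)), {ae mu, forall x, f x = u x},
      {ae mu, forall x, wderiv f x = p x} & measurable_fun setT f].
Proof.
move=> [df dg /in_L2_setT Lf /in_L2_setT Lg /in_L2_setT Lh].
have loc f1 : L2 f1 -> in_L2loc f1.
  by move=> L1; have [m1 s1] := L1; apply: lint_in_L2loc => //; exact: L2_lint_sqr.
have [u [p [Wu Wp fu gp mf]]] := in_H2loc_W1 (And5 df dg (loc _ Lf) (loc _ Lg) (loc _ Lh)).
exists u, p; split=> //; split=> //.
- exact/nb_L2/(nb_ae (nb_nrm Lf) (W1_measurable Wu) fu).
- exact/nb_L2/(nb_ae (nb_nrm Lg) (W1_measurable Wp) gp).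
Qed.

Lemma ae_sym f g : {ae mu, forall x, f x = g x} -> {ae mu, forall x, g x = f x}.
Proof. exact: ae_imp. Qed.

Lemma H2_in_H2 f u p h : H2 u p h -> measurable_fun setT f ->
  {ae mu, forall x, f x = u x} ->
  [/\ in_H2 f, L2 f, {ae mu, forall x, wderiv f x = p x} &
    {ae mu, forall x, wderiv (wderiv f) x = h x}].
Proof.
move=> [Wu Wp Lu Lp Lh] mf fu.
have [[d1 d2 _ _ _] m1 m2 e1 e2] := W1_in_H2loc Wu Wp mf fu.
have Lf := nb_L2 (nb_ae (nb_nrm Lu) mf (ae_sym fu)).
split=> //; split=> //; apply/in_L2_setT => //.
- exact: (nb_L2 (nb_ae (nb_nrm Lp) m1 (ae_sym e1))).
- exact: (nb_L2 (nb_ae (nb_nrm Lh) m2 (ae_sym e2))).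
Qed.

Lemma L2norm_le D f u K : measurable D -> measurable_fun setT f ->
  {ae mu, forall x, f x = u x} -> nb (u \_ D) K -> (L2norm D f <= K%:E)%E.
Proof.
move=> mD mf fu nu.
have nf : nb (f \_ D) K.
  apply: nb_ae nu _ _.
    by apply/(measurable_restrictT _ _).1 => //; exact: measurable_funTS.
  by apply: (ae_imp _ fu) => x fux; rewrite !patchE fux.
by rewrite L2norm_restrict ?lee_fin; case: nf.
Qed.

(** Three contributions of size at most K give the square root of 3 times K, rounded up to 2 K. *)
Lemma H2norm_le D f u p h K : measurable D -> W1 u p -> W1 p h -> measurable_fun setT f ->
  {ae mu, forall x, f x = u x} -> nb (u \_ D) K -> nb (p \_ D) K -> nb (h \_ D) K ->
  (H2norm D f <= (2 * K)%:E)%E.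
Proof.
move=> mD Wu Wp mf fu nu np nh; have K0 := nb_ge0 nu.
have [_ m1 m2 e1 e2] := W1_in_H2loc Wu Wp mf fu.
have := L2norm_le mD mf fu nu; have := L2norm_le mD m1 e1 np.
have := L2norm_le mD m2 e2 nh; rewrite /H2norm.
have pos g : (0 <= L2norm D g)%E by exact: Lnorm_ge0.
have := pos f; have := pos (wderiv f); have := pos (wderiv (wderiv f)).
case: (L2norm D f) => [x| |]//; case: (L2norm D (wderiv f)) => [y| |]//.
case: (L2norm D (wderiv (wderiv f))) => [z| |]//; rewrite !lee_fin => z0 y0 x0 zK yK xK.
rewrite powR12_sqrt; last by rewrite !addr_ge0// mulr_ge0.
rewrite -[leRHS]ger0_norm ?mulr_ge0// -sqrtr_sqr ler_sqrt ?sqr_ge0//.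
nra.
Qed.

Lemma H2norm_ge0 D f : (0 <= H2norm D f)%E.
Proof. exact: poweR_ge0. Qed.

End with_bump.

End sobolev_bridge.

(** * Invertible Schroedinger operators *)

Section schroedinger_operators.
Context {R : realType}.
Local Notation mu := (@lebesgue_measure R).
Implicit Types (f g h u p v q k c Q chi : R -> R) (B C K d e : R).

(* [Inv Q C]: the operator u |-> - u'' + Q u, from H^2(R) to L^2(R), is onto,
   and ||u||, ||u'|| and ||u''|| are at most C ||- u'' + Q u||. *)
Definition Inv Q C :=
  (forall g, L2 g -> exists u p, H2 u p (fun x => Q x * u x - g x)) /\
  (forall u p h K, H2 u p h -> nb (fun x => Q x * u x - h x) K ->
     [/\ nb u (C * K), nb p (C * K) & nb h (C * K)]).

Lemma nb_bounded_mul Q B f K : measurable_fun setT Q -> (forall x, `|Q x| <= B) ->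
  nb f K -> nb (fun x => Q x * f x) (B * K).
Proof.
move=> mQ QB nf; have B0 : 0 <= B by apply: le_trans (QB 0); exact: normr_ge0.
have mf := nb_measurable nf; apply: nb_dom B0 nf _ _; first exact: measurable_funM.
by move=> x; rewrite normrM ler_wpM2r.
Qed.

Lemma L2_bounded_mul Q B f : measurable_fun setT Q -> (forall x, `|Q x| <= B) ->
  L2 f -> L2 (fun x => Q x * f x).
Proof. by move=> mQ QB /nb_nrm nf; exact/nb_L2/(nb_bounded_mul mQ QB nf). Qed.

Lemma eq_nb f g K : f =1 g -> nb f K -> nb g K.
Proof. by move=> /funext ->. Qed.

(* Self-adjointness: a bounded right inverse yields the a priori bound. *)
Lemma Inv_of_right_inverse Q B C : measurable_fun setT Q -> (forall x, `|Q x| <= B) ->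
  0 <= C ->
  (forall g K, nb g K -> exists u p, H2 u p (fun x => Q x * u x - g x) /\ nb u (C * K)) ->
  Inv Q (2 * C + 1 + B * C).
Proof.
move=> mQ QB C0 ri.
have B0 : 0 <= B by apply: le_trans (QB 0); exact: normr_ge0.
split=> [g /nb_nrm/ri[u [p [Hu _]]]|v q k K Hv nf]; first by exists u, p.
have K0 := nb_ge0 nf.
have Lv : L2 v by case: Hv.
have [u [p [Hu nu]]] := ri _ _ (nb_nrm Lv).
have Lu : L2 u by case: Hu.
have Lk : L2 k by case: Hv.
have Lf := nb_L2 nf.
(* Duality: the right inverse is applied to v itself, so - u'' + Q u = v, and symmetry moves the
   operator from u onto v. With the norm of u at most C times that of v, one factor of the norm of v
   cancels. *)
have E : \int[mu]_x (v x ^+ 2) = \int[mu]_x (u x * (Q x * v x - k x)).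
  have sym := H2_symmetric Hu Hv.
  have Luv := L2M_summable Lu (L2_bounded_mul mQ QB Lv).
  have Luk := L2M_summable Lu Lk.
  have Lvv := L2M_summable Lv Lv.
  have -> : \int[mu]_x (u x * (Q x * v x - k x)) =
      \int[mu]_x (u x * (Q x * v x)) - \int[mu]_x (u x * k x).
    by rewrite -RintegralB//; apply: eq_Rintegral => x _; ring.
  rewrite -sym -RintegralB//; last first.
    by apply: L2M_summable => //; case: Hu.
  by apply: eq_Rintegral => x _; ring.
have nv : nb v (C * K).
  have n0 := nrm_ge0 v.
  have : nrm v ^+ 2 <= (C * nrm v) * K.
    rewrite nrm_sqr E; apply: le_trans (ler_norm _) _.
    apply: le_trans (CauchySchwarz Lu Lf) _.
    by apply: ler_pM; rewrite ?nrm_ge0//; [case: nu|case: nf].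
  split=> //; have [->|vn0] := eqVneq (nrm v) 0; first by rewrite mulr_ge0.
  have vp : 0 < nrm v by rewrite lt_neqAle eq_sym vn0.
  by rewrite -(ler_pM2r vp) -expr2 mulrAC.
have CK0 : 0 <= C * K by rewrite mulr_ge0.
have BCK0 : 0 <= B * (C * K) by rewrite mulr_ge0.
have nk : nb k (B * (C * K) + K).
  apply: eq_nb (nbB (nb_bounded_mul mQ QB nv) nf) => x /=; ring.
split; [apply: nb_le nv _|apply: nb_le (H2_interpolation Hv nv nk) _|apply: nb_le nk _]; nra.
Qed.

(** If the defect of the approximate inverse has relative size 1/2, the equation f = g - defect(f)
    has a solution of norm at most 2 K, and [SU f] solves the problem for g. This doubles C before
    [Inv_of_right_inverse] is applied. The last hypothesis stands in for linearity. *)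
Lemma Inv_parametrix Q B C (SU SP SH : (R -> R) -> R -> R) :
  measurable_fun setT Q -> (forall x, `|Q x| <= B) -> 0 <= C ->
  (forall f, L2 f -> H2 (SU f) (SP f) (SH f)) ->
  (forall f K, nb f K -> nb (SU f) (C * K)) ->
  (forall f K, nb f K -> nb (fun x => Q x * SU f x - SH f x - f x) (K / 2)) ->
  (forall f g K, L2 f -> L2 g -> nb (fun x => f x - g x) K ->
     nb (fun x => (Q x * SU f x - SH f x - f x) - (Q x * SU g x - SH g x - g x)) (K / 2)) ->
  Inv Q (2 * (2 * C) + 1 + B * (2 * C)).
Proof.
move=> mQ QB C0 HS SC E2 EL.
apply: Inv_of_right_inverse => //; first by rewrite mulr_ge0.
move=> g K ng; have K0 := nb_ge0 ng.
pose Phi f x := g x - (Q x * SU f x - SH f x - f x).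
have [|f nf|f f' K' nf nf' nff'|f [nf ff]] := @L2_fixpoint _ Phi (2 * K).
- by rewrite mulr_ge0.
- by apply: nb_le (nbB ng (E2 _ _ nf)) _; lra.
- apply: eq_nb (nbN (EL _ _ _ (nb_L2 nf) (nb_L2 nf') nff')) => x.
  by rewrite /Phi; ring.
have [Wu Wp Lu Lp Lh] := HS _ (nb_L2 nf).
exists (SU f), (SP f); split; last by apply: nb_le (SC _ _ nf) _; lra.
apply: H2_ae (HS _ (nb_L2 nf)) _ _.
  apply: measurable_funB; last exact: nb_measurable ng.
  by apply: measurable_funM => //; case: Lu.
by apply: (ae_imp _ ff) => x; rewrite /Phi; lra.
Qed.

(** The estimate on differences is the a priori bound applied to the difference of two solutions; it
    is what the contraction arguments need from a solver made by choice. *)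
Lemma Inv_solver Q C : Inv Q C -> exists U P : (R -> R) -> R -> R,
  [/\ forall g, L2 g -> H2 (U g) (P g) (fun x => Q x * U g x - g x),
      forall g K, nb g K -> nb (U g) (C * K) /\ nb (P g) (C * K) &
      forall f g K, L2 f -> L2 g -> nb (fun x => f x - g x) K ->
        nb (fun x => U f x - U g x) (C * K) /\ nb (fun x => P f x - P g x) (C * K)].
Proof.
move=> [ex ap].
have /choice[UP HUP] : forall g, exists up : (R -> R) * (R -> R),
    L2 g -> H2 up.1 up.2 (fun x => Q x * up.1 x - g x).
  move=> g; have [Lg|nLg] := pselect (L2 g); last by exists ((fun=> 0), (fun=> 0)).
  by have [u [p H]] := ex g Lg; exists (u, p).
exists (fun g => (UP g).1), (fun g => (UP g).2); split=> //.
  move=> g K ng; have H := HUP g (nb_L2 ng).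
  have [|? ? ?] := ap _ _ _ K H; last by split.
  by apply: eq_nb ng => x; ring.
move=> f g K Lf Lg nfg; have H := H2B (HUP f Lf) (HUP g Lg).
have [|? ? ?] := ap _ _ _ K H; last by split.
by apply: eq_nb nfg => x; ring.
Qed.

(** The solver for Q is an approximate inverse for Q', with defect (Q' - Q) U f of size at most d C
    K. *)
Lemma Inv_perturb Q Q' B C d : Inv Q C -> measurable_fun setT Q' ->
  measurable_fun setT Q ->
  (forall x, `|Q' x| <= B) -> 0 <= C -> (forall x, `|Q' x - Q x| <= d) -> d * C <= 1 / 2 ->
  Inv Q' (2 * (2 * C) + 1 + B * (2 * C)).
Proof.
move=> iQ mQ' mQ Q'B C0 QQ' dC; have [U [P [HU UC UL]]] := Inv_solver iQ.
have mQQ : measurable_fun setT (fun x => Q' x - Q x) by exact: measurable_funB.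
apply: (@Inv_parametrix Q' B C U P (fun g x => Q x * U g x - g x)) => //.
- by move=> f K /UC[].
- move=> f K nf; have [nu _] := UC _ _ nf; have K0 := nb_ge0 nf.
  have := nb_bounded_mul mQQ QQ' nu; rewrite mulrA => nn.
  apply: (@eq_nb (fun x => (Q' x - Q x) * U f x)) => [x|]; first by ring.
  by apply: nb_le nn _; nra.
- move=> f g K Lf Lg nfg; have [nu _] := UL _ _ _ Lf Lg nfg; have K0 := nb_ge0 nfg.
  have := nb_bounded_mul mQQ QQ' nu; rewrite mulrA => nn.
  apply: (@eq_nb (fun x => (Q' x - Q x) * (U f x - U g x))) => [x|]; first by ring.
  by apply: nb_le nn _; nra.
Qed.

Lemma Inv_shift t Q C : Inv Q C -> Inv (fun x => Q (x + t)) C.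
Proof.
move=> [ex ap]; split.
  move=> g /nb_nrm/(nb_shift (- t))/nb_L2 /ex[u [p /(H2_shift t) H]].
  exists (fun x => u (x + t)), (fun x => p (x + t)).
  rewrite (_ : (fun x => Q (x + t) * u (x + t) - g x) =
    (fun x => Q (x + t) * u (x + t) - g (x + t - t)))//.
  by apply/funext => x; rewrite addrK.
move=> u p h K /(H2_shift (- t)) H /(nb_shift (- t)) n.
have [|n1 n2 n3] := ap _ _ _ K H.
  by apply: eq_nb n => x; rewrite subrK.
have back f : nb (fun x => f (x - t)) (C * K) -> nb f (C * K).
  by move=> /(nb_shift t); apply: eq_nb => x; rewrite addrK.
by split; exact: back.
Qed.

(** A single bound d serves both derivatives. It is small for wide transition layers, but d = 1 also
    occurs, for the given cut-offs. *)
Definition cutoff c c1 c2 (d : R) := [/\ W1 c c1, W1 c1 c2,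
  forall x, `|c x| <= 1, forall x, `|c1 x| <= d & forall x, `|c2 x| <= d].

Lemma H2_cutoff c c1 c2 d u p h : cutoff c c1 c2 d -> H2 u p h ->
  H2 (fun x => c x * u x) (fun x => c1 x * u x + c x * p x)
     (fun x => c2 x * u x + 2 * (c1 x * p x) + c x * h x).
Proof.
move=> [Wc Wc1 cb c1b c2b] [Wu Wp Lu Lp Lh].
have mc := W1_measurable Wc; have mc1 := W1_measurable Wc1.
have mc2 : measurable_fun setT c2 by have [[]] := Wc1.
split.
- exact: W1M.
- by apply: eq_W1 (W1D (W1M Wc1 Wu) (W1M Wc Wp)) => // x; ring.
- exact: (L2_bounded_mul mc cb).
- by apply: L2D; [exact: (L2_bounded_mul mc1 c1b)|exact: (L2_bounded_mul mc cb)].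
- apply: L2D; last exact: (L2_bounded_mul mc cb).
  apply: L2D; first exact: (L2_bounded_mul mc2 c2b).
  by apply: L2Z; exact: (L2_bounded_mul mc1 c1b).
Qed.

(* The solution operator of -u'' + Q0 u, localized by the cut-off c, inverts
   - u'' + Q u on data supported where c = 1, up to an error of relative size
   (e + 3 d) C, if Q is e-close to Q0 on the support of c. *)
Lemma localized_solver Q Q0 C c c1 c2 d chi e : Inv Q0 C -> cutoff c c1 c2 d ->
  measurable_fun setT Q -> measurable_fun setT Q0 ->
  measurable_fun setT chi -> (forall x, `|chi x| <= 1) -> (forall x, c x * chi x = chi x) ->
  (forall x, `|c x * (Q x - Q0 x)| <= e) -> 0 <= C ->
  exists SU SP SH E : (R -> R) -> R -> R,
  [/\ forall f, L2 f -> H2 (SU f) (SP f) (SH f) /\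
        (forall x, Q x * SU f x - SH f x = chi x * f x + E f x),
      forall f K, nb f K -> [/\ nb (SU f) (C * K), nb (SP f) ((1 + d) * C * K),
        nb (E f) ((e + 3 * d) * C * K) & nb (SH f) ((3 * d + 1) * C * K)],
      forall f g K, L2 f -> L2 g -> nb (fun x => f x - g x) K ->
        [/\ nb (fun x => SU f x - SU g x) (C * K),
           nb (fun x => SP f x - SP g x) ((1 + d) * C * K) &
           nb (fun x => E f x - E g x) ((e + 3 * d) * C * K)] &
      forall f x, c x = 0 -> c1 x = 0 -> c2 x = 0 ->
        [/\ SU f x = 0, SP f x = 0, SH f x = 0 & E f x = 0]].
Proof.
move=> iQ cc mQ mQ0 mchi chib cchi cQ C0.
have [U [P [HU UC UL]]] := Inv_solver iQ.
have [Wc Wc1 cb c1b c2b] := cc.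
have d0 : 0 <= d by apply: le_trans (c1b 0); exact: normr_ge0.
have mc := W1_measurable Wc; have mc1 := W1_measurable Wc1.
have mc2 : measurable_fun setT c2 by have [[]] := Wc1.
have mcQ : measurable_fun setT (fun x => c x * (Q x - Q0 x)).
  by apply: measurable_funM => //; exact: measurable_funB.
pose X f x := chi x * f x.
have LX f : L2 f -> L2 (X f) by exact: (L2_bounded_mul mchi chib).
have nX f K : nb f K -> nb (X f) K.
  by move=> /(nb_bounded_mul mchi chib); rewrite mul1r.
pose SH f x := c2 x * U (X f) x + 2 * (c1 x * P (X f) x) + c x * (Q0 x * U (X f) x - X f x).
(* The defect: the mismatch of the potentials on the support of c, and the commutator of c with the
   second derivative. The terms c'' u and 2 c' u' account for the factor 3 in [3 * d]. *)
pose E f x := c x * (Q x - Q0 x) * U (X f) x - (c2 x * U (X f) x + 2 * (c1 x * P (X f) x)).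
exists (fun f x => c x * U (X f) x), (fun f x => c1 x * U (X f) x + c x * P (X f) x), SH, E.
have bd u p K : nb u (C * K) -> nb p (C * K) -> 
    [/\ nb (fun x => c x * u x) (C * K),
    nb (fun x => c1 x * u x + c x * p x) ((1 + d) * C * K) &
    nb (fun x => c x * (Q x - Q0 x) * u x - (c2 x * u x + 2 * (c1 x * p x)))
      ((e + 3 * d) * C * K)].
  move=> nu np; split.
  - by have := nb_bounded_mul mc cb nu; rewrite mul1r.
  - have := nbD (nb_bounded_mul mc1 c1b nu) (nb_bounded_mul mc cb np).
    by move=> /nb_le; apply; rewrite le_eqVlt; apply/orP; left; apply/eqP; ring.
  - have := nbB (nb_bounded_mul mcQ cQ nu)
      (nbD (nb_bounded_mul mc2 c2b nu) (nbZ 2 (nb_bounded_mul mc1 c1b np))).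
    move=> /nb_le; apply; rewrite ger0_norm// le_eqVlt; apply/orP; left; apply/eqP.
    by ring.
split.
- move=> f Lf; have H := HU _ (LX _ Lf); split.
    exact: (H2_cutoff cc H).
  by move=> x; rewrite /SH /E /X -[in RHS](cchi x); ring.
- move=> f K nf; have [nu np] := UC _ _ (nX _ _ nf).
  have [n1 n2 n3] := bd _ _ _ nu np; split=> //.
  have nh : nb (fun x => Q0 x * U (X f) x - X f x) (C * K).
    have [_ ap] := iQ.
    have [|_ _ //] := ap _ _ _ K (HU _ (LX _ (nb_L2 nf))).
    by apply: eq_nb (nX _ _ nf) => x; ring.
  have := nbD (nbD (nb_bounded_mul mc2 c2b nu) (nbZ 2 (nb_bounded_mul mc1 c1b np)))
    (nb_bounded_mul mc cb nh).
  move=> /nb_le; apply; rewrite ger0_norm// le_eqVlt; apply/orP; left; apply/eqP.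
  by ring.
- move=> f g K Lf Lg nfg.
  have nXfg : nb (fun x => X f x - X g x) K.
    by apply: eq_nb (nX _ _ nfg) => x; rewrite /X; ring.
  have [nu np] := UL _ _ _ (LX _ Lf) (LX _ Lg) nXfg.
  have [n1 n2 n3] := bd _ _ _ nu np; split.
  + by apply: eq_nb n1 => x; ring.
  + by apply: eq_nb n2 => x; ring.
  + by apply: eq_nb n3 => x; rewrite /E; ring.
(* Vanishing is pointwise, not merely almost everywhere, so that the outputs can later be periodized
   by finite sums. *)
- move=> f x c0 c10 c20; rewrite /SH /E c0 c10 c20.
  by split; ring.
Qed.

(* Data are split at the point m; the two halves are inverted with QA and QB. *)
Lemma Inv_glue Q QA QB B C cA cA1 cA2 cB cB1 cB2 d e (m : R) :
  measurable_fun setT Q -> measurable_fun setT QA -> measurable_fun setT QB ->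
  (forall x, `|Q x| <= B) -> 0 <= C -> Inv QA C -> Inv QB C ->
  cutoff cA cA1 cA2 d -> cutoff cB cB1 cB2 d ->
  (forall x, x <= m -> cA x = 1) -> (forall x, m < x -> cB x = 1) ->
  (forall x, `|cA x * (Q x - QA x)| <= e) -> (forall x, `|cB x * (Q x - QB x)| <= e) ->
  (e + 3 * d) * C <= 1 / 4 ->
  Inv Q (2 * (2 * (2 * C)) + 1 + B * (2 * (2 * C))).
Proof.
move=> mQ mQA mQB QB' C0 iA iB ccA ccB A1 B1 eA eB small.
(* The data are split by sharp indicators, which add up to 1 exactly and cost no regularity in L^2;
   only the solutions need smooth cut-offs. *)
pose xA (x : R) : R := \1_(`]-oo, m]) x; pose xB (x : R) : R := \1_(`]m, +oo[) x.
have xAE (x : R) : xA x = (x <= m)%R%:R by rewrite /xA indicE mem_setE in_itv.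
have xBE (x : R) : xB x = (m < x)%R%:R by rewrite /xB indicE mem_setE in_itv/= andbT.
have mA : measurable_fun setT xA by exact: measurable_indic.
have mB : measurable_fun setT xB by exact: measurable_indic.
have [||UA [PA [HA [EA [HA1 HA2 HA3 _]]]]] :=
  localized_solver iA ccA mQ mQA mA _ _ eA C0.
- by move=> x; rewrite xAE; case: (x <= m); rewrite ?normr1 ?normr0.
- by move=> x; rewrite xAE; case: leP => h; rewrite ?mulr0// A1// mul1r.
have [||UB [PB [HB [EB [HB1 HB2 HB3 _]]]]] :=
  localized_solver iB ccB mQ mQB mB _ _ eB C0.
- by move=> x; rewrite xBE; case: (m < x); rewrite ?normr1 ?normr0.
- by move=> x; rewrite xBE; case: ltP => h; rewrite ?mulr0// B1// mul1r.
have AB f x : xA x * f x + xB x * f x = f x.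
  by rewrite xAE xBE; case: ltP => _ /=; rewrite ?mul0r ?mul1r ?add0r ?addr0.
have EE f : L2 f -> forall x,
    Q x * (UA f x + UB f x) - (HA f x + HB f x) - f x = EA f x + EB f x.
  move=> Lf x; have [_ /(_ x) e1] := HA1 _ Lf; have [_ /(_ x) e2] := HB1 _ Lf.
  have := AB f x; lra.
apply: (@Inv_parametrix Q B (2 * C) (fun f x => UA f x + UB f x)
  (fun f x => PA f x + PB f x) (fun f x => HA f x + HB f x)) => //.
- by rewrite mulr_ge0.
- by move=> f Lf; apply: H2D; [case: (HA1 _ Lf)|case: (HB1 _ Lf)].
- move=> f K nf; have [n1 _ _ _] := HA2 _ _ nf; have [n2 _ _ _] := HB2 _ _ nf.
  by apply: nb_le (nbD n1 n2) _; lra.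
(* Each half has a defect of at most K / 4, so together they stay within the K / 2 allowed to a
   parametrix. *)
- move=> f K nf; have [_ _ n1 _] := HA2 _ _ nf; have [_ _ n2 _] := HB2 _ _ nf.
  have K0 := nb_ge0 nf.
  apply: (@eq_nb (fun x => EA f x + EB f x)) => [x|]; first by rewrite EE//; exact: nb_L2 nf.
  apply: nb_le (nbD n1 n2) _; nra.
- move=> f g K Lf Lg nfg; have [_ _ n1] := HA3 _ _ _ Lf Lg nfg.
  have [_ _ n2] := HB3 _ _ _ Lf Lg nfg; have K0 := nb_ge0 nfg.
  apply: (@eq_nb (fun x => (EA f x - EA g x) + (EB f x - EB g x))) => [x|].
    by rewrite !EE//; ring.
  apply: nb_le (nbD n1 n2) _; nra.
Qed.

End schroedinger_operators.

(** * Cut-offs with wide transition layers and gluing across them *)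

Section cutoff_functions.
Context {R : realType}.
Local Notation mu := (@lebesgue_measure R).
Implicit Types (f g h s : R -> R) (K d e w m : R).

Lemma compact_support_bounded f r : continuous f -> (forall x : R, r <= `|x| -> f x = 0) ->
  exists M : R, 0 <= M /\ forall x, `|f x| <= M.
Proof.
move=> cf f0.
have cf' : {within `[- r, r], continuous f} by exact: continuous_subspaceT.
have [M [Mr Mf]] := compact_bounded (continuous_compact cf' (@segment_compact R (- r) r)).
exists (`|M| + 1); split; first by rewrite addr_ge0.
move=> x; have [xr|xr] := leP `|x| r.
  have M1 : M < `|M| + 1 by rewrite (le_lt_trans (ler_norm M))// ltrDl.
  by apply: (Mf _ M1); exists x => //=; rewrite in_itv/= -ler_norml.
by rewrite f0 ?(ltW xr)// normr0 addr_ge0.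
Qed.

Lemma derive1_near_cst f c x (d : R) : 0 < d ->
  (forall y, `|x - y| < d -> f y = c) -> derive1 f x = 0.
Proof.
move=> d0 fc.
have E : \forall y \near x, f y = cst c y.
  by apply/nbhs_ballP; exists d => //= y; rewrite -ball_normE/=; exact: fc.
by rewrite derive1E (near_eq_derive _ E) derive_cst.
Qed.

Lemma step_function (b : R -> R) : smooth b -> (forall x, 0 <= b x <= 1) ->
  (forall x, `|x| <= 1 -> b x = 1) -> (forall x, 2 <= `|x| -> b x = 0) ->
  exists s k, [/\ smooth s, forall x, `|s x| <= 1, forall x, x <= 1 -> s x = 1,
    forall x, 2 <= x -> s x = 0 & 0 <= k /\
    forall x, `|derive1 s x| <= k /\ `|derive1 (derive1 s) x| <= k].
Proof.
move=> sb b01 b1 b0.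
(* Only the right flank of the bump is kept. The derivatives of s are compactly supported, hence
   bounded, although s is not. *)
pose s x := if x <= 0 then 1 else b x.
have s1 x : x <= 1 -> s x = 1.
  move=> x1; rewrite /s; case: ifPn => //; rewrite -ltNge => x0.
  by rewrite b1// ger0_norm// ltW.
have s0 x : 2 <= x -> s x = 0.
  move=> x2; rewrite /s ifF; last by apply/negbTE; rewrite -ltNge; lra.
  by rewrite b0// ger0_norm//; lra.
have ss : smooth s.
  apply: smooth_local => x; have [x1|x1] := ltP x 1.
    exists (fun=> 1); split; first exact: smooth_cst.
    apply/nbhs_ballP; exists (1 - x); first by rewrite /= subr_gt0.
    move=> y; rewrite -ball_normE/= ltr_norml => /andP[h1 h2].
    by apply: s1; lra.
  exists b; split=> //.
  apply/nbhs_ballP; exists 1 => //= y; rewrite -ball_normE/= ltr_norml => /andP[h1 h2].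
  by rewrite /s ifF//; apply/negbTE; rewrite -ltNge; lra.
have d1 x : 3 <= `|x| -> derive1 s x = 0.
  have [xp|xn] := leP 0 x.
    rewrite ger0_norm// => x3; apply: (@derive1_near_cst s 0 x 1) => // y.
    by rewrite ltr_norml => /andP[h1 h2]; apply: s0; lra.
  rewrite ltr0_norm// => x3; apply: (@derive1_near_cst s 1 x 1) => // y.
  by rewrite ltr_norml => /andP[h1 h2]; apply: s1; lra.
have d2 x : 4 <= `|x| -> derive1 (derive1 s) x = 0.
  move=> x4; apply: (@derive1_near_cst (derive1 s) 0 x 1) => // y xy.
  by apply: d1; have := ler_distD y x 0; rewrite !subr0; lra.
have [k1 [k10 h1]] := compact_support_bounded (smooth_continuous (smooth_derive1 ss)) d1.
have [k2 [k20 h2]] :=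
  compact_support_bounded (smooth_continuous (smooth_derive1 (smooth_derive1 ss))) d2.
exists s, (k1 + k2); split=> //.
  move=> x; rewrite /s; case: ifP => _; first by rewrite normr1.
  by have /andP[? ?] := b01 x; rewrite ger0_norm.
split; first exact: addr_ge0.
by move=> x; split; [apply: le_trans (h1 x) _|apply: le_trans (h2 x) _]; lra.
Qed.

(** The second derivative carries a^2, which |a| <= 1 reduces to |a|; so one bound k |a| covers both
    derivatives. *)
Lemma cutoff_affine s k (a c : R) : smooth s -> (forall x, `|s x| <= 1) -> 0 <= k ->
  (forall x, `|derive1 s x| <= k /\ `|derive1 (derive1 s) x| <= k) -> `|a| <= 1 ->
  cutoff (fun x => s (a * x + c)) (fun x => a * derive1 s (a * x + c))
    (fun x => a * (a * derive1 (derive1 s) (a * x + c))) (k * `|a|).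
Proof.
move=> ss s1 k0 kk a1.
have W f : smooth f -> W1 (fun x => f (a * x + c)) (fun x => a * derive1 f (a * x + c)).
  move=> sf; apply: W1_deriv.
  - by move=> x; exact: (smooth_derivable (@smooth_affine _ f a c sf)).
  - move=> x; have := is_derive_affine (@smooth_derivable _ f (a * x + c) sf) => H.
    by rewrite derive1E; exact: (@derive_val _ _ _ _ _ _ _ H).
  - move=> x; apply: (@continuousM _ _ (fun=> a) (fun x => derive1 f (a * x + c)) x).
      exact: cvg_cst.
    by have := smooth_continuous (@smooth_affine _ _ a c (smooth_derive1 sf)); apply.
have kb x : 0 <= x -> x <= k -> x * `|a| <= k * `|a| by move=> *; exact: ler_wpM2r.
split=> //; [exact: W|apply: W1Z; apply: W; exact: smooth_derive1| |].
- by move=> x; rewrite normrM mulrC; apply: kb => //; have [] := kk (a * x + c).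
- move=> x; rewrite !normrM mulrA [_ * `|derive1 _ _|]mulrC mulrA.
  have [_ h] := kk (a * x + c); apply: ler_wpM2r => //.
  by rewrite -[k]mulr1; apply: ler_pM.
Qed.

(** The second derivative of the product is at most d + 2 d^2 + d, and d <= 1 turns this into 4
    d. *)
Lemma cutoffM c c1 c2 f f1 f2 d : cutoff c c1 c2 d -> cutoff f f1 f2 d -> d <= 1 ->
  cutoff (fun x => c x * f x) (fun x => c1 x * f x + c x * f1 x)
    (fun x => c2 x * f x + 2 * (c1 x * f1 x) + c x * f2 x) (4 * d).
Proof.
move=> [Wc Wc1 cb c1b c2b] [Wf Wf1 fb f1b f2b] d1.
have d0 : 0 <= d by apply: le_trans (c1b 0); exact: normr_ge0.
have bd (x y r t : R) : `|x| <= r -> `|y| <= t -> `|x * y| <= r * t.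
  by move=> ? ?; rewrite normrM ler_pM.
split.
- exact: W1M.
- by apply: eq_W1 (W1D (W1M Wc1 Wf) (W1M Wc Wf1)) => // x; ring.
- by move=> x; rewrite -[1]mulr1; exact: bd.
- move=> x; apply: le_trans (ler_normD _ _) _.
  have := bd _ _ _ _ (c1b x) (fb x); have := bd _ _ _ _ (cb x) (f1b x); lra.
- move=> x; apply: le_trans (ler_normD _ _) _.
  apply: le_trans (lerD (ler_normD _ _) (lexx _)) _.
  rewrite (normrM 2) (@ger0_norm _ 2)//.
  have := bd _ _ _ _ (c2b x) (fb x); have := bd _ _ _ _ (c1b x) (f1b x).
  have := bd _ _ _ _ (cb x) (f2b x); nra.
Qed.

Section with_step.
Context (s : R -> R) (k : R) (ss : smooth s) (sb : forall x, `|s x| <= 1)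
  (s1 : forall x, x <= 1 -> s x = 1) (s0 : forall x, 2 <= x -> s x = 0) (k0 : 0 <= k)
  (sk : forall x, `|derive1 s x| <= k /\ `|derive1 (derive1 s) x| <= k).

Lemma left_cutoff m w : 1 <= w -> exists c c1 c2, [/\ cutoff c c1 c2 (k / w),
  forall x, x <= m -> c x = 1 &
  forall x, m + w < x -> [/\ c x = 0, c1 x = 0 & c2 x = 0]].
Proof.
move=> w1; have w0 : 0 < w by lra.
have aw : `|w^-1| = w^-1 by rewrite ger0_norm// invr_ge0 ltW.
have w1' : w^-1 <= 1 by rewrite invf_le1.
have arg x : w^-1 * x + (1 - m / w) = 1 + (x - m) / w by ring.
have cc := cutoff_affine (a := w^-1) (1 - m / w) ss sb k0 sk.
rewrite aw in cc; have {}cc := cc w1'.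
do 3 eexists; split; first exact: cc.
  move=> x xm /=; apply: s1; rewrite arg.
  by have : (x - m) / w <= 0; [rewrite ler_pdivrMr// mul0r; lra|lra].
have big x : m + w < x -> 2 < w^-1 * x + (1 - m / w).
  move=> mx; rewrite arg.
  by have : 1 < (x - m) / w; [rewrite ltr_pdivlMr// mul1r; lra|lra].
have z1 y : 2 < y -> derive1 s y = 0.
  move=> y2; apply: (@derive1_near_cst s 0 y (y - 2)); first by rewrite subr_gt0.
  by move=> z; rewrite ltr_norml => /andP[? ?]; apply: s0; lra.
have z2 y : 2 < y -> derive1 (derive1 s) y = 0.
  move=> y2; apply: (@derive1_near_cst (derive1 s) 0 y (y - 2)); first by rewrite subr_gt0.
  by move=> z; rewrite ltr_norml => /andP[? ?]; apply: z1; lra.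
move=> x /big h; split; rewrite /=.
- by apply: s0; exact: ltW.
- by rewrite z1// mulr0.
- by rewrite z2// !mulr0.
Qed.

Lemma right_cutoff m w : 1 <= w -> exists c c1 c2, [/\ cutoff c c1 c2 (k / w),
  forall x, m <= x -> c x = 1 &
  forall x, x < m - w -> [/\ c x = 0, c1 x = 0 & c2 x = 0]].
Proof.
move=> w1; have w0 : 0 < w by lra.
have aw : `|- w^-1| = w^-1 by rewrite normrN ger0_norm// invr_ge0 ltW.
have w1' : w^-1 <= 1 by rewrite invf_le1.
have arg x : - w^-1 * x + (1 + m / w) = 1 + (m - x) / w by ring.
have cc := cutoff_affine (a := - w^-1) (1 + m / w) ss sb k0 sk.
rewrite aw in cc; have {}cc := cc w1'.
do 3 eexists; split; first exact: cc.
  move=> x xm /=; apply: s1; rewrite arg.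
  by have : (m - x) / w <= 0; [rewrite ler_pdivrMr// mul0r; lra|lra].
have big x : x < m - w -> 2 < - w^-1 * x + (1 + m / w).
  move=> mx; rewrite arg.
  by have : 1 < (m - x) / w; [rewrite ltr_pdivlMr// mul1r; lra|lra].
have z1 y : 2 < y -> derive1 s y = 0.
  move=> y2; apply: (@derive1_near_cst s 0 y (y - 2)); first by rewrite subr_gt0.
  by move=> z; rewrite ltr_norml => /andP[? ?]; apply: s0; lra.
have z2 y : 2 < y -> derive1 (derive1 s) y = 0.
  move=> y2; apply: (@derive1_near_cst (derive1 s) 0 y (y - 2)); first by rewrite subr_gt0.
  by move=> z; rewrite ltr_norml => /andP[? ?]; apply: z1; lra.
move=> x /big h; split; rewrite /=.
- by apply: s0; exact: ltW.
- by rewrite z1// mulr0.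
- by rewrite z2// !mulr0.
Qed.

(** Each comparison potential must stay close to Q a distance w past the cut m, because the cut-off
    needs that room to decay. The price of the transition is [k / w], so wide windows are cheap. *)
Lemma Inv_glue_at (Q QA QB : R -> R) B C m w e :
  measurable_fun setT Q -> measurable_fun setT QA -> measurable_fun setT QB ->
  (forall x, `|Q x| <= B) -> 0 <= C -> Inv QA C -> Inv QB C -> 1 <= w -> 0 <= e ->
  (forall x, x <= m + w -> `|Q x - QA x| <= e) ->
  (forall x, m - w <= x -> `|Q x - QB x| <= e) ->
  (e + 3 * (k / w)) * C <= 1 / 4 ->
  Inv Q (2 * (2 * (2 * C)) + 1 + B * (2 * (2 * C))).
Proof.
move=> mQ mQA mQB QB' C0 iA iB w1 e0 eA eB small.
have [cA [cA1 [cA2 [ccA A1 A0]]]] := left_cutoff m w1.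
have [cB [cB1 [cB2 [ccB B1 B0]]]] := right_cutoff m w1.
apply: (Inv_glue mQ mQA mQB QB' C0 iA iB ccA ccB A1 _ _ _ small).
- by move=> x /ltW; exact: B1.
- move=> x; have [h|h] := leP x (m + w); last by have [-> _ _] := A0 _ h; rewrite mul0r normr0.
  have [_ _ cb _ _] := ccA.
  by rewrite normrM -[e]mul1r; apply: ler_pM => //; exact: eA.
- move=> x; have [h|h] := leP (m - w) x; last by have [-> _ _] := B0 _ h; rewrite mul0r normr0.
  have [_ _ cb _ _] := ccB.
  by rewrite normrM -[e]mul1r; apply: ler_pM => //; exact: eB.
Qed.

End with_step.

End cutoff_functions.

(** * Sums of distant solitons *)

Section multi_bump.
Context {R : realType}.
Local Notation mu := (@lebesgue_measure R).
Implicit Types (f g h u v w p q Q : R -> R) (B C K d e r : R).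

Lemma Inv_le Q C C' : Inv Q C -> C <= C' -> Inv Q C'.
Proof.
move=> [ex ap] CC; split=> // u p h K H n; have K0 := nb_ge0 n.
by have [n1 n2 n3] := ap _ _ _ _ H n; split;
  [apply: nb_le n1 _|apply: nb_le n2 _|apply: nb_le n3 _]; exact: ler_wpM2r.
Qed.

Lemma large_multiple (T X : R) : 0 < T ->
  exists N : nat, forall n, (N <= n)%N -> X <= n%:R * T.
Proof.
move=> T0; exists (Num.bound (`|X| / T)) => n nN.
apply: le_trans (ler_norm X) _; rewrite -ler_pdivrMr//; apply: ltW.
have h := archi_boundP (divr_ge0 (normr_ge0 X) (ltW T0)).
by apply: lt_le_trans h _; rewrite ler_nat.
Qed.

Lemma periodic_mulrn (W : R -> R) (T : R) n : periodic W T ->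
  forall x, W (x + n%:R * T) = W x.
Proof. by move=> pW x; rewrite mulr_natl; exact: periodicn. Qed.

Lemma periodic_subn (W : R -> R) (T : R) n : periodic W T ->
  forall x, W (x - n%:R * T) = W x.
Proof. by move=> pW x; rewrite -(periodic_mulrn n pW) subrK. Qed.

Context (T BW C0 Bpsi k : R) (W psi p h s : R -> R)
  (T0 : 0 < T) (pW : periodic W T) (mW : measurable_fun setT W)
  (WB : forall x, `|W x| <= BW)
  (Hpsi : H2 psi p h) (eqpsi : forall x, h x = W x * psi x - psi x ^+ 3)
  (psiB : forall x, `|psi x| <= Bpsi) (iQ : Inv (fun x => W x - 3 * psi x ^+ 2) C0)
  (C00 : 0 <= C0)
  (ss : smooth s) (sb : forall x, `|s x| <= 1)
  (s1 : forall x, x <= 1 -> s x = 1) (s0 : forall x, 2 <= x -> s x = 0) (k0 : 0 <= k)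
  (sk : forall x, `|derive1 s x| <= k /\ `|derive1 (derive1 s) x| <= k).

Lemma potential_measurable w : measurable_fun setT w ->
  measurable_fun setT (fun x => W x - 3 * w x ^+ 2).
Proof.
by move=> mw; apply: measurable_funB => //; apply: measurable_funM => //; exact: measurable_funX.
Qed.

Lemma potential_bounded w B : (forall x, `|w x| <= B) ->
  forall x, `|W x - 3 * w x ^+ 2| <= BW + 3 * B ^+ 2.
Proof.
move=> wB x; apply: le_trans (ler_normB _ _) _; apply: lerD => //.
rewrite normrM (@ger0_norm _ 3)// ler_pM2l// normrX.
by apply: lerXn2r; rewrite ?nnegrE//; apply: le_trans (wB x); exact: normr_ge0.
Qed.

Let psi_measurable : measurable_fun setT psi.
Proof. by have [/W1_measurable] := Hpsi. Qed.

Let Bpsi0 : 0 <= Bpsi. Proof. by apply: le_trans (psiB 0); exact: normr_ge0. Qed.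

Let tail e : 0 < e -> exists r, forall x, r <= `|x| -> `|psi x| <= e.
Proof. by move=> e0; have [Wu _ Lu Lp _] := Hpsi; exact: (W1_vanishing Wu Lu Lp). Qed.

Context (theta : nat -> R) (theta2 : forall j, theta j ^+ 2 = 1).

Definition bump_at (n j : nat) (x : R) := psi (x - j.+1%:R * n%:R * T).

Definition bumps (M n : nat) (x : R) := \sum_(0 <= j < M) theta j * bump_at n j x.

Lemma bumpsS M n x : bumps M.+1 n x = bumps M n x + theta M * bump_at n M x.
Proof. by rewrite /bumps big_nat_recr. Qed.

Lemma bumps0 n x : bumps 0 n x = 0.
Proof. by rewrite /bumps big_geq. Qed.

Let ntheta j : `|theta j| = 1.
Proof.
have /eqP := theta2 j; rewrite sqrf_eq1 => /orP[/eqP ->|/eqP ->]; first exact: normr1.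
by rewrite normrN1.
Qed.

Lemma bump_at_bounded n j x : `|theta j * bump_at n j x| <= Bpsi.
Proof. by rewrite normrM ntheta mul1r; exact: psiB. Qed.

Lemma bumps_bounded M n x : `|bumps M n x| <= M%:R * Bpsi.
Proof.
elim: M => [|M IH]; first by rewrite bumps0 normr0 mul0r.
rewrite bumpsS -natr1 mulrDl mul1r; apply: le_trans (ler_normD _ _) _.
by apply: lerD => //; exact: bump_at_bounded.
Qed.

Lemma bump_at_measurable n j : measurable_fun setT (bump_at n j).
Proof. by apply: measurableT_comp => //; exact: measurable_shift. Qed.

Lemma bumps_measurable M n : measurable_fun setT (bumps M n).
Proof.
apply: measurable_sum => j; apply: measurable_funM => //; exact: bump_at_measurable.
Qed.

Lemma bump_shift j n x : W (x - j.+1%:R * n%:R * T) = W x.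
Proof. by rewrite -natrM; exact: periodic_subn. Qed.

Lemma bumps_small_right M n e : 
  (forall x, (n%:R * T) / 4 <= `|x| -> `|psi x| <= e) ->
  forall x, M%:R * n%:R * T + n%:R * T / 4 <= x -> `|bumps M n x| <= M%:R * e.
Proof.
move=> te x.
have nT0 : 0 <= n%:R * T by rewrite mulr_ge0// ltW.
elim: M => [|M IH] hx; first by rewrite bumps0 normr0 mul0r.
have hx' : M%:R * n%:R * T + n%:R * T / 4 <= x.
  apply: le_trans hx; rewrite lerD2r -natr1 mulrDl mulrDl mul1r; lra.
rewrite bumpsS -natr1 mulrDl mul1r; apply: le_trans (ler_normD _ _) _.
apply: lerD; first exact: IH.
rewrite normrM ntheta mul1r; apply: te.
by rewrite (le_trans _ (ler_norm _))// /bump_at; lra.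
Qed.

Lemma bump_small_left M n e :
  (forall x, (n%:R * T) / 4 <= `|x| -> `|psi x| <= e) ->
  forall x, x <= M.+1%:R * n%:R * T - n%:R * T / 4 -> `|bump_at n M x| <= e.
Proof.
move=> te x hx; apply: te; rewrite -normrN (le_trans _ (ler_norm _))//; lra.
Qed.

(* Induction on M: M bumps look like M - 1 bumps on the left and like a single
   bump on the right. *)
Lemma bumps_Inv M : exists C N, 0 <= C /\
  forall n, (N <= n)%N -> Inv (fun x => W x - 3 * bumps M n x ^+ 2) C.
Proof.
elim: M => [|M [C1 [N1 [C10 IH]]]].
  (* No soliton at all: on each half-line the operator with W alone resembles the single-soliton
     operator whose soliton has been moved far into the other half-line. The value of e makes the
     potential error and the cut-off error, each at most e, add up to 1/4 after multiplication by C0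
     + 1. *)
  pose e : R := 1 / (8 * (C0 + 1)).
  have e0 : 0 < e by rewrite divr_gt0// mulr_gt0// ltr_wpDl.
  have e3 : 0 < e / (3 * (Bpsi + 1)) by rewrite divr_gt0// mulr_gt0// ltr_wpDl.
  have [r hr] := tail e3.
  (* Past distance r the term 3 psi^2 is at most e; the other entry gives 1 <= w and 3 k / w <=
     e. *)
  pose w := Num.max r (24 * k * (C0 + 1) + 1).
  have kC : 0 <= 24 * k * (C0 + 1) by rewrite !mulr_ge0// addr_ge0.
  have w1 : 1 <= w by rewrite le_max lerDr kC orbT.
  have rw : r <= w by rewrite le_max lexx.
  have kw : 24 * k * (C0 + 1) <= w by rewrite le_max lerDl ler01 orbT.
  have [N hN] := large_multiple (2 * w) T0.
  have psie x : r <= `|x| -> `|3 * psi x ^+ 2| <= e.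
    move=> /hr hx; rewrite normrM (@ger0_norm _ 3)// normrX expr2.
    have e30 := ltW e3.
    have : `|psi x| * `|psi x| <= e / (3 * (Bpsi + 1)) * (Bpsi + 1).
      by apply: ler_pM => //; apply: le_trans (psiB x) _; rewrite lerDl.
    have -> : e / (3 * (Bpsi + 1)) * (Bpsi + 1) = e / 3.
      by field; rewrite gt_eqF// ltr_wpDl.
    by lra.
  have NT := hN N (leqnn N).
  have mB : forall n x, `|W x - 3 * bumps 0 n x ^+ 2| <= BW.
    by move=> n x; rewrite bumps0 expr0n/= mulr0 subr0.
  exists (2 * (2 * (2 * C0)) + 1 + BW * (2 * (2 * C0))), 0%N.
  have BW0 : 0 <= BW by apply: le_trans (WB 0); exact: normr_ge0.
  split; first by rewrite !addr_ge0// !mulr_ge0.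
  move=> n _.
  have iA := Inv_shift (- (N%:R * T)) iQ; have iB := Inv_shift (N%:R * T) iQ.
  apply: (Inv_glue_at ss sb s1 s0 k0 sk (m := 0) (w := w) (e := e) _ _ _ _ C00 iA iB) => //.
  - by apply: potential_measurable; exact: bumps_measurable.
  - have := potential_measurable psi_measurable => m.
    by apply: (measurableT_comp m); exact: measurable_shift.
  - have := potential_measurable psi_measurable => m.
    by apply: (measurableT_comp m); exact: measurable_shift.
  - exact: ltW.
  - move=> x xw; rewrite bumps0 expr0n/= mulr0 subr0 (periodic_subn N pW) subKr.
    apply: psie; apply: le_trans rw _.
    by rewrite -normrN (le_trans _ (ler_norm _))//; lra.
  - move=> x xw; rewrite bumps0 expr0n/= mulr0 subr0 (periodic_mulrn N pW) subKr.
    apply: psie; apply: le_trans rw _.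
    by rewrite (le_trans _ (ler_norm _))//; lra.
  - have w0 : 0 < w by lra.
    have C1p : 0 < C0 + 1 by rewrite ltr_wpDl.
    have -> : 1 / 4 = (e + e) * (C0 + 1) by rewrite /e; field; rewrite gt_eqF.
    have ke : 3 * (k / w) <= e.
      by rewrite mulrA ler_pdivrMr// /e mulrAC mul1r ler_pdivlMr ?mulr_gt0//; lra.
    have kw0 : 0 <= k / w by rewrite divr_ge0// ltW.
    by apply: ler_pM => //; lra.
pose C := C1 + C0.
have C_0 : 0 <= C by exact: addr_ge0.
have C1p : 0 < C + 1 by rewrite ltr_wpDl.
(* Differences of squares factor into a tail, at most e / D up to a factor M, and a bounded sum; D
   dominates the product of all remaining factors for both comparisons. *)
pose D : R := 6 * (M%:R + 1) ^+ 2 * (Bpsi + 1).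
have M0 : 0 <= M%:R :> R by [].
have M1 : 0 < M%:R + 1 :> R by rewrite ltr_wpDl.
have B1 : 0 < Bpsi + 1 by rewrite ltr_wpDl.
have D0 : 0 < D by rewrite !mulr_gt0// exprn_gt0.
pose e : R := 1 / (8 * (C + 1)).
have e0 : 0 < e by rewrite divr_gt0// mulr_gt0.
have e3 : 0 < e / D by rewrite divr_gt0.
have [r hr] := tail e3.
pose X := Num.max r (24 * k * (C + 1) + 1).
have kC : 0 <= 24 * k * (C + 1) by rewrite !mulr_ge0// addr_ge0.
have X1 : 1 <= X by rewrite le_max lerDr kC orbT.
have rX : r <= X by rewrite le_max lexx.
have kX : 24 * k * (C + 1) <= X by rewrite le_max lerDl ler01 orbT.
have [N hN] := large_multiple (4 * X) T0.
pose B := BW + 3 * (M.+1%:R * Bpsi) ^+ 2.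
have BW0 : 0 <= BW by apply: le_trans (WB 0); exact: normr_ge0.
have B0 : 0 <= B by rewrite addr_ge0// mulr_ge0// sqr_ge0.
exists (2 * (2 * (2 * C)) + 1 + B * (2 * (2 * C))), (maxn N N1).
split; first by rewrite !addr_ge0// !mulr_ge0.
move=> n; rewrite geq_max => /andP[nN nN1].
have NT := hN n nN.
pose w := n%:R * T / 4.
have Xw : X <= w by rewrite /w; lra.
have iA := Inv_le (IH n nN1) (_ : C1 <= C).
have iB : Inv (fun x => W x - 3 * bump_at n M x ^+ 2) C.
  apply: Inv_le (_ : C0 <= C); last by rewrite lerDr.
  have := Inv_shift (- (M.+1%:R * n%:R * T)) iQ.
  by under eq_fun do rewrite bump_shift.
have te x : n%:R * T / 4 <= `|x| -> `|psi x| <= e / D.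
  by move=> hx; apply: hr; apply: le_trans hx; exact: le_trans rX Xw.
have Ee : e = e / D * D by rewrite divfK// gt_eqF.
have small_le (a b a' b' : R) : `|a| <= a' -> `|b| <= b' -> `|3 * (a * b)| <= 3 * (a' * b').
  move=> aa bb; rewrite !normrM (@ger0_norm _ 3)// ler_pM2l//.
  by apply: ler_pM.
have eD0 := ltW e3.
(* The cut lies halfway between the positions M n T and (M + 1) n T. Since w = n T / 4, each end of
   the window is still n T / 4 away from the nearer of them. *)
apply: (Inv_glue_at ss sb s1 s0 k0 sk (m := M.+1%:R * n%:R * T - n%:R * T / 2)
  (w := w) (e := e) _ _ _ _ C_0 (iA _) iB) => //.
- by apply: potential_measurable; exact: bumps_measurable.
- by apply: potential_measurable; exact: bumps_measurable.
- by apply: potential_measurable; exact: bump_at_measurable.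
- by apply: potential_bounded; exact: bumps_bounded.
- by rewrite lerDl.
- exact: le_trans X1 Xw.
- exact: ltW.
- move=> x hx.
  have hb : `|bump_at n M x| <= e / D.
    by apply: (bump_small_left te); move: hx; rewrite /w; lra.
  have -> : W x - 3 * bumps M.+1 n x ^+ 2 - (W x - 3 * bumps M n x ^+ 2) =
      3 * (- (theta M * bump_at n M x) * (2 * bumps M n x + theta M * bump_at n M x)).
    by rewrite bumpsS; ring.
  have h1 : `|- (theta M * bump_at n M x)| <= e / D.
    by rewrite normrN normrM ntheta mul1r.
  have h2 : `|2 * bumps M n x + theta M * bump_at n M x| <= 2 * (M%:R * Bpsi) + Bpsi.
    apply: le_trans (ler_normD _ _) _; apply: lerD; last exact: bump_at_bounded.
    by rewrite normrM (@ger0_norm _ 2)// ler_pM2l//; exact: bumps_bounded.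
  apply: le_trans (small_le _ _ _ _ h1 h2) _.
  rewrite [leRHS]Ee mulrCA; apply: ler_wpM2l => //; rewrite /D.
  by have : 0 <= M%:R * Bpsi; [exact: mulr_ge0|nra].
- move=> x hx.
  have hb : `|bumps M n x| <= M%:R * (e / D).
    apply: (bumps_small_right te); move: hx; rewrite /w -natr1 !mulrDl mul1r; lra.
  have -> : W x - 3 * bumps M.+1 n x ^+ 2 - (W x - 3 * bump_at n M x ^+ 2) =
      3 * (- bumps M n x * (bumps M n x + 2 * (theta M * bump_at n M x))).
    (* The sign squares away, so a reflected soliton has the same linearization. *)
    have := theta2 M; rewrite bumpsS => t2.
    have -> : 3 * bump_at n M x ^+ 2 = 3 * (theta M ^+ 2 * bump_at n M x ^+ 2) by rewrite t2 mul1r.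
    by ring.
  have h1 : `|- bumps M n x| <= M%:R * (e / D) by rewrite normrN.
  have h2 : `|bumps M n x + 2 * (theta M * bump_at n M x)| <= M%:R * Bpsi + 2 * Bpsi.
    apply: le_trans (ler_normD _ _) _; apply: lerD; first exact: bumps_bounded.
    by rewrite normrM (@ger0_norm _ 2)// ler_pM2l//; exact: bump_at_bounded.
  apply: le_trans (small_le _ _ _ _ h1 h2) _.
  rewrite [leRHS]Ee.
  have -> : 3 * (M%:R * (e / D) * (M%:R * Bpsi + 2 * Bpsi)) =
     e / D * (3 * (M%:R * (M%:R + 2) * Bpsi)) by ring.
  apply: ler_wpM2l => //; rewrite /D.
  have MB : 0 <= M%:R * Bpsi by exact: mulr_ge0.
  have MMB : 0 <= M%:R * (M%:R * Bpsi) by exact: mulr_ge0.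
  have MM : 0 <= M%:R * M%:R :> R by exact: mulr_ge0.
  by lra.
- have w0 : 0 < w by apply: lt_le_trans Xw; lra.
  have -> : 1 / 4 = (e + e) * (C + 1) by rewrite /e; field; rewrite gt_eqF.
  have ke : 3 * (k / w) <= e.
    by rewrite mulrA ler_pdivrMr// /e mulrAC mul1r ler_pdivlMr ?mulr_gt0//; lra.
  have kw0 : 0 <= k / w by rewrite divr_ge0// ltW.
  by apply: ler_pM => //; lra.
Qed.

(** Every signed translate satisfies the equation, so the sum fails it only by the mixed products in
    the cube. *)
Definition bumps_residual (M n : nat) x :=
  \sum_(0 <= j < M) theta j * bump_at n j x ^+ 3 - bumps M n x ^+ 3.

Lemma bumps_H2 M n : exists q,
  H2 (bumps M n) q (fun x => W x * bumps M n x - bumps M n x ^+ 3 - bumps_residual M n x).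
Proof.
suff [q H] : exists q, H2 (bumps M n) q
    (fun x => W x * bumps M n x - \sum_(0 <= j < M) theta j * bump_at n j x ^+ 3).
  exists q; congr (H2 _ _ _) : H; apply/funext => x; rewrite /bumps_residual; ring.
elim: M => [|M [q IH]].
  exists (fun=> 0); rewrite (_ : bumps 0 n = (fun=> 0)); last exact/funext/bumps0.
  rewrite (_ : (fun x => _) = (fun=> 0)); first exact: H2_0.
  by apply/funext => x; rewrite big_geq// mulr0 subr0.
have H := H2_shift (- (M.+1%:R * n%:R * T)) Hpsi.
have {}H := H2D IH (H2Z (theta M) H); eexists; move: H.
rewrite (_ : (fun x => bumps M n x + _) = bumps M.+1 n); last first.
  by apply/funext => x; rewrite bumpsS.
move=> H; congr (H2 _ _ _) : H; apply/funext => x.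
by rewrite bumpsS big_nat_recr//= eqpsi bump_shift /bump_at; ring.
Qed.

Lemma bump_at_nb n j : nb (bump_at n j) (nrm psi).
Proof. by apply: nb_shift; apply: nb_nrm; case: Hpsi. Qed.

Lemma bumps_nb M n : nb (bumps M n) (M%:R * nrm psi).
Proof.
elim: M => [|M IH].
  by rewrite mul0r (_ : bumps 0 n = (fun=> 0)); [exact: nb0|exact/funext/bumps0].
rewrite (_ : bumps M.+1 n = (fun x => bumps M n x + theta M * bump_at n M x)).
  apply: nb_le (nbD IH (nbZ (theta M) (bump_at_nb n M))) _.
  by rewrite ntheta mul1r -natr1 mulrDl mul1r.
by apply/funext => x; exact: bumpsS.
Qed.

(** With a the sum of the old bumps and c the new bump with sign t, the residual changes by -3 a c
    (t a + c), by t^2 = 1. The product [G] of a and c is uniformly small, and the last factor is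
    bounded in L^2 independently of n. *)
Lemma bumps_residual_small M e : 0 < e ->
  exists N, forall n, (N <= n)%N -> nb (bumps_residual M n) e.
Proof.
elim: M e => [|M IH] e e0.
  exists 0%N => n _; rewrite (_ : bumps_residual 0 n = (fun=> 0)).
    by apply: nb_le nb0 (ltW e0).
  by apply/funext => x; rewrite /bumps_residual bumps0 big_geq// expr0n/= subr0.
have e2 : 0 < e / 2 by rewrite divr_gt0.
have [N1 h1] := IH _ e2.
have npsi := nrm_ge0 psi.
pose D : R := 3 * ((M%:R + 1) * (nrm psi + 1)) * ((M%:R + 1) * (Bpsi + 1)).
have M1 : 0 < M%:R + 1 :> R by rewrite ltr_wpDl.
have D0 : 0 < D by rewrite !mulr_gt0// ltr_wpDl.
have e3 : 0 < e / 2 / D by rewrite divr_gt0.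
have [r hr] := tail e3.
have [N hN] := large_multiple (4 * r) T0.
exists (maxn N N1) => n; rewrite geq_max => /andP[nN nN1].
have NT := hN n nN.
have te x : n%:R * T / 4 <= `|x| -> `|psi x| <= e / 2 / D.
  by move=> hx; apply: hr; apply: le_trans hx; lra.
have eD0 := ltW e3.
have nT0 : 0 <= n%:R * T by rewrite mulr_ge0// ltW.
pose G x := bumps M n x * bump_at n M x.
(* At every x at least one factor is in its tail: c to the left of the threshold, a to the right. *)
have G1 x : `|G x| <= e / 2 / D * ((M%:R + 1) * (Bpsi + 1)).
  have B0 : 0 <= Bpsi + 1 by rewrite addr_ge0.
  have M0 : 0 <= M%:R :> R by [].
  have [hx|hx] := leP x (M.+1%:R * n%:R * T - n%:R * T / 4).
    rewrite /G normrM mulrC; apply: ler_pM => //; first exact: (bump_small_left te).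
    apply: le_trans (bumps_bounded M n x) _.
    by apply: ler_pM => //; lra.
  have hx' : M%:R * n%:R * T + n%:R * T / 4 <= x.
    by move: hx; rewrite -natr1 !mulrDl mul1r; lra.
  rewrite /G normrM; apply: (@le_trans _ _ (M%:R * (e / 2 / D) * Bpsi)).
    by apply: ler_pM => //; [exact: (bumps_small_right te)|exact: psiB].
  have -> : M%:R * (e / 2 / D) * Bpsi = e / 2 / D * (M%:R * Bpsi) by ring.
  apply: ler_wpM2l => //.
  by apply: ler_pM => //; lra.
have mG : measurable_fun setT G.
  by apply: measurable_funM; [exact: bumps_measurable|exact: bump_at_measurable].
have nS : nb (fun x => theta M * bumps M n x + bump_at n M x) ((M%:R + 1) * (nrm psi + 1)).
  apply: nb_le (nbD (nbZ (theta M) (bumps_nb M n)) (bump_at_nb n M)) _.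
  by rewrite ntheta mul1r; have : 0 <= M%:R :> R by []; lra.
have := nbB (h1 n nN1) (nbZ 3 (nb_bounded_mul mG G1 nS)).
move=> nr; apply: (eq_nb _ (nb_le nr _)).
  move=> x; rewrite /G /bumps_residual bumpsS big_nat_recr//=.
  have := theta2 M; set t := theta M => t2.
  have t3 : t ^+ 3 = t by rewrite exprSr t2 mul1r.
  move: (\sum_(0 <= j < M) _) (bumps M n x) (bump_at n M x) => S a c.
  have -> : (a + t * c) ^+ 3 = a ^+ 3 + 3 * t * a ^+ 2 * c + 3 * t ^+ 2 * a * c ^+ 2 + t ^+ 3 * c ^+ 3 by ring.
  by rewrite t2 t3; ring.
rewrite (@ger0_norm _ 3)//.
have -> : 3 * (e / 2 / D * ((M%:R + 1) * (Bpsi + 1)) * ((M%:R + 1) * (nrm psi + 1))) = e / 2 / D * D.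
  by rewrite /D; ring.
by rewrite divfK ?gt_eqF//; lra.
Qed.

End multi_bump.

(** * Nonlinear perturbation *)

Section nonlinear.
Context {R : realType}.
Local Notation mu := (@lebesgue_measure R).
Implicit Types (f g h u v w p q a Q : R -> R) (B C K d e r : R).

(** With S = C (4 r), the quantity 6 B S + 3 S^2 is the Lipschitz constant of a |-> 3 w a^2 + a^3 on
    |a| <= S when |w| <= B; the last factor C is that of the solution operator. *)
Lemma small_radius B C : 0 <= B -> 0 <= C -> exists r0 : R, 0 < r0 /\
  forall r, 0 <= r -> r <= r0 ->
    (6 * B * (C * (4 * r)) + 3 * (C * (4 * r)) ^+ 2) * C <= 1 / 4.
Proof.
move=> B0 C0; pose D := 24 * B * C ^+ 2 + 48 * C ^+ 3.
have D0 : 0 <= D by rewrite addr_ge0// !mulr_ge0// exprn_ge0.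
have D1 : 0 < 4 * (D + 1) by rewrite mulr_gt0// ltr_wpDl.
exists (Num.min 1 (1 / (4 * (D + 1)))); split.
  by rewrite lt_min ltr01 divr_gt0.
move=> r r0; rewrite le_min => /andP[r1 rD].
apply: (@le_trans _ _ (D * r)).
  have -> : (6 * B * (C * (4 * r)) + 3 * (C * (4 * r)) ^+ 2) * C =
    24 * B * C ^+ 2 * r + 48 * C ^+ 3 * (r * r) by ring.
  have -> : D * r = 24 * B * C ^+ 2 * r + 48 * C ^+ 3 * r by rewrite /D; ring.
  rewrite lerD2l; apply: ler_wpM2l.
    by rewrite mulr_ge0// exprn_ge0.
  by rewrite -[leRHS]mulr1 ler_wpM2l.
move: rD; rewrite ler_pdivlMr//; nra.
Qed.

(** [A f] is the correction produced by the datum f, and [E] the defect of A as an inverse of the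
    linearization. On the ball of radius 4 r the nonlinear terms contribute at most r / 2, the
    residual r and the defect r; differences shrink by 1/4 + 1/4. *)
Lemma nonlinear_fixpoint (A E : (R -> R) -> R -> R) w (res : R -> R) Bw C r :
  0 <= C -> measurable_fun setT w -> (forall x, `|w x| <= Bw) -> nb res r ->
  (forall f K, nb f K -> nb (A f) (C * K)) ->
  (forall f K x, nb f K -> `|A f x| <= C * K) ->
  (forall f g K, L2 f -> L2 g -> nb (fun x => f x - g x) K ->
     nb (fun x => A f x - A g x) (C * K)) ->
  (forall f K, nb f K -> nb (E f) (K / 4)) ->
  (forall f g K, L2 f -> L2 g -> nb (fun x => f x - g x) K ->
     nb (fun x => E f x - E g x) (K / 4)) ->
  (6 * Bw * (C * (4 * r)) + 3 * (C * (4 * r)) ^+ 2) * C <= 1 / 4 ->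
  exists f, nb f (4 * r) /\
    {ae mu, forall x, f x = 3 * w x * A f x ^+ 2 + A f x ^+ 3 - res x - E f x}.
Proof.
move=> C0 mw wB nres A1 A2 A3 E1 E3 small.
have r0 := nb_ge0 nres.
have Bw0 : 0 <= Bw by apply: le_trans (wB 0); exact: normr_ge0.
set S := C * (4 * r) in small.
have S0 : 0 <= S by rewrite !mulr_ge0.
have BS0 : 0 <= Bw * S by rewrite mulr_ge0.
have bw3 x y : `|y| <= S -> `|3 * w x * y| <= 3 * (Bw * S).
  by move=> yS; rewrite -mulrA normrM (@ger0_norm _ 3)// ler_pM2l// normrM ler_pM.
have sq y : `|y| <= S -> `|y ^+ 2| <= S ^+ 2.
  by move=> yS; rewrite normrX; apply: lerXn2r; rewrite ?nnegrE.
have prod y z : `|y| <= S -> `|z| <= S -> `|y * z| <= S ^+ 2.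
  by move=> yS zS; rewrite normrM expr2 ler_pM.
have mA f : nb f (4 * r) -> measurable_fun setT (A f).
  by move=> nf; exact: nb_measurable (A1 _ _ nf).
apply: L2_fixpoint; first by rewrite mulr_ge0.
- move=> f nf; have mAf := mA _ nf.
  have bA x : `|3 * w x * A f x + A f x ^+ 2| <= 3 * (Bw * S) + S ^+ 2.
    apply: le_trans (ler_normD _ _) _.
    by apply: lerD; [apply: bw3|apply: sq]; exact: A2.
  have mB : measurable_fun setT (fun x => 3 * w x * A f x + A f x ^+ 2).
    apply: measurable_funD; last exact: measurable_funX.
    by apply: measurable_funM => //; exact: measurable_funM.
  have n1 := nb_bounded_mul mB bA (A1 _ _ nf).
  have := nbB (nbB n1 nres) (E1 _ _ nf).
  move=> h; apply: (eq_nb _ (nb_le h _)) => [x|]; first by ring.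
  have : (3 * (Bw * S) + S ^+ 2) * C * (4 * r) <= 1 / 8 * (4 * r).
    apply: ler_wpM2r; first by rewrite mulr_ge0.
    have : 0 <= S ^+ 2 * C by rewrite mulr_ge0// exprn_ge0.
    move: small; lra.
  by rewrite /S; lra.
- move=> f g K nf ng nfg; have mAf := mA _ nf; have mAg := mA _ ng.
  have bA x : `|3 * w x * A f x + 3 * w x * A g x +
       (A f x ^+ 2 + A f x * A g x + A g x ^+ 2)| <= 6 * Bw * S + 3 * S ^+ 2.
    have a1 := A2 _ _ x nf; have a2 := A2 _ _ x ng.
    have -> : 6 * Bw * S + 3 * S ^+ 2 = 3 * (Bw * S) + 3 * (Bw * S) + (S ^+ 2 + S ^+ 2 + S ^+ 2) by ring.
    apply: le_trans (ler_normD _ _) _; apply: lerD.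
      by apply: le_trans (ler_normD _ _) _; apply: lerD; exact: bw3.
    apply: le_trans (ler_normD _ _) _; apply: lerD; last exact: sq.
    by apply: le_trans (ler_normD _ _) _; apply: lerD; [exact: sq|exact: prod].
  have mB : measurable_fun setT (fun x => 3 * w x * A f x + 3 * w x * A g x +
       (A f x ^+ 2 + A f x * A g x + A g x ^+ 2)).
    apply: measurable_funD.
      by apply: measurable_funD; apply: measurable_funM => //; exact: measurable_funM.
    apply: measurable_funD; last exact: measurable_funX.
    by apply: measurable_funD; [exact: measurable_funX|exact: measurable_funM].
  have K0 := nb_ge0 nfg.
  have n1 := nb_bounded_mul mB bA (A3 _ _ _ (nb_L2 nf) (nb_L2 ng) nfg).
  have := nbB n1 (E3 _ _ _ (nb_L2 nf) (nb_L2 ng) nfg).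
  move=> h; apply: (eq_nb _ (nb_le h _)) => [x|]; first by ring.
  rewrite mulrA.
  have : (6 * Bw * S + 3 * S ^+ 2) * C * K <= 1 / 4 * K by exact: ler_wpM2r.
  lra.
Qed.

(** K and r0 are chosen before w and depend on it only through its sup bound and the constant C,
    hence not on n. The correction is linear in the residual, which gives convergence as well as
    existence. *)
Lemma Inv_nonlinear (W : R -> R) C BW (Bw : R) : measurable_fun setT W ->
  (forall x, `|W x| <= BW) -> 0 <= Bw -> 0 <= C ->
  exists K r0, [/\ 0 <= K, 0 < r0 &
    forall w q (res : R -> R) r, (forall x, `|w x| <= Bw) ->
    H2 w q (fun x => W x * w x - w x ^+ 3 - res x) ->
    Inv (fun x => W x - 3 * w x ^+ 2) C ->
    nb res r -> r <= r0 ->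
    exists a b c, [/\ H2 a b c, [/\ nb a (K * r), nb b (K * r) & nb c (K * r)],
      (exists q', H2 (fun x => w x + a x) q'
        (fun x => W x * (w x + a x) - (w x + a x) ^+ 3)) &
      (exists C', Inv (fun x => W x - 3 * (w x + a x) ^+ 2) C')]].
Proof.
move=> mW WB Bw0 C0.
have BW0 : 0 <= BW by apply: le_trans (WB 0); exact: normr_ge0.
have C2 : 0 <= 2 * C by rewrite mulr_ge0.
have [r1 [r10 hr1]] := small_radius Bw0 C2.
(* The norm of the correction is at most C (4 r), and its sup norm at most twice that. *)
pose K := 8 * C.
have K0 : 0 <= K by rewrite mulr_ge0.
pose D : R := 3 * (K + 1) * (2 * Bw + 1) * (C + 1).
have D0 : 0 < D.
  by rewrite !mulr_gt0// ltr_wpDl// mulr_ge0.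
(* The three thresholds serve the contraction, the bound |a| <= 1, and the perturbation of the
   potential by 6 w a + 3 a^2, which must be small for [Inv_perturb]. *)
exists K, (Num.min r1 (Num.min (1 / (K + 1)) (1 / (2 * D)))); split=> //.
  have K1 : 0 < K + 1 by rewrite ltr_wpDl.
  by rewrite !lt_min r10 !divr_gt0// mulr_gt0.
move=> w0 q0 res r wB Hw iQ nres; rewrite !le_min => /and3P[rr1 rK rD].
have r0 := nb_ge0 nres.
have mw : measurable_fun setT w0 by have [/W1_measurable] := Hw.
set Q := (fun x => W x - 3 * w0 x ^+ 2) in iQ.
have [U [P [HU UC UL]]] := Inv_solver iQ.
have [_ apri] := iQ.
have sup f L x : nb f L -> `|U f x| <= 2 * (C * L).
  move=> nf; have [Wu _ _ _ _] := HU _ (nb_L2 nf); have [n1 n2] := UC _ _ nf.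
  exact: W1_sup Wu n1 n2.
have dbl L : 0 <= L -> C * L <= 2 * C * L.
  by move=> L0; have := mulr_ge0 C0 L0; lra.
(* The inversion is exact, so the defect is 0; [2 * C] accommodates the factor 2 of the Sobolev
   embedding. *)
have [||||||f [nf ef]] := @nonlinear_fixpoint U (fun _ _ => 0) w0 res Bw (2 * C) r C2 mw wB nres.
- by move=> f L nf; have [n1 _] := UC _ _ nf; apply: nb_le n1 (dbl _ (nb_ge0 nf)).
- by move=> f L x nf; rewrite -mulrA; exact: sup.
- move=> f g L Lf Lg nfg; have [n1 _] := UL _ _ _ Lf Lg nfg.
  exact: nb_le n1 (dbl _ (nb_ge0 nfg)).
- by move=> f L nf; apply: nb_le nb0 _; rewrite divr_ge0//; exact: nb_ge0 nf.
- move=> f g L _ _ nf; rewrite subrr; apply: nb_le nb0 _.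
  by rewrite divr_ge0//; exact: nb_ge0 nf.
- exact: hr1.
have HUf := HU _ (nb_L2 nf).
have [|n1 n2 n3] := apri _ _ _ (4 * r) HUf.
  by apply: eq_nb nf => x; ring.
have KC : C * (4 * r) <= K * r by rewrite /K; have := mulr_ge0 C0 r0; lra.
exists (U f), (P f), (fun x => Q x * U f x - f x); split=> //.
- by split; [exact: nb_le n1 KC|exact: nb_le n2 KC|exact: nb_le n3 KC].
- eexists; apply: H2_ae (H2D Hw HUf) _ _.
    have mU := nb_measurable n1.
    apply: measurable_funB.
      by apply: measurable_funM => //; exact: measurable_funD.
    by apply: measurable_funX; exact: measurable_funD.
  apply: (ae_imp _ ef) => x; rewrite /Q subr0 => fx; lra.
- have supU x : `|U f x| <= K * r.
    by have := sup _ _ x nf; rewrite /K; lra.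
  have Kr1 : K * r <= 1.
    have : r * (K + 1) <= 1 by move: rK; rewrite ler_pdivlMr// ltr_wpDl.
    lra.
  have mU := nb_measurable n1.
  have mQ v : measurable_fun setT v -> measurable_fun setT (fun x => W x - 3 * v x ^+ 2).
    move=> mv; apply: measurable_funB => //.
    by apply: measurable_funM => //; exact: measurable_funX.
  eexists; apply: (@Inv_perturb _ Q _ (BW + 3 * (Bw + 1) ^+ 2) C (3 * (K * r * (2 * Bw + 1))) iQ) => //.
  + by apply: mQ; exact: measurable_funD.
  + exact: mQ.
  + move=> x; apply: le_trans (ler_normB _ _) _; apply: lerD => //.
    rewrite normrM (@ger0_norm _ 3)// ler_pM2l// normrX.
    apply: lerXn2r; rewrite ?nnegrE ?addr_ge0//.
    by apply: le_trans (ler_normD _ _) _; apply: lerD => //; exact: le_trans (supU x) Kr1.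
  + move=> x; rewrite /Q.
    have -> : W x - 3 * (w0 x + U f x) ^+ 2 - (W x - 3 * w0 x ^+ 2) =
      3 * (- U f x * (2 * w0 x + U f x)) by ring.
    rewrite normrM (@ger0_norm _ 3)// ler_pM2l// normrM normrN; apply: ler_pM => //.
    apply: le_trans (ler_normD _ _) _; apply: lerD; last exact: le_trans (supU x) Kr1.
    by rewrite normrM (@ger0_norm _ 2)// ler_pM2l.
  + have Dr : r * (2 * D) <= 1 by move: rD; rewrite ler_pdivlMr// mulr_gt0.
    apply: (@le_trans _ _ (r * D)); last lra.
    have -> : 3 * (K * r * (2 * Bw + 1)) * C = r * (3 * K * (2 * Bw + 1) * C) by ring.
    apply: ler_wpM2l => //; rewrite /D.
    have b1 : 0 <= 2 * Bw + 1 by rewrite addr_ge0// mulr_ge0.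
    apply: ler_pM => //; [by rewrite !mulr_ge0| |by rewrite lerDl].
    by apply: ler_wpM2r => //; lra.
Qed.

Section with_bump.
Context (b : R -> R) (sb : smooth b) (b01 : forall x, 0 <= b x <= 1)
  (b1 : forall x, `|x| <= 1 -> b x = 1) (b0 : forall x, 2 <= `|x| -> b x = 0).

Lemma L2_ae f g : L2 f -> measurable_fun setT g -> {ae mu, forall x, f x = g x} ->
  L2 g /\ nrm g = nrm f.
Proof.
move=> Lf mg fg; have ng := nb_ae (nb_nrm Lf) mg fg; split; first exact: nb_L2 ng.
have Lg := nb_L2 ng.
have nf := nb_ae (nb_nrm Lg) (proj1 Lf) (ae_sym fg).
by apply/eqP; rewrite eq_le; apply/andP; split; [case: ng|case: nf].
Qed.

Section equation.
Context (omega mu0 : R) (V W : R -> R) (BW : R)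
  (WE : forall x, W x = mu0 * V x + omega) (mV : measurable_fun setT V)
  (WB : forall x, `|W x| <= BW).

Let mW : measurable_fun setT W.
Proof.
rewrite (_ : W = (fun x => mu0 * V x + omega)); last exact/funext.
by apply: measurable_funD => //; exact: measurable_funM.
Qed.

Lemma linearization_ae f v phi u h : {ae mu, forall x, f x = v x} ->
  {ae mu, forall x, phi x = u x} -> {ae mu, forall x, wderiv (wderiv phi) x = h x} ->
  {ae mu, forall x, (W x - 3 * v x ^+ 2) * u x - h x = linearization omega mu0 V f phi x}.
Proof.
move=> fv pu ph; apply: (ae_imp _ (ae_and fv (ae_and pu ph))) => x [e1 [e2 e3]].
by rewrite /linearization e1 e2 e3 WE; ring.
Qed.

Lemma linearization_measurable f phi : measurable_fun setT f -> measurable_fun setT phi ->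
  measurable_fun setT (wderiv (wderiv phi)) ->
  measurable_fun setT (linearization omega mu0 V f phi).
Proof.
move=> mf mphi mh; rewrite /linearization.
have m3 : measurable_fun setT (fun x => 3 * f x ^+ 2).
  by apply: measurable_funM => //; exact: measurable_funX.
apply: measurable_funB; last exact: measurable_funM.
apply: measurable_funD; last exact: measurable_funM.
apply: measurable_funD; first exact: measurableT_comp.
by apply: measurable_funM => //; exact: measurable_funM.
Qed.

Lemma is_solution_of_W1 f v q : measurable_fun setT f -> {ae mu, forall x, f x = v x} ->
  W1 v q -> W1 q (fun x => W x * v x - v x ^+ 3) -> is_solution omega mu0 V f.
Proof.
move=> mf fv Wv Wq; have [H _ _ _ e2] := W1_in_H2loc sb b01 b1 b0 Wv Wq mf fv.
split=> //; apply: (ae_imp _ (ae_and fv e2)) => x [-> ->]; rewrite WE; ring.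
Qed.

Lemma nondegenerate_of_Inv f v q C : measurable_fun setT f ->
  {ae mu, forall x, f x = v x} -> H2 v q (fun x => W x * v x - v x ^+ 3) ->
  Inv (fun x => W x - 3 * v x ^+ 2) C -> nondegenerate_solution omega mu0 V f.
Proof.
move=> mf fv [Wv Wq Lv Lq _] [ex ap].
have [M hM] := W1_bounded Wv Lv Lq.
split; first exact: is_solution_of_W1 fv Wv Wq.
  by exists M; apply: (ae_imp _ fv) => x ->.
have rep phi : in_H2 phi -> exists u p h, [/\ H2 u p h, {ae mu, forall x, phi x = u x},
    {ae mu, forall x, (W x - 3 * v x ^+ 2) * u x - h x = linearization omega mu0 V f phi x} &
    measurable_fun setT (linearization omega mu0 V f phi)].
  move=> Hphi; have [u [p [H pu pp mphi]]] := in_H2_H2 sb b01 b1 b0 Hphi.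
  exists u, p, (wderiv (wderiv phi)); split=> //.
    by apply: linearization_ae => //; exact: aeW.
  by apply: linearization_measurable => //; have [_ [[mh _] _ _] _ _ _] := H.
have LQ u p h : H2 u p h -> L2 (fun x => (W x - 3 * v x ^+ 2) * u x - h x).
  move=> [_ _ Lu _ Lh]; apply: L2B => //.
  apply: (@L2_bounded_mul _ _ (BW + 3 * M ^+ 2)) => //.
    by apply: potential_measurable => //; exact: W1_measurable Wv.
  exact: potential_bounded.
split.
- move=> phi /rep[u [p [h [H pu E mE]]]]; apply/in_L2_setT.
  by have [] := L2_ae (LQ _ _ _ H) mE E.
- move=> phi1 phi2 /rep[u1 [p1 [h1 [H1 pu1 E1 mE1]]]] /rep[u2 [p2 [h2 [H2' pu2 E2 mE2]]]] E.
  have [|n _ _] := ap _ _ _ 0 (H2B H1 H2').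
    apply: nb_ae nb0 _ _.
      by have [] := LQ _ _ _ (H2B H1 H2').
    apply: (ae_imp _ (ae_and E (ae_and E1 E2))) => x [e [e1 e2]].
    by rewrite -e1 -e2 in e; rewrite mulrBr; lra.
  rewrite mulr0 in n.
  apply: (ae_imp _ (ae_and (nrm0_ae n) (ae_and pu1 pu2))) => x [z [-> ->]].
  by apply/eqP; rewrite -subr_eq0 z.
- move=> g /in_L2_setT Lg; have [u [p H]] := ex g Lg; exists u.
  have mu' : measurable_fun setT u by have [/W1_measurable] := H.
  have [Hu _ _ e2] := H2_in_H2 sb b01 b1 b0 H mu' (aeW _ (fun x => erefl)).
  split=> //; have uu : {ae mu, forall x, u x = u x} by exact: aeW.
  have := linearization_ae fv uu e2.
  by apply: ae_imp => x <-; ring.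
- exists C => phi Hphi; have [u [p [h [H pu E mE]]]] := rep _ Hphi.
  have [LA nA] := L2_ae (LQ _ _ _ H) mE E.
  have Lu : L2 u by case: H.
  have mphi : measurable_fun setT phi by have [_ _ /in_L2_setT[]] := Hphi.
  have [Lphi nphi] := L2_ae Lu mphi (ae_sym pu).
  rewrite !L2norm_setT// nA nphi -EFinM lee_fin.
  by have [_ hu] := (let: And3 n _ _ := ap _ _ _ _ H (nb_nrm (LQ _ _ _ H)) in n).
Qed.

(** The hypothesis bounds only the L^2 norm of the preimage. The bounds on its derivatives come from
    [Inv_of_right_inverse]. *)
Lemma Inv_of_nondegenerate f v : {ae mu, forall x, f x = v x} ->
  measurable_fun setT v -> (exists M, forall x, `|v x| <= M) ->
  nondegenerate_solution omega mu0 V f ->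
  exists C, 0 <= C /\ Inv (fun x => W x - 3 * v x ^+ 2) C.
Proof.
move=> fv mv [M vM] [[[[f' wf] _ _ _ _] _] _ [_ _ ex [C bd]]].
have mf : measurable_fun setT f by have [/locally_integrable_lint[]] := wf.
(* The constant in [invertible_operator] carries no sign. *)
pose C' : R := `|C|.
have C'0 : 0 <= C' by exact: normr_ge0.
have mQ := potential_measurable mW mv.
have QB := potential_bounded WB vM.
have B0 : 0 <= BW + 3 * M ^+ 2.
  by apply: le_trans (QB 0); exact: normr_ge0.
exists (2 * C' + 1 + (BW + 3 * M ^+ 2) * C'); split.
  by rewrite !addr_ge0// ?mulr_ge0.
apply: (Inv_of_right_inverse mQ QB) => // g K ng.
have [phi [Hphi Eg]] := ex g (proj2 (in_L2_setT g) (nb_L2 ng)).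
have [u [p [H pu pp mphi]]] := in_H2_H2 sb b01 b1 b0 Hphi.
have hh : {ae mu, forall x, wderiv (wderiv phi) x = wderiv (wderiv phi) x} by exact: aeW.
have L := linearization_ae fv pu hh.
have mu' : measurable_fun setT u by have [/W1_measurable] := H.
exists u, p; split.
  apply: H2_ae H _ _.
    by apply: measurable_funB; [exact: measurable_funM|exact: nb_measurable ng].
  by apply: (ae_imp _ (ae_and L Eg)) => x [e1 e2]; rewrite -e2 -e1; ring.
have Lu : L2 u by case: H.
split=> //.
have := bd _ Hphi.
have [Lphi nphi] := L2_ae Lu mphi (ae_sym pu).
have EN : L2norm setT (linearization omega mu0 V f phi) = L2norm setT g.
  rewrite /L2norm !patch_setT !Lnorm2E; congr (_ `^ _)%E.
  have mg := nb_measurable ng.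
  have mA : measurable_fun setT (linearization omega mu0 V f phi).
    apply: linearization_measurable => //.
    by have [_ [[mh _] _ _] _ _ _] := H.
  apply: ae_eq_integral => //.
  - by apply/measurable_EFinP; exact: measurable_funX.
  - by apply/measurable_EFinP; exact: measurable_funX.
  - by apply: (ae_imp _ Eg) => x ->.
rewrite EN !L2norm_setT//; last exact: nb_L2 ng.
rewrite nphi -EFinM lee_fin => h; apply: le_trans h _.
have n0 := nrm_ge0 g.
apply: (@le_trans _ _ (C' * nrm g)); first by apply: ler_wpM2r => //; exact: ler_norm.
by apply: ler_wpM2l => //; case: ng.
Qed.

End equation.

End with_bump.

End nonlinear.

(** * Periodization *)

Section periodization.
Context {R : realType}.
Local Notation mu := (@lebesgue_measure R).
Implicit Types (f g h u v w p q : R -> R) (B C K d e r : R).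
Context (l : R) (l0 : 0 < l).

(* For v vanishing outside (-3l/2, 3l/2), [wrap N v x] agrees with the sum of
   v over x + 2 l Z as soon as |x| + 3l/2 <= 2 l N. *)
Definition wrap (N : nat) v x :=
  \sum_(0 <= i < N) (v (x + 2 * l * i%:R) + v (x - 2 * l * i.+1%:R)).

(** A finite sum whose length depends on x: for narrow v the omitted terms vanish, so no convergence
    question arises. *)
Definition periodize v x := wrap (Num.bound (`|x| / l)).+1 v x.

(** The support may exceed the cell [-l, l] by l / 2 on each side, since localized solutions need
    room outside the cell to decay; neighbouring copies may overlap. *)
Definition narrow v := forall x, 3 * l / 2 <= `|x| -> v x = 0.

Lemma wrapS N v x : wrap N.+1 v x =
  wrap N v x + (v (x + 2 * l * N%:R) + v (x - 2 * l * N.+1%:R)).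
Proof. by rewrite /wrap big_nat_recr. Qed.

Lemma wrap0 v x : wrap 0 v x = 0. Proof. by rewrite /wrap big_geq. Qed.

Lemma wrap2 v x : wrap 2 v x =
  v x + v (x - 2 * l) + (v (x + 2 * l) + v (x - 4 * l)).
Proof.
rewrite !wrapS wrap0 add0r mulr0 addr0 !mulr1; congr (_ + _ + (_ + v _)).
by rewrite -[2%:R]/(2 : R); ring.
Qed.

Lemma wrap_stable v N M (x : R) : narrow v -> `|x| + 3 * l / 2 <= 2 * l * N%:R ->
  (N <= M)%N -> wrap M v x = wrap N v x.
Proof.
move=> nv xN /subnK <-; elim: (M - N)%N => [|m IH]; first by rewrite add0n.
rewrite addSn wrapS IH !nv ?addr0//.
  have h : 2 * l * N%:R <= 2 * l * (m + N).+1%:R.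
    by rewrite ler_pM2l ?mulr_gt0// ler_nat -addSn leq_addl.
  have K0 : 0 <= 2 * l * (m + N).+1%:R by rewrite !mulr_ge0// ltW.
  have := ler_distD x (2 * l * (m + N).+1%:R) 0; rewrite !subr0 (ger0_norm K0).
  by rewrite distrC; lra.
have h : 2 * l * N%:R <= 2 * l * (m + N)%:R.
  by rewrite ler_pM2l ?mulr_gt0// ler_nat leq_addl.
have K0 : 0 <= 2 * l * (m + N)%:R by rewrite !mulr_ge0// ltW.
have := ler_distD (- x) (2 * l * (m + N)%:R) 0; rewrite !subr0 normrN.
by rewrite (ger0_norm K0) opprK (addrC x); lra.
Qed.

Lemma periodizeE v N (x : R) : narrow v -> `|x| + 3 * l / 2 <= 2 * l * N%:R ->
  periodize v x = wrap N v x.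
Proof.
move=> nv xN; rewrite /periodize; set M := (_).+1.
have xM : `|x| + 3 * l / 2 <= 2 * l * M%:R.
  have := archi_boundP (divr_ge0 (normr_ge0 (x : R)) (ltW l0)).
  rewrite ltr_pdivrMr// /M; set b := Num.bound _ => h.
  have -> : b.+1%:R = b%:R + 1 :> R by rewrite -natr1.
  move: b h => b h; clear M.
  have : 0 <= b%:R * l by rewrite mulr_ge0// ltW.
  by have := l0; lra.
have [MN|NM] := leqP M N; first by rewrite -(wrap_stable nv xM MN).
exact: wrap_stable nv xN (ltnW NM).
Qed.

Lemma periodize2 v (x : R) : narrow v -> `|x| <= 5 * l / 2 -> periodize v x = wrap 2 v x.
Proof.
move=> nv xl; apply: periodizeE => //.
by rewrite -[2%:R]/(2 : R); lra.
Qed.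

Lemma wrap_translate v N x :
  wrap N v (x + 2 * l) = wrap N v x + v (x + 2 * l * N%:R) - v (x - 2 * l * N%:R).
Proof.
elim: N => [|N IH]; first by rewrite !wrap0 mulr0 addr0 subr0 add0r subrr.
have E : N.+1%:R = N%:R + 1 :> R by rewrite -natr1.
rewrite !wrapS IH E.
have -> : x + 2 * l + 2 * l * N%:R = x + 2 * l * (N%:R + 1) by ring.
have -> : x + 2 * l - 2 * l * (N%:R + 1) = x - 2 * l * N%:R by ring.
ring.
Qed.

Lemma large_wrap (B : R) : exists N, forall n, (N <= n)%N -> B + 3 * l / 2 <= 2 * l * n%:R.
Proof.
have [N hN] := large_multiple (B + 3 * l / 2) l0.
exists N => n /hN h; apply: le_trans h _.
by rewrite mulrC; have := mulr_ge0 (ltW l0) (ler0n R n); lra.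
Qed.

Lemma periodize_periodic v : narrow v -> periodic (periodize v) (2 * l).
Proof.
move=> nv; suff h (x : R) : periodize v (x + 2 * l) = periodize v x by exact: h.
have [N hN] := large_wrap (`|x| + 2 * l).
have xN : `|x| + 2 * l + 3 * l / 2 <= 2 * l * N%:R := hN N (leqnn N).
rewrite !(@periodizeE v N)//; last first.
- apply: le_trans xN; rewrite lerD2r; apply: le_trans (ler_normD _ _) _.
  by rewrite (@ger0_norm _ (2 * l))// mulr_ge0// ltW.
- by apply: le_trans xN; rewrite lerD2r lerDl mulr_ge0// ltW.
have K0 : 0 <= 2 * l * N%:R by rewrite !mulr_ge0// ltW.
rewrite wrap_translate !nv ?addr0 ?subr0//.
  have := ler_distD x (2 * l * N%:R) 0; rewrite !subr0 (ger0_norm K0).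
  by rewrite distrC; have := l0; lra.
have := ler_distD (- x) (2 * l * N%:R) 0; rewrite !subr0 normrN.
by rewrite (ger0_norm K0) opprK (addrC x); have := l0; lra.
Qed.

Lemma wrap_measurable N v : measurable_fun setT v -> measurable_fun setT (wrap N v).
Proof.
move=> mv; apply: measurable_sum => i; apply: measurable_funD.
  by apply: measurableT_comp => //; exact: measurable_shift.
by apply: measurableT_comp => //; exact: measurable_shift.
Qed.

Lemma periodize_measurable v : narrow v -> measurable_fun setT v ->
  measurable_fun setT (periodize v).
Proof.
move=> nv mv; apply: (@measurable_fun_cvg _ _ _ setT (fun n => wrap n v)).
  by move=> n; exact: wrap_measurable.
move=> x _; have [N hN] := large_wrap `|x|.
apply: cvg_near_cst; exists N => // n /= Nn.
by apply/esym; apply: periodizeE => //; exact: hN.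
Qed.

Lemma wrap_nb N v K : nb v K -> nb (wrap N v) (2 * N%:R * K).
Proof.
move=> nv; elim: N => [|N IH].
  by rewrite mulr0 mul0r (_ : wrap 0 v = (fun=> 0)); [exact: nb0|exact/funext/wrap0].
rewrite (_ : wrap N.+1 v = (fun x => wrap N v x +
  (v (x + 2 * l * N%:R) + v (x - 2 * l * N.+1%:R)))); last exact/funext/wrapS.
apply: nb_le (nbD IH (nbD (nb_shift _ nv) (nb_shift _ nv))) _.
by rewrite -natr1; lra.
Qed.

Lemma wrap_W1 N v p : W1 v p -> W1 (wrap N v) (wrap N p).
Proof.
move=> Wv; elim: N => [|N IH].
  rewrite (_ : wrap 0 v = (fun=> 0)); last exact/funext/wrap0.
  by rewrite (_ : wrap 0 p = (fun=> 0)); [exact: W1_cst|exact/funext/wrap0].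
apply: eq_W1 (W1D IH (W1D (W1_shift (2 * l * N%:R) Wv) (W1_shift (- (2 * l * N.+1%:R)) Wv))) => x.
  by rewrite wrapS.
by rewrite wrapS.
Qed.

Lemma wrap_bounded N v B x : (forall y, `|v y| <= B) -> `|wrap N v x| <= 2 * N%:R * B.
Proof.
move=> vB; elim: N => [|N IH]; first by rewrite wrap0 normr0 mulr0 mul0r.
rewrite wrapS; apply: le_trans (ler_normD _ _) _.
have h := ler_normD (v (x + 2 * l * N%:R)) (v (x - 2 * l * N.+1%:R)).
have := vB (x + 2 * l * N%:R); have := vB (x - 2 * l * N.+1%:R).
move: IH h; rewrite -[in X in _ -> _ -> _ -> _ -> _ <= X]natr1; lra.
Qed.

Lemma wrapB N u v x : wrap N (fun y => u y - v y) x = wrap N u x - wrap N v x.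
Proof. by elim: N => [|N IH]; rewrite ?wrap0 ?subr0// !wrapS IH; ring. Qed.

Lemma wrapD N u v x : wrap N (fun y => u y + v y) x = wrap N u x + wrap N v x.
Proof. by elim: N => [|N IH]; rewrite ?wrap0 ?addr0// !wrapS IH; ring. Qed.

Lemma wrapM N (Q v : R -> R) x : periodic Q (2 * l) ->
  wrap N (fun y => Q y * v y) x = Q x * wrap N v x.
Proof.
move=> pQ; elim: N => [|N IH]; first by rewrite !wrap0 mulr0.
rewrite !wrapS IH [2 * l * N%:R]mulrC [2 * l * N.+1%:R]mulrC.
by rewrite (periodic_mulrn N pQ) (periodic_subn N.+1 pQ); ring.
Qed.

Lemma periodize_lint v : narrow v -> lint v -> lint (periodize v).
Proof.
move=> nv lv; split; first by apply: periodize_measurable => //; case: lv.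
move=> a b; have [N hN] := large_wrap (`|a| + `|b|).
have [_ lw] : lint (wrap N v).
  elim: N {hN} => [|N IH].
    rewrite (_ : wrap 0 v = (fun=> 0)); last exact/funext/wrap0.
    by apply: continuous_lint; exact: cst_continuous.
  rewrite (_ : wrap N.+1 v = (fun x => wrap N v x +
    (v (x + 2 * l * N%:R) + v (x - 2 * l * N.+1%:R)))); last exact/funext/wrapS.
  by apply: lintD => //; apply: lintD; exact: lint_shift.
apply: eq_integrable (lw a b) => // x; rewrite inE/= in_itv/= => /andP[ax xb].
congr (_%:E); apply/esym; apply: periodizeE => //.
apply: le_trans (hN N (leqnn N)); rewrite lerD2r ler_norml.
have := ler_norm (- a); have := ler_norm b; rewrite normrN.
by have := normr_ge0 a; have := normr_ge0 b; lra.
Qed.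

(** On a bounded interval both periodizations coincide with one fixed finite [wrap]. *)
Lemma periodize_W1 v p : narrow v -> narrow p -> W1 v p ->
  W1 (periodize v) (periodize p).
Proof.
move=> nv np Wv; have [lp lp2 _] := Wv.
have E : (fun x => periodize p x ^+ 2) = periodize (fun x => periodize p x * p x).
  apply/funext => x.
  by rewrite [in RHS]/periodize wrapM ?expr2//; exact: periodize_periodic.
have lpp := periodize_lint np lp.
have eqw a b : exists N, forall x, a <= x <= b ->
    periodize v x = wrap N v x /\ periodize p x = wrap N p x.
  have [N hN] := large_wrap (`|a| + `|b|); exists N => x /andP[ax xb].
  have xN : `|x| + 3 * l / 2 <= 2 * l * N%:R.
    apply: le_trans (hN N (leqnn N)); rewrite lerD2r ler_norml.
    have := ler_norm (- a); have := ler_norm b; rewrite normrN.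
    by have := normr_ge0 a; have := normr_ge0 b; lra.
  by split; exact: periodizeE.
split=> //.
  split; first by apply: measurable_funX; case: lpp.
  move=> a b; have [N hN] := eqw a b.
  have [_ [_ lw] _] := wrap_W1 N Wv.
  apply: eq_integrable (lw a b) => // x; rewrite inE/= in_itv/= => /hN[_ ->] //.
move=> a b ab; have [N hN] := eqw a b.
have [_ _ WN] := wrap_W1 N Wv.
rewrite (hN a _).1 ?lexx// (hN b _).1 ?lexx ?ab// WN//.
by apply: eq_J => x /hN[].
Qed.

Lemma cell_narrow v : (forall x, x < - l \/ l <= x -> v x = 0) -> narrow v.
Proof.
move=> nv y; have := l0; have [y0|y0] := leP 0 y => l1.
  by rewrite ger0_norm// => h; apply: nv; right; lra.
by rewrite ltr0_norm// => h; apply: nv; left; lra.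
Qed.

Lemma periodize_id v x : (forall x, x < - l \/ l <= x -> v x = 0) ->
  - l <= x < l -> periodize v x = v x.
Proof.
move=> nv /andP[x1 x2]; have nar := cell_narrow nv.
rewrite periodize2//; last by rewrite ler_norml; lra.
rewrite wrap2 (nv (x - 2 * l)); last by left; lra.
rewrite (nv (x + 2 * l)); last by right; lra.
by rewrite (nv (x - 4 * l)); [rewrite !addr0|left; lra].
Qed.

Lemma reduce_period (x : R) : exists n : nat,
  - l <= x - n%:R * (2 * l) < l \/ - l <= x + n%:R * (2 * l) < l.
Proof.
have l20 : 0 < 2 * l by rewrite mulr_gt0.
pose y := (x + l) / (2 * l).
have xE : x = y * (2 * l) - l by rewrite /y divfK ?gt_eqF// addrK.
have := Num.Theory.floor_itv y.
case: (Num.floor y) => n.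
  move=> /andP[h1 h2]; exists n; left.
  move: h1 h2; rewrite intrD -pmulrn => h1 h2; rewrite xE.
  have := ler_wpM2r (ltW l20) h1.
  have : y * (2 * l) < (n%:R + 1) * (2 * l) by rewrite ltr_pM2r.
  by move=> ? ?; apply/andP; split; lra.
move=> /andP[h1 h2]; exists n.+1; right.
rewrite xE; move: h1 h2; rewrite NegzE intrD mulrNz -pmulrn => h1 h2.
have := ler_wpM2r (ltW l20) h1.
have : y * (2 * l) < (- n.+1%:R + 1) * (2 * l) by rewrite ltr_pM2r.
by move=> ? ?; apply/andP; split; lra.
Qed.

Lemma ae_periodic (P : R -> Prop) : (forall x, P (x + 2 * l) <-> P x) ->
  {ae mu, forall x, - l <= x < l -> P x} -> {ae mu, forall x, P x}.
Proof.
move=> pP aP.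
have pPn n x : P (x + n%:R * (2 * l)) <-> P x.
  elim: n => [|n IH]; first by rewrite mul0r addr0.
  rewrite -IH -(pP (x + n%:R * (2 * l))) -natr1.
  by have -> : x + (n%:R + 1) * (2 * l) = x + n%:R * (2 * l) + 2 * l by ring.
have a1 := ae_foralln (fun n => ae_shift (- (n%:R * (2 * l))) aP).
have a2 := ae_foralln (fun n => ae_shift (n%:R * (2 * l)) aP).
apply: (ae_imp _ (ae_and a1 a2)) => x [h1 h2].
have [n [hn|hn]] := reduce_period x.
  by have := h1 n hn; rewrite -(pPn n) subrK.
by have := h2 n hn; rewrite pPn.
Qed.

Lemma periodize_ae u v : {ae mu, forall x, u x = v x} ->
  {ae mu, forall x, periodize u x = periodize v x}.
Proof.
move=> uv.
have a1 := ae_foralln (fun n => ae_shift (2 * l * n%:R) uv).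
have a2 := ae_foralln (fun n => ae_shift (- (2 * l * n.+1%:R)) uv).
apply: (ae_imp _ (ae_and a1 a2)) => x [h1 h2].
by rewrite /periodize /wrap; apply: eq_bigr => i _; rewrite h1 h2.
Qed.

End periodization.

(** * Periodic solutions near a truncated soliton *)

Section periodic_solutions.
Context {R : realType}.
Local Notation mu := (@lebesgue_measure R).
Implicit Types (f g u v w q c : R -> R) (B C K d e r : R).

(** One radius serves all functions dominated by f, which is what makes the smallness uniform over
    the cut-offs. *)
Lemma L2_tail f e : L2 f -> 0 < e -> exists r0, forall g r, r0 <= r ->
  measurable_fun setT g -> (forall x, `|g x| <= `|f x|) ->
  (forall x, `|x| < r -> g x = 0) -> nb g e.
Proof.
move=> [mf sf] e0; have e20 : 0 < e ^+ 2 by rewrite exprn_gt0.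
have [r0 [r00 hr]] := J_cvg_full sf e20.
exists (r0 + 1) => g r rr mg gf g0.
have [Lg _] : nb g (nrm f) by apply: nb_dom1 gf => //; apply: nb_nrm.
have [_ sg] := Lg; apply: nbP => //; first exact: ltW.
have lf := summable_lint sf; have lg := summable_lint sg.
have fg x : 0 <= f x ^+ 2 - g x ^+ 2.
  rewrite subr_ge0 -(real_normK (num_real (f x))) -(real_normK (num_real (g x))).
  by apply: lerXn2r; rewrite ?nnegrE.
have sfg : summable_fun (fun x => f x ^+ 2 - g x ^+ 2).
  have := summableD sf (summableZ (-1) sg).
  by under [X in summable_fun X -> _]eq_fun do rewrite mulN1r.
have := J_le_full (- r0) r0 sfg fg.
rewrite RintegralB// JB//.
rewrite [X in _ - X](_ : _ = 0) ?subr0; last first.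
  rewrite (@eq_J _ _ _ _ (fun=> 0)) ?J_cst ?mul0r//; first by lra.
  move=> x xr; rewrite g0 ?expr0n//.
  have : `|x| <= r0 by rewrite ler_norml.
  lra.
have := hr (- r0) r0 (lexx _) (lexx _); rewrite ler_norml => /andP[_ h1] h2.
lra.
Qed.

(** The given cut-offs have derivatives bounded by 1, with no decay in n assumed; the smallness of
    their commutator terms must come from the decay of the soliton. Passing from 2 l / 3 to 3 l / 4
    leaves room for the derivatives to vanish too. *)
Lemma truncated_cutoff (T : R) (n : nat) chi : 0 < T -> (0 < n)%N ->
  is_cutoff T n chi -> exists c c1 c2, [/\ cutoff c c1 c2 1,
    forall x, - (n%:R / 2 * T) <= x < n%:R / 2 * T -> c x = chi x,
    forall x, `|x| < n%:R / 2 * T / 3 -> [/\ c x = 1, c1 x = 0 & c2 x = 0] &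
    forall x, 3 * (n%:R / 2 * T) / 4 <= `|x| -> [/\ c x = 0, c1 x = 0 & c2 x = 0]].
Proof.
move=> T0 n0 hchi; have [c [sc c01 cE c1 c0]] := cutoff_truncation T0 n0 hchi.
have [_ _ _ dchi _] := hchi.
set l := n%:R / 2 * T in cE c1 c0 *.
have l0 : 0 < l by rewrite mulr_gt0// divr_gt0// ltr0n.
have near_chi x : `|x| < l -> \forall y \near x, c y = chi y.
  move=> xl; have e0 : 0 < l - `|x| by rewrite subr_gt0.
  apply/nbhs_ballP; exists (l - `|x|) => //= y.
  rewrite -ball_normE/= => xy; apply: cE.
  have := ler_distD x 0 y; rewrite !sub0r !normrN; lra.
have d1 x : `|x| < l -> derive1 c x = derive1 chi x.
  by move=> xl; rewrite !derive1E; apply: near_eq_derive; exact: near_chi.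
have d2 x : `|x| < l -> derive1 (derive1 c) x = derive1 (derive1 chi) x.
  move=> xl; rewrite ![derive1 (derive1 _) x]derive1E; apply: near_eq_derive.
  have e0 : 0 < l - `|x| by rewrite subr_gt0.
  apply/nbhs_ballP; exists (l - `|x|) => //= y.
  rewrite -ball_normE/= => xy; apply: d1.
  have := ler_distD x 0 y; rewrite !sub0r !normrN; lra.
have far (m x : R) : m < `|x| -> forall y, `|x - y| < `|x| - m -> m < `|y|.
  move=> mx y xy; have := ler_distD y x 0; rewrite !subr0; lra.
have z1 y : 2 * l / 3 < `|y| -> derive1 c y = 0.
  move=> yl; apply: (@derive1_near_cst _ c 0 y (`|y| - 2 * l / 3)); first by rewrite subr_gt0.
  by move=> z /(far _ _ yl)/ltW; exact: c0.
have z2 y : 2 * l / 3 < `|y| -> derive1 (derive1 c) y = 0.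
  move=> yl; apply: (@derive1_near_cst _ (derive1 c) 0 y (`|y| - 2 * l / 3)); first by rewrite subr_gt0.
  by move=> z /(far _ _ yl); exact: z1.
have close (x : R) : `|x| < l / 3 -> forall y, `|x - y| < l / 3 - `|x| -> `|y| < l / 3.
  move=> mx y xy; have := ler_distD x 0 y; rewrite !sub0r !normrN; lra.
have o1 y : `|y| < l / 3 -> derive1 c y = 0.
  move=> yl; apply: (@derive1_near_cst _ c 1 y (l / 3 - `|y|)); first by rewrite subr_gt0.
  by move=> z /(close _ yl)/ltW; exact: c1.
have o2 y : `|y| < l / 3 -> derive1 (derive1 c) y = 0.
  move=> yl; apply: (@derive1_near_cst _ (derive1 c) 0 y (l / 3 - `|y|)); first by rewrite subr_gt0.
  by move=> z /(close _ yl); exact: o1.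
have l23 : 2 * l / 3 < l by lra.
exists c, (derive1 c), (derive1 (derive1 c)); split.
- have WD f : smooth f -> W1 f (derive1 f).
    move=> sf; apply: W1_deriv => //.
      by move=> x; exact: (@smooth_derivable _ f x sf).
    exact: (smooth_continuous (smooth_derive1 sf)).
  split; [exact: WD|exact/WD/smooth_derive1| | |] => x.
  + by have /andP[h0 h1] := c01 x; rewrite ger0_norm.
  + have [xl|xl] := ltP `|x| l; first by rewrite d1//; exact: (dchi 1%N).
    by rewrite z1 ?normr0//; lra.
  + have [xl|xl] := ltP `|x| l; first by rewrite d2//; exact: (dchi 2%N).
    by rewrite z2 ?normr0//; lra.
- by move=> x /andP[xl lx]; rewrite cE// ler_norml xl ltW.
- by move=> x xl; rewrite c1 ?o1 ?o2// ltW.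
- by move=> x xl; rewrite c0 ?z1 ?z2//; lra.
Unshelve. all: by end_near. Qed.

Lemma outside_cell (l y : R) : 0 < l -> y < - l \/ l <= y -> 3 * l / 4 <= `|y|.
Proof.
move=> l0 hy; rewrite leNgt ltr_norml; apply/negP => /andP[].
by case: hy; lra.
Qed.

Lemma inside_cell (l y : R) : - l <= y < l -> `|y| <= 5 * l / 2.
Proof. by move=> /andP[? ?]; rewrite ler_norml; apply/andP; split; lra. Qed.

Context (BW C0 Bpsi k : R) (W psi p h s : R -> R)
  (mW : measurable_fun setT W) (WB : forall x, `|W x| <= BW)
  (Hpsi : H2 psi p h) (eqpsi : forall x, h x = W x * psi x - psi x ^+ 3)
  (psiB : forall x, `|psi x| <= Bpsi) (iQ : Inv (fun x => W x - 3 * psi x ^+ 2) C0)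
  (C00 : 0 <= C0)
  (ss : smooth s) (sb : forall x, `|s x| <= 1)
  (s1 : forall x, x <= 1 -> s x = 1) (s0 : forall x, 2 <= x -> s x = 0) (k0 : 0 <= k)
  (sk : forall x, `|derive1 s x| <= k /\ `|derive1 (derive1 s) x| <= k).

(** A left and a right cut-off with layers of width l / 4 multiplied together, whence 4 (k / (l /
    4)) = 16 k / l. The support ends at 5 l / 4, within the 3 l / 2 of [narrow]. *)
Lemma cell_cutoff l : 4 <= l -> 4 * k <= l -> exists c c1 c2,
  [/\ cutoff c c1 c2 (16 * k / l), forall x, - l <= x <= l -> c x = 1 &
    forall x, 5 * l / 4 < `|x| -> [/\ c x = 0, c1 x = 0 & c2 x = 0]].
Proof.
move=> l4 kl; have l0 : 0 < l by lra.
have l41 : 1 <= l / 4 by lra.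
have [a [a1 [a2 [ca a_1 a_0]]]] := left_cutoff ss sb s1 s0 k0 sk l l41.
have [b [b1 [b2 [cb b_1 b_0]]]] := right_cutoff ss sb s1 s0 k0 sk (- l) l41.
have kl1 : k / (l / 4) <= 1 by rewrite ler_pdivrMr; lra.
have dE : 4 * (k / (l / 4)) = 16 * k / l by field; rewrite gt_eqF.
rewrite -dE; do 3 eexists; split; first exact: cutoffM ca cb kl1.
  by move=> x /andP[xl lx] /=; rewrite a_1// b_1// mulr1.
move=> x xl /=; have [x0|x0] := leP 0 x.
  rewrite ger0_norm// in xl; have [|-> -> ->] := a_0 x; first lra.
  by rewrite !(mul0r, mulr0, addr0).
rewrite ltr0_norm// in xl; have [|-> -> ->] := b_0 x; first lra.
by rewrite !(mul0r, mulr0, addr0).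
Qed.

(** The comparison extends past the cell, to the support of the cell cut-off. There the neighbouring
    copy is still zero: |x| <= 5 l / 4 keeps x at distance at least 3 l / 4 from its centre. *)
Lemma periodized_potential l e cc : 0 < l -> (forall x, `|cc x| <= 1) ->
  (forall x, `|x| < l / 3 -> cc x = 1) -> (forall x, 3 * l / 4 <= `|x| -> cc x = 0) ->
  (forall x, l / 3 <= `|x| -> `|psi x| <= e) ->
  forall x, `|x| <= 5 * l / 4 ->
  `|periodize l (fun y => cc y * psi y) x ^+ 2 - psi x ^+ 2| <= e ^+ 2.
Proof.
move=> l0 ccB cc1 cc0 tail x xl.
set w0 := fun y => cc y * psi y.
have w0z y : 3 * l / 4 <= `|y| -> w0 y = 0 by move=> yl; rewrite /w0 cc0// mul0r.
have nw : narrow l w0 by move=> y yl; apply: w0z; lra.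
have w0z' y : y < - l \/ l <= y -> w0 y = 0.
  by move=> /(outside_cell l0)/w0z.
have sqe y : l / 3 <= `|y| -> psi y ^+ 2 <= e ^+ 2.
  move=> yl; have he := tail y yl; rewrite -(real_normK (num_real (psi y))).
  by apply: lerXn2r => //; rewrite nnegrE//; apply: le_trans he.
have [hx|hx] := boolP (- l <= x < l).
  rewrite periodize_id//; have [xs|xs] := ltP `|x| (l / 3).
    by rewrite /w0 cc1// mul1r subrr normr0 sqr_ge0.
  have h1 := sqe x xs.
  have h2 : 0 <= w0 x ^+ 2 <= psi x ^+ 2.
    rewrite sqr_ge0/= /w0 exprMn -[leRHS]mul1r ler_wpM2r ?sqr_ge0//.
    rewrite -(real_normK (num_real (cc x))) -[leRHS](expr1n _ 2).
    by apply: lerXn2r; rewrite ?nnegrE.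
  have := sqr_ge0 (psi x); move/andP: h2 => [h2 h3] h4.
  by rewrite ler_norml; apply/andP; split; lra.
have xl3 : l / 3 <= `|x|.
  by rewrite leNgt ltr_norml; apply/negP => /andP[h1 h2]; move/negP: hx; apply; apply/andP; split; lra.
have -> : periodize l w0 x = 0.
  have pw := periodize_periodic l0 nw.
  move: hx xl; rewrite negb_and -ltNge -leNgt ler_norml => /orP[] hx /andP[xl1 xl2].
    rewrite -(pw x) periodize_id//; last by apply/andP; split; lra.
    by apply: w0z; rewrite ger0_norm; lra.
  rewrite -(subrK (2 * l) x) (pw (x - 2 * l)) periodize_id//; last by apply/andP; split; lra.
  by apply: w0z; rewrite ler0_norm; lra.
by rewrite expr0n/= sub0r normrN ger0_norm ?sqr_ge0//; exact: sqe.
Qed.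

(** What remains on inserting c psi into the equation and using psi'' = W psi - psi^3. *)
Definition truncation_residual c c1 c2 x :=
  c x * psi x ^+ 3 - (c x * psi x) ^+ 3 - c2 x * psi x - 2 * (c1 x * p x).

(* The solution operator of the linearization at psi is localized to one period
   and its outputs are periodized. On the period cell this inverts the
   linearization at the periodized soliton up to a small error, and periodicity
   takes care of the equation elsewhere. *)
Lemma periodic_solution_near : exists K r0 l1, [/\ 0 <= K, 0 < r0, 0 < l1 &
  forall l cc cc1 cc2 r, l1 <= l -> periodic W (2 * l) -> cutoff cc cc1 cc2 1 ->
  (forall x, `|x| < l / 3 -> cc x = 1) ->
  (forall x, 3 * l / 4 <= `|x| -> [/\ cc x = 0, cc1 x = 0 & cc2 x = 0]) ->
  nb (truncation_residual cc cc1 cc2) r -> r <= r0 ->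
  exists a a1 a2, [/\ periodic a (2 * l), W1 a a1, W1 a1 a2,
    [/\ nb (a \_ `]0, 2 * l[) (K * r), nb (a1 \_ `]0, 2 * l[) (K * r) &
       nb (a2 \_ `]0, 2 * l[) (K * r)] &
    exists q, W1 (fun x => periodize l (fun y => cc y * psi y) x + a x) q /\
      W1 q (fun x => W x * (periodize l (fun y => cc y * psi y) x + a x)
        - (periodize l (fun y => cc y * psi y) x + a x) ^+ 3)]].
Proof.
(* [wrap l 2] sums four translates, each bounded in sup norm by 2 (2 C0 K). *)
have C16 : 0 <= 16 * C0 by rewrite mulr_ge0.
have Bpsi0 : 0 <= Bpsi by apply: le_trans (psiB 0); exact: normr_ge0.
have [r1 [r10 hr1]] := small_radius Bpsi0 C16.
(* d bounds both the tail of psi and the derivatives of the cell cut-off. The defect of the four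
   translates, 4 (3 d + 3 d) C0 K, must be at most K / 4, that is, d C0 <= 1/96. *)
pose d : R := 1 / (96 * (C0 + 1)).
have d0 : 0 < d by rewrite divr_gt0// mulr_gt0// ltr_wpDl.
have dC : d * C0 <= 1 / 96.
  rewrite /d mulrAC mul1r ler_pdivrMr ?mulr_gt0 ?ltr_wpDl//; lra.
have d1 : d <= 1.
  rewrite /d ler_pdivrMr ?mulr_gt0 ?ltr_wpDl//; lra.
have [Wpsi Wp Lpsi Lp Lh] := Hpsi.
have [rt hrt] := W1_vanishing Wpsi Lpsi Lp d0.
have four K : 2 * 2%:R * K = 4 * K by rewrite -[2%:R]/(2 : R); ring.
have ar1 K e : 0 <= K -> e <= d -> 4 * ((3 * d + 3 * e) * C0 * K) <= K / 4.
  move=> K0 ed; have eC : e * C0 <= d * C0 by exact: ler_wpM2r.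
  have : (3 * d + 3 * e) * C0 <= 1 / 16 by lra.
  by move=> /(ler_wpM2r K0); lra.
have ar2 K : 0 <= K -> 4 * (C0 * K) <= 16 * C0 * K.
  by move=> K0; have := mulr_ge0 C00 K0; lra.
have ar3 K e : 0 <= K -> e <= d -> (1 + e) * C0 * K <= 2 * (C0 * K).
  by move=> K0 ed; rewrite -mulrA; apply: ler_wpM2r; [exact: mulr_ge0|lra].
have ar4 r e : 0 <= r -> e <= d -> [/\ 4 * (C0 * (4 * r)) <= 64 * C0 * r,
    4 * ((1 + e) * C0 * (4 * r)) <= 64 * C0 * r &
    4 * ((3 * e + 1) * C0 * (4 * r)) <= 64 * C0 * r].
  move=> r0 ed; have CK := mulr_ge0 C00 r0.
  have : e * (C0 * r) <= 1 * (C0 * r) by apply: ler_wpM2r => //; exact: le_trans ed d1.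
  by move=> h1; split; lra.
have kd0 : 0 <= 16 * k / d by apply: divr_ge0; [exact: mulr_ge0|exact: ltW].
have rt0 := normr_ge0 rt; have rtn := ler_norm rt.
(* The factor 64 is 4 translates times the radius 4 r times 3 d + 1 <= 4. The bound on l gives the
   hypotheses of [cell_cutoff], then 16 k / l <= d, then l / 3 beyond the tail radius [rt]. *)
exists (64 * C0), r1, (4 + 4 * k + 16 * k / d + 3 * `|rt|); split=> //.
- by rewrite mulr_ge0.
- have : 0 <= 4 * k by rewrite mulr_ge0.
  by lra.
move=> l cc cc1 cc2 r ll pW ccc cc_1 cc_0 nres rr1.
have k40 : 0 <= 4 * k by rewrite mulr_ge0.
have l0 : 0 < l by lra.
have r0 := nb_ge0 nres.
have [l4 kl] : 4 <= l /\ 4 * k <= l by split; lra.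
have dl : 16 * k / l <= d.
  by rewrite ler_pdivrMr// [d * l]mulrC -ler_pdivrMr//; lra.
have l52 : 2 * l <= 5 * l / 2 by lra.
have l54 : 5 * l / 4 < 3 * l / 2 by lra.
have tail x : l / 3 <= `|x| -> `|psi x| <= d by move=> xl; apply: hrt; lra.
have [Wcc Wcc1 ccB cc1B cc2B] := ccc.
set res := truncation_residual cc cc1 cc2 in nres.
pose w0 x := cc x * psi x.
pose w1 x := cc1 x * psi x + cc x * p x.
pose w2 x := cc2 x * psi x + 2 * (cc1 x * p x) + cc x * h x.
have Hw : H2 w0 w1 w2 := H2_cutoff ccc Hpsi.
have [Ww0 Ww1 Lw0 Lw1 Lw2] := Hw.
have w2E x : w2 x = W x * w0 x - w0 x ^+ 3 - res x.
  by rewrite /w2 /w0 /res /truncation_residual eqpsi; ring.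
have w0B x : `|w0 x| <= Bpsi.
  by rewrite /w0 normrM -[leRHS]mul1r; apply: ler_pM.
have nar v : (forall x, 3 * l / 4 <= `|x| -> v x = 0) -> narrow l v.
  by move=> v0 x xl; apply: v0; lra.
have n0 : narrow l w0 by apply: nar => x /cc_0[h0 _ _]; rewrite /w0 h0 mul0r.
have n1 : narrow l w1.
  by apply: nar => x /cc_0[h0 h1 _]; rewrite /w1 h0 h1 !mul0r addr0.
have n2 : narrow l w2.
  by apply: nar => x /cc_0[h0 h1 h2]; rewrite /w2 h0 h1 h2 !mul0r mulr0 !addr0.
have [WP1 WP2] := (periodize_W1 l0 n0 n1 Ww0, periodize_W1 l0 n1 n2 Ww1).
set wP := periodize l w0 in WP1 *.
pose Q x := W x - 3 * wP x ^+ 2.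
pose Q0 x := W x - 3 * psi x ^+ 2.
have pwP : periodic wP (2 * l) := periodize_periodic l0 n0.
have pQ : periodic Q (2 * l) by move=> x; rewrite /Q pW pwP.
have mQ : measurable_fun setT Q.
  apply: measurable_funB => //; apply: measurable_funM => //.
  by apply: measurable_funX; exact: W1_measurable WP1.
have mQ0 : measurable_fun setT Q0.
  apply: measurable_funB => //; apply: measurable_funM => //.
  by apply: measurable_funX; exact: W1_measurable Wpsi.
have [c [c1 [c2 [cc_ c_1 c_0]]]] := cell_cutoff l4 kl.
set dd := 16 * k / l in cc_ dl.
have dd0 : 0 <= dd by apply: divr_ge0; [exact: mulr_ge0|exact: ltW].
(* Half-open, so that the translates of the cell tile the line exactly. *)
pose chi x : R := (\1_(`[- l, l[ : set R) x).
have chiE x : - l <= x < l -> chi x = 1.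
  by move=> hx; rewrite /chi indicE mem_set//= in_itv.
have chi0 x : ~~ (- l <= x < l) -> chi x = 0.
  by move=> hx; rewrite /chi indicE memNset//= in_itv/=; exact/negP.
have chiB x : `|chi x| <= 1.
  by have [/chiE->|/chi0->] := boolP (- l <= x < l); rewrite ?normr1 ?normr0.
have cchi x : c x * chi x = chi x.
  have [hx|/chi0->] := boolP (- l <= x < l); last by rewrite mulr0.
  by rewrite c_1 ?mul1r//; move/andP: hx => [-> /ltW].
have mchi : measurable_fun setT chi by exact: measurable_indic.
have cB : forall x, `|c x| <= 1 by case: cc_.
have eQ x : `|c x * (Q x - Q0 x)| <= 3 * d.
  have [xl|xl] := leP `|x| (5 * l / 4); last first.
    by have [-> _ _] := c_0 x xl; rewrite mul0r normr0 mulr_ge0// ltW.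
  have -> : Q x - Q0 x = 3 * (psi x ^+ 2 - wP x ^+ 2) by rewrite /Q /Q0; ring.
  have cc0' y : 3 * l / 4 <= `|y| -> cc y = 0 by case/cc_0.
  have hw := periodized_potential l0 ccB cc_1 cc0' tail xl.
  have dd2 : d ^+ 2 <= d by rewrite expr2 -[leRHS]mulr1 ler_wpM2l// ltW.
  rewrite normrM -[leRHS]mul1r; apply: ler_pM => //.
  by rewrite normrM ger0_norm// ler_pM2l// distrC; exact: le_trans hw dd2.
have [SU [SP [SH [E [S1 S2 S3 S4]]]]] :=
  localized_solver iQ cc_ mQ mQ0 mchi chiB cchi eQ C00.
have narS f : narrow l (SU f) /\ narrow l (SP f) /\ narrow l (SH f).
  have hx (x : R) : 3 * l / 2 <= `|x| -> 5 * l / 4 < `|x| by exact: lt_le_trans.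
  by split; [|split] => x /hx /c_0[h0 h1 h2]; have [] := S4 f x h0 h1 h2.
(* Restriction to the cell keeps the fixed point in L^2 of the line. There [wrap l 2] already equals
   the full periodization. *)
pose A f x := chi x * wrap l 2 (SU f) x.
pose F f x := chi x * wrap l 2 (E f) x.
have chi_nb u K : nb u K -> nb (fun x => chi x * wrap l 2 u x) (4 * K).
  move=> nu; rewrite -[4 * K]mul1r; apply: nb_bounded_mul => //.
  by rewrite -four; exact: wrap_nb.
have chi_nbB u v K : nb (fun x => u x - v x) K ->
    nb (fun x => chi x * wrap l 2 u x - chi x * wrap l 2 v x) (4 * K).
  by move/chi_nb; apply: eq_nb => x; rewrite wrapB mulrBr.
have mw0 : measurable_fun setT w0 by exact: W1_measurable Ww0.
have [||||||f [nf ef]] := @nonlinear_fixpoint _ A F w0 res Bpsi (16 * C0) r C16 mw0 w0B nres.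
- move=> f K nf; have [nU _ _ _] := S2 f K nf.
  by apply: nb_le (chi_nb _ _ nU) (ar2 _ (nb_ge0 nf)).
- move=> f K x nf; have [nU nP _ _] := S2 f K nf.
  have K0 := nb_ge0 nf; have CK0 := mulr_ge0 C00 K0.
  have [[WU _ _ _ _] _] := S1 f (nb_L2 nf).
  have supU y : `|SU f y| <= 2 * (2 * (C0 * K)).
    by apply: W1_sup WU _ _; [apply: nb_le nU _; rewrite mulr_natl mulr2n lerDl|exact: nb_le nP (ar3 _ _ K0 dl)].
  have := wrap_bounded l 2 x supU; rewrite four => hw.
  rewrite /A normrM -[leRHS]mul1r; apply: ler_pM => //.
  by apply: le_trans hw _; rewrite le_eqVlt; apply/orP; left; apply/eqP; ring.
- move=> f g K Lf Lg nfg; have [nU _ _] := S3 f g K Lf Lg nfg.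
  by apply: nb_le (chi_nbB _ _ _ nU) (ar2 _ (nb_ge0 nfg)).
- move=> f K nf; have [_ _ nE _] := S2 f K nf.
  by apply: nb_le (chi_nb _ _ nE) (ar1 _ _ (nb_ge0 nf) dl).
- move=> f g K Lf Lg nfg; have [_ _ nE] := S3 f g K Lf Lg nfg.
  by apply: nb_le (chi_nbB _ _ _ nE) (ar1 _ _ (nb_ge0 nfg) dl).
- exact: hr1.
have [HS SE] := S1 f (nb_L2 nf).
have [WU WP _ _ _] := HS.
have [nU [nP nH]] := narS f.
have Wa := periodize_W1 l0 nU nP WU; have Wa1 := periodize_W1 l0 nP nH WP.
have pU := periodize_periodic l0 nU; have pH := periodize_periodic l0 nH.
have pw2 := periodize_periodic l0 n2.
set a := periodize l (SU f) in Wa pU *.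
set a2 := periodize l (SH f) in Wa1 pH *.
exists a, (periodize l (SP f)), a2; split=> //.
- have [bU bP _ bH] := S2 f _ nf.
  have restr v K : narrow l v -> nb v K -> 4 * K <= 64 * C0 * r ->
      nb (periodize l v \_ `]0, 2 * l[) (64 * C0 * r).
    move=> nv bv h4.
    have bw : nb (wrap l 2 v) (64 * C0 * r).
      by apply: nb_le (wrap_nb l 2 bv) _; rewrite four.
    apply: (nb_dom1 bw).
      apply/(measurable_restrictT _ _).1 => //; apply: measurable_funTS.
      by apply: periodize_measurable => //; exact: nb_measurable bv.
    move=> x; rewrite patchE; case: ifPn => [|_]; last by rewrite normr0.
    rewrite inE/= in_itv/= => /andP[x0 xl]; by rewrite periodize2// (ger0_norm (ltW x0)); exact: le_trans (ltW xl) l52.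
  have [h1 h2 h3] := ar4 _ _ r0 dl.
  split; [exact: restr nU bU h1|exact: restr nP bP h2|exact: restr nH bH h3].
- exists (fun x => periodize l w1 x + periodize l (SP f) x); split; first exact: W1D.
  apply: (W1_ae (W1D WP2 Wa1)).
    have mz : measurable_fun setT (fun x => wP x + a x).
      by apply: measurable_funD; [exact: W1_measurable WP1|exact: W1_measurable Wa].
    by apply: measurable_funB; [exact: measurable_funM|exact: measurable_funX].
  (* All functions involved have period 2 l, so the equation is needed only on the cell, where the
     fixed-point identity is available. *)
  apply: (ae_periodic l0); first by move=> x; rewrite pw2 pH pW pwP pU.
  apply: (ae_imp _ ef) => x fx hx.
  have xs := inside_cell hx.
  have wPx : wP x = w0 x.
    by apply: periodize_id => // y /(outside_cell l0)/cc_0[h0 _ _]; rewrite /w0 h0 mul0r.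
  have -> : periodize l w2 x = w2 x.
    apply: periodize_id => // y /(outside_cell l0)/cc_0[h0 h1 h2].
    by rewrite /w2 h0 h1 h2 !mul0r mulr0 !addr0.
  have ax : a x = wrap l 2 (SU f) x by exact: periodize2.
  have a2x : a2 x = wrap l 2 (SH f) x by exact: periodize2.
  have chif : wrap l 2 (fun y => chi y * f y) x = f x.
    have z y : y < - l \/ l <= y -> chi y * f y = 0.
      move=> hy; rewrite chi0 ?mul0r//; apply/negP => /andP[].
      by case: hy => [/lt_geF->|/le_gtF->].
    rewrite -periodize2//; first by rewrite periodize_id// chiE// mul1r.
    exact: cell_narrow.
  (* The localized identity summed over translates: Q is periodic and passes through [wrap], and on
     the cell the sum of the pieces of f is f. *)
  have key : Q x * a x - a2 x = f x + wrap l 2 (E f) x.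
    rewrite ax a2x -(wrapM 2 _ _ pQ) -wrapB -chif -wrapD.
    by congr wrap; apply/funext => y; exact: SE.
  move: fx; rewrite /A /F chiE// !mul1r -ax w2E wPx => fx.
  move: key; rewrite /Q wPx => key.
  have -> : a2 x = (W x - 3 * w0 x ^+ 2) * a x - (f x + wrap l 2 (E f) x) by rewrite -key; ring.
  by rewrite fx; ring.
Qed.

(** The residual vanishes for |x| < l / 3 and is dominated by a fixed L^2 function built from psi
    and psi', so its norm is a tail, uniformly in the cut-off. *)
Lemma truncation_residual_small e : 0 < e -> exists l1, forall l c c1 c2, l1 <= l ->
  cutoff c c1 c2 1 ->
  (forall x, `|x| < l / 3 -> [/\ c x = 1, c1 x = 0 & c2 x = 0]) ->
  nb (truncation_residual c c1 c2) e.
Proof.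
move=> e0.
have [Wpsi Wp Lpsi Lp Lh] := Hpsi.
pose f x := (2 * Bpsi ^+ 2 + 1) * `|psi x| + 2 * `|p x|.
have Labs v : L2 v -> L2 (fun x => `|v x|).
  move=> Lv; have [mv _] := Lv.
  have [] : nb (fun x => `|v x|) (nrm v) => //.
  apply: nb_dom1 (nb_nrm Lv) _ _; first exact: measurableT_comp.
  by move=> x; rewrite normr_id.
have Lf : L2 f by apply: L2D; apply: L2Z; exact: Labs.
have [r0 hr] := L2_tail Lf e0.
exists (3 * r0) => l c c1 c2 ll [Wc Wc1 cB c1B c2B] c_1.
have mc2 : measurable_fun setT c2 by case: Wc1 => -[].
have mc := W1_measurable Wc; have mc1 := W1_measurable Wc1.
have mpsi := W1_measurable Wpsi; have mp := W1_measurable Wp.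
apply: (hr _ (l / 3)); first by lra.
- apply: measurable_funB.
    apply: measurable_funB; last exact: measurable_funM.
    apply: measurable_funB; last by apply: measurable_funX; exact: measurable_funM.
    by apply: measurable_funM => //; exact: measurable_funX.
  by apply: measurable_funM => //; exact: measurable_funM.
- move=> x; rewrite /f [leRHS]ger0_norm; last first.
    by rewrite addr_ge0// mulr_ge0// addr_ge0// mulr_ge0// exprn_ge0//; apply: le_trans (psiB 0).
  have Bx := psiB x; have B0 : 0 <= Bpsi by exact: le_trans Bx.
  have mul1 (u v : R) : `|u| <= 1 -> `|u * v| <= `|v|.
    by move=> u1; rewrite normrM -[leRHS]mul1r ler_wpM2r.
  have cube : `|psi x ^+ 3| <= Bpsi ^+ 2 * `|psi x|.
    rewrite exprSr normrM ler_wpM2r// normrX; apply: lerXn2r; rewrite ?nnegrE//.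
  apply: le_trans (ler_normB _ _) _; apply: lerD; last first.
    by rewrite normrM ger0_norm// ler_pM2l//; exact: mul1.
  apply: le_trans (ler_normB _ _) _; rewrite mulrDl mul1r; apply: lerD; last exact: mul1.
  apply: le_trans (ler_normB _ _) _.
  have -> : 2 * Bpsi ^+ 2 * `|psi x| = Bpsi ^+ 2 * `|psi x| + Bpsi ^+ 2 * `|psi x| by ring.
  apply: lerD; first exact: le_trans (mul1 _ _ (cB x)) cube.
  rewrite exprMn; apply: le_trans (mul1 _ _ _) cube.
  by rewrite normrX -[leRHS](expr1n _ 3); apply: lerXn2r; rewrite ?nnegrE.
- move=> x /c_1[h0 h1 h2]; rewrite /truncation_residual h0 h1 h2; ring.
Qed.

End periodic_solutions.

(** * Existence *)

Section existence.
Context {R : realType}.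
Local Notation mu := (@lebesgue_measure R).

Lemma cvge0 (u : nat -> \bar R) : (forall n, (0 <= u n)%E) ->
  (forall e : R, 0 < e -> exists N, forall n, (N <= n)%N -> (u n <= e%:E)%E) ->
  u n @[n --> \oo] --> 0%E.
Proof.
move=> u0 ue; apply/fine_cvgP; split.
  have [N hN] := ue 1 ltr01; exists N => // n /= /hN un.
  by rewrite ge0_fin_numE//; exact: le_lt_trans un (ltry _).
apply/cvgrPdist_le => e e0; have [N hN] := ue e e0.
exists N => // n /= /hN un; rewrite sub0r normrN ger0_norm ?fine_ge0//.
by rewrite -lee_fin fineK// ge0_fin_numE//; exact: le_lt_trans un (ltry _).
Qed.

Lemma continuous_periodic_bounded (T : R) (V : R -> R) : 0 < T -> continuous V ->
  periodic V T -> exists B, forall x, `|V x| <= B.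
Proof.
move=> T0 cV pV; have l0 : 0 < T / 2 by rewrite divr_gt0.
have TE : 2 * (T / 2) = T by rewrite mulrC divfK.
have [M [_ hM]] := compact_bounded (continuous_compact
  (continuous_subspaceT cV) (@segment_compact R (- (T / 2)) (T / 2))).
have key y : - (T / 2) <= y < T / 2 -> `|V y| <= M + 1.
  move=> /andP[y1 y2]; apply: (hM (M + 1)); first by rewrite ltrDl.
  by exists y => //=; rewrite in_itv/= y1 ltW.
exists (M + 1) => x; have [n [hn|hn]] := reduce_period l0 x.
  by rewrite TE in hn; rewrite -(periodic_subn n pV); exact: key.
by rewrite TE in hn; rewrite -(periodic_mulrn n pV); exact: key.
Qed.

Context (b : R -> R) (sb : smooth b) (b01 : forall x, 0 <= b x <= 1)
  (b1 : forall x, `|x| <= 1 -> b x = 1) (b0 : forall x, 2 <= `|x| -> b x = 0).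
Context (omega mu0 T BW : R) (V W psi0 : R -> R) (T0 : 0 < T)
  (WE : forall x, W x = mu0 * V x + omega) (pW : periodic W T)
  (mV : measurable_fun setT V) (mW : measurable_fun setT W)
  (WB : forall x, `|W x| <= BW)
  (Hpsi0 : in_H2 psi0) (npsi0 : nondegenerate_solution omega mu0 V psi0).

(** The equation holds only almost everywhere for psi0. Passing to the continuous representative and
    changing the second derivative on a null set makes it an identity. *)
Lemma nondegenerate_profile : exists psi p Bpsi C,
  [/\ H2 psi p (fun x => W x * psi x - psi x ^+ 3),
    {ae mu, forall x, psi0 x = psi x}, measurable_fun setT psi0,
    forall x, `|psi x| <= Bpsi & 0 <= C /\ Inv (fun x => W x - 3 * psi x ^+ 2) C].
Proof.
have [psi [p [Hu e0 e1 m0]]] := in_H2_H2 sb b01 b1 b0 Hpsi0.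
have [Wpsi _ Lpsi Lp _] := Hu.
have [B hB] := W1_bounded Wpsi Lpsi Lp.
have mpsi := W1_measurable Wpsi.
have [C [C0 iC]] := Inv_of_nondegenerate sb b01 b1 b0 WE mV WB e0 mpsi
  (ex_intro _ B hB) npsi0.
have [[_ eqn] _ _] := npsi0.
exists psi, p, B, C; split=> //.
apply: (H2_ae Hu).
  by apply: measurable_funB; [exact: measurable_funM|exact: measurable_funX].
apply: (ae_imp _ (ae_and eqn e0)) => x [h1 h2].
rewrite -h2 WE; lra.
Qed.

Context (s : R -> R) (k : R) (ss : smooth s) (sB : forall x, `|s x| <= 1)
  (s1 : forall x, x <= 1 -> s x = 1) (s0 : forall x, 2 <= x -> s x = 0) (k0 : 0 <= k)
  (sk : forall x, `|derive1 s x| <= k /\ `|derive1 (derive1 s) x| <= k).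

Lemma multi_bump_existence (theta : nat -> R) M : (forall j, theta j ^+ 2 = 1) ->
  exists N (a : nat -> R -> R), (forall n, (N <= n)%N ->
    nondegenerate_solution omega mu0 V (fun x =>
      \sum_(0 <= j < M) theta j * psi0 (x - j.+1%:R * n%:R * T) + a n x) /\
    in_H2 (a n)) /\
  H2norm [set: R] (a n) @[n --> \oo] --> 0%E.
Proof.
move=> th2; have [psi [p [B [C0 [Hpsi e0 m0 psiB [C00 iQ]]]]]] := nondegenerate_profile.
have B0 : 0 <= B by apply: le_trans (psiB 0).
have [C [N1 [C_0 iC]]] := bumps_Inv T0 pW mW WB Hpsi psiB iQ C00 ss sB s1 s0 k0 sk th2 M.
have MB0 : 0 <= M%:R * B by rewrite mulr_ge0.
have [K [r0 [K0 r00 nonlin]]] := Inv_nonlinear mW WB MB0 C_0.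
have small := bumps_residual_small T0 Hpsi psiB th2 M.
have [N2 hN2] := small r0 r00.
pose res := bumps_residual T psi theta M.
pose f n x := \sum_(0 <= j < M) theta j * psi0 (x - j.+1%:R * n%:R * T).
(* The bound is in terms of the actual residual rather than r0: the sequence is chosen once and must
   both exist and converge. *)
pose good n (a : R -> R) := (maxn N1 N2 <= n)%N ->
  [/\ nondegenerate_solution omega mu0 V (fun x => f n x + a x), in_H2 a &
    (H2norm [set: R] a <= (2 * (K * nrm (res n)))%:E)%E].
have mpsi0s n j : measurable_fun setT (fun x : R => psi0 (x - j.+1%:R * n%:R * T)).
  by apply: measurableT_comp => //; exact: measurable_shift.
have fE n : {ae mu, forall x, f n x = bumps T psi theta M n x}.
  have a1 j := ae_shift (- (j.+1%:R * n%:R * T)) e0.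
  apply: (ae_imp _ (ae_foralln a1)) => x hx.
  by apply: eq_bigr => j _; rewrite /bump_at hx.
have [a ha] : {a : nat -> R -> R & forall n, good n (a n)}.
  apply: choice => n; have [Nn|Nn] := leqP (maxn N1 N2) n; last first.
    by exists (fun=> 0) => nN; move: Nn; rewrite ltnNge nN.
  move: Nn; rewrite geq_max => /andP[n1 n2].
  have [q Hq] := bumps_H2 pW Hpsi (fun=> erefl) theta M n.
  have nres := hN2 n n2.
  have rr : nrm (res n) <= r0 by case: nres.
  have [a [a1 [a2 [Ha [na na1 na2] [q' Hq'] [C' iC']]]]] :=
    nonlin _ _ _ _ (bumps_bounded T psiB th2 M n) Hq (iC n n1)
      (nb_nrm (nb_L2 nres)) rr.
  have [Wa Wa1 _ _ _] := Ha.
  have ma := W1_measurable Wa.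
  have mf : measurable_fun setT (fun x => f n x + a x).
    apply: measurable_funD => //; apply: measurable_sum => j.
    by apply: measurable_funM.
  have ea : {ae mu, forall x, a x = a x} by exact: aeW.
  exists a => _; split.
  - apply: (nondegenerate_of_Inv sb b01 b1 b0 WE mV WB mf _ Hq' iC').
    by apply: (ae_imp _ (fE n)) => x ->.
  - by have [] := H2_in_H2 sb b01 b1 b0 Ha ma ea.
  - by apply: (H2norm_le sb b01 b1 b0 measurableT Wa Wa1 ma ea); rewrite patch_setT.
exists (maxn N1 N2), a; split; first by move=> n /ha[].
apply: cvge0 => [n|e e0']; first exact: H2norm_ge0.
have K1 : 0 < 2 * (K + 1) by rewrite mulr_gt0// ltr_wpDl.
have [N3 hN3] := small (e / (2 * (K + 1))) (divr_gt0 e0' K1).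
exists (maxn (maxn N1 N2) N3) => n; rewrite geq_max => /andP[/ha[_ _ hn] /hN3[_ h3]].
apply: le_trans hn _; rewrite lee_fin; move: h3; rewrite ler_pdivlMr// => h3.
apply: le_trans h3; have := nrm_ge0 (res n); rewrite -/(res n); lra.
Qed.

Lemma periodic_existence (chi : nat -> R -> R) n0 :
  (forall n, (n0 <= n)%N -> is_cutoff T n (chi n)) ->
  exists N (psiper a : nat -> R -> R), (forall n, (N <= n)%N ->
    [/\ periodic (psiper n) (n%:R * T), is_solution omega mu0 V (psiper n),
      in_H2per (n%:R * T) (a n) &
      forall x, - (n%:R / 2 * T) <= x < n%:R / 2 * T ->
        psiper n x = chi n x * psi0 x + a n x]) /\
  H2per_norm (n%:R * T) (a n) @[n --> \oo] --> 0%E.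
Proof.
move=> hchi; have [psi [p [B [C0 [Hpsi e0 m0 psiB [C00 iQ]]]]]] := nondegenerate_profile.
have [K [r0 [l1 [K0 r00 l10 near]]]] :=
  periodic_solution_near mW Hpsi (fun=> erefl) psiB iQ C00 ss sB s1 s0 k0 sk.
have small := truncation_residual_small Hpsi psiB.
have [l2 hl2] := small r0 r00.
have T2 : 0 < T / 2 by rewrite divr_gt0.
pose l n : R := n%:R / 2 * T.
have large X : exists N, forall n, (N <= n)%N -> X <= l n.
  have [N hN] := large_multiple X T2; exists N => n /hN h.
  by rewrite /l mulrAC -mulrA.
have lE n : 2 * l n = n%:R * T by rewrite /l; field.
have [N1 hN1] := large l1; have [N2 hN2] := large l2.
(* The successor forces n > 0, so that the half period [l n] is positive. *)
pose N := maxn n0.+1 (maxn N1 N2).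
pose close n c c1 c2 := cutoff c c1 c2 1 /\
  forall x, `|x| < l n / 3 -> [/\ c x = 1, c1 x = 0 & c2 x = 0].
pose good n (ua : (R -> R) * (R -> R)) := (N <= n)%N ->
  [/\ [/\ periodic ua.1 (n%:R * T), is_solution omega mu0 V ua.1,
      in_H2per (n%:R * T) ua.2 &
      forall x, - l n <= x < l n -> ua.1 x = chi n x * psi0 x + ua.2 x] &
    (* The truncation is internal to the choice of the solution, so the estimate is stated against
       any e valid for all truncations at n. *)
    forall e, (forall c c1 c2, close n c c1 c2 -> nb (truncation_residual psi p c c1 c2) e) ->
      (H2per_norm (n%:R * T) ua.2 <= (2 * (K * e))%:E)%E].
have [ua hua] : {ua : nat -> (R -> R) * (R -> R) & forall n, good n (ua n)}.
  apply: choice => n; have [Nn|Nn] := leqP N n; last first.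
    by exists (fun=> 0, fun=> 0) => nN; move: Nn; rewrite ltnNge nN.
  move: Nn; rewrite /N !geq_max => /and3P[n_0 n1 n2].
  have n_gt0 : (0 < n)%N by exact: leq_ltn_trans n_0.
  have ln0 : 0 < l n by rewrite mulr_gt0// divr_gt0// ltr0n.
  have [c [c1 [c2 [cc cchi c_1 c_0]]]] := truncated_cutoff T0 n_gt0 (hchi n (ltnW n_0)).
  rewrite -/(l n) in cchi c_1 c_0.
  have clc : close n c c1 c2 by [].
  have nres := hl2 _ _ _ _ (hN2 n n2) cc c_1.
  have rr : nrm (truncation_residual psi p c c1 c2) <= r0 by case: nres.
  have pWl : periodic W (2 * l n) by move=> x; rewrite lE; exact: periodic_mulrn.
  have c_1' x : `|x| < l n / 3 -> c x = 1 by case/c_1.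
  have [a [a1 [a2 [pa Wa Wa1 [na na1 na2] [q [Wq Wq']]]]]] :=
    near (l n) _ _ _ _ (hN1 n n1) pWl cc c_1' c_0 (nb_nrm (nb_L2 nres)) rr.
  have ma := W1_measurable Wa.
  have ea : {ae mu, forall x, a x = a x} by exact: aeW.
  have mc : measurable_fun setT c by case: cc => /W1_measurable.
  have zero (v : R -> R) y : y < - l n \/ l n <= y -> c y * v y = 0.
    by move=> /(outside_cell ln0)/c_0[-> _ _]; rewrite mul0r.
  have nar v : narrow (l n) (fun y => c y * v y).
    by apply: cell_narrow => // y; exact: (zero v).
  pose u x := periodize (l n) (fun y => c y * psi0 y) x + a x.
  have mu0' : measurable_fun setT u.
    apply: measurable_funD => //; apply: periodize_measurable => //.
    exact: measurable_funM.
  have eu : {ae mu, forall x, u x = periodize (l n) (fun y => c y * psi y) x + a x}.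
    have ecp : {ae mu, forall x, c x * psi0 x = c x * psi x}.
      by apply: (ae_imp _ e0) => x ->.
    by apply: (ae_imp _ (periodize_ae (l n) ecp)) => x; rewrite /u => ->.
  exists (u, a) => _; split; first split.
  - by move=> x; rewrite -lE /u/= pa periodize_periodic.
  - exact: (is_solution_of_W1 sb b01 b1 b0 WE mu0' eu Wq Wq').
  - split; first by rewrite -lE.
    by have [] := W1_in_H2loc sb b01 b1 b0 Wa Wa1 ma ea.
  - move=> x hx; rewrite /u/= periodize_id//; last exact: zero.
    by rewrite cchi.
  - move=> e /(_ _ _ _ clc)[_ he]; rewrite /H2per_norm.
    have KK : K * nrm (truncation_residual psi p c c1 c2) <= K * e by exact: ler_wpM2l.
    apply: (H2norm_le sb b01 b1 b0 (measurable_itv _) Wa Wa1 ma ea); rewrite -lE.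
    + exact: nb_le na KK.
    + exact: nb_le na1 KK.
    + exact: nb_le na2 KK.
exists N, (fun n => (ua n).1), (fun n => (ua n).2); split; first by move=> n /hua[].
apply: cvge0 => [n|e e0']; first exact: H2norm_ge0.
have K1 : 0 < 2 * (K + 1) by rewrite mulr_gt0// ltr_wpDl.
have e1 := divr_gt0 e0' K1.
have [l3 hl3] := small _ e1; have [N3 hN3] := large l3.
exists (maxn N N3) => n; rewrite geq_max => /andP[/hua[_ hn] /hN3 h3].
apply: le_trans (hn (e / (2 * (K + 1))) _) _.
  by move=> c c1 c2 [cc c_1]; exact: hl3 h3 cc c_1.
rewrite lee_fin mulrA mulrCA ler_piMr ?(ltW e0')// ler_pdivrMr// mul1r.
by rewrite ler_pM2l// lerDl.
Qed.

End existence.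

Unset Implicit Arguments.

Theorem corollary8p16 (R : realType) (T omega mu : R) (V : R -> R)
  (M : nat) (theta : 'I_M -> R) (psi0 : R -> R)
  (chi : nat -> R -> R) (n0 : nat)
  (hT : 0 < T)
  (hV : C1 V) (hVper : periodic V T)
  (htheta : forall j, theta j = 1 \/ theta j = -1)
  (hpsi0 : in_H2 psi0)
  (hnondeg : nondegenerate_solution omega mu V psi0)
  (hchi : forall n : nat, (n0 <= n)%N -> is_cutoff T n (chi n)) :
  exists N : nat,
    (exists psi a : nat -> R -> R,
      (forall n : nat, (N <= n)%N ->
        [/\ nondegenerate_solution omega mu V (psi n),
            in_H2 (a n) &
            forall x : R, psi n x =
              \sum_(j < M) theta j * psi0 (x - j.+1%:R * n%:R * T) + a n x])
      /\ (H2norm [set: R] (a n) @[n --> \oo] --> 0%E))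
    /\
    (exists psiper a : nat -> R -> R,
      (forall n : nat, (N <= n)%N ->
        [/\ periodic (psiper n) (n%:R * T),
            is_solution omega mu V (psiper n),
            in_H2per (n%:R * T) (a n) &
            forall x : R, - (n%:R / 2 * T) <= x < n%:R / 2 * T ->
              psiper n x = chi n x * psi0 x + a n x])
      /\ (H2per_norm (n%:R * T) (a n) @[n --> \oo] --> 0%E)).
Proof.
(* Index [n0.+1] is admissible and positive even if [n0 = 0]. *)
have [b [sb b01 b1 b0]] := bump_of_cutoff hT (ltn0Sn n0) (hchi _ (leqnSn n0)).
have [s [k [ss sB s1 s0 [k0 sk]]]] := step_function sb b01 b1 b0.
have cV : continuous V.
  move=> x; apply: differentiable_continuous; apply/derivable1_diffP.
  by case: hV.
have [BV VB] := continuous_periodic_bounded hT cV hVper.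
have mV : measurable_fun setT V by exact: continuous_measurable_fun.
pose W x := mu * V x + omega.
have WE x : W x = mu * V x + omega by [].
have pW : periodic W T by move=> x; rewrite /W hVper.
have mW : measurable_fun setT W.
  by apply: measurable_funD => //; exact: measurable_funM.
have WB x : `|W x| <= `|mu| * BV + `|omega|.
  by apply: le_trans (ler_normD _ _) _; rewrite lerD2r normrM ler_wpM2l.
(* The induction on the number of bumps needs signs indexed by all naturals; the default 1 keeps
   every square equal to 1. *)
pose th j := if insub j is Some i then theta i else 1.
have th2 j : th j ^+ 2 = 1.
  rewrite /th; case: insub => [i|]; last by rewrite expr1n.
  by case: (htheta i) => ->; rewrite ?sqrrN expr1n.
have [N1 [a1 [h1 c1]]] := multi_bump_existence sb b01 b1 b0 hT WE pW mV mW WB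
  hpsi0 hnondeg ss sB s1 s0 k0 sk M th2.
have [N2 [u2 [a2 [h2 c2]]]] := periodic_existence sb b01 b1 b0 hT WE pW mV mW WB
  hpsi0 hnondeg ss sB s1 s0 k0 sk hchi.
exists (maxn N1 N2); split.
  exists (fun n x => \sum_(0 <= j < M) th j * psi0 (x - j.+1%:R * n%:R * T) + a1 n x), a1.
  split; last exact: c1.
  move=> n; rewrite geq_max => /andP[/h1[nd ia] _].
  split; [exact: nd|exact: ia|] => x; rewrite big_mkord.
  by congr (_ + _); apply: eq_bigr => i _; rewrite /th valK.
exists u2, a2; split; last exact: c2.
by move=> n; rewrite geq_max => /andP[_ /h2].
Qed.
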